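(* Let $\mathcal M$ be a mean curvature function, let $\mathbb V^2$ be a compact oriented surface, $\alpha:\mathbb V^2\to\mathbb R^3$ an immersion of class $C^r$, $r\ge6$, and $c$ a closed $\mathcal M$-mean curvature line of $\alpha$, parametrized by arc length $s$ and of total length $L$. Then the derivative of the Poincaré map $\pi_\alpha$ associated to $c$ is given by $$\ln\pi_\alpha'(0)=\int_0^L\left[\frac{[\mathcal M]_v}{2\tau_g}+\frac{k_g}{\tau_g}(\mathcal H-\mathcal M)\right]ds,$$ where $\tau_g=\pm\sqrt{(\mathcal M-k_1)(k_2-\mathcal M)}$.
   Context: $N$ is the positive unit normal of $\alpha$, $I_\alpha=E\,du^2+2F\,du\,dv+G\,dv^2$, $II_\alpha=e\,du^2+2f\,du\,dv+g\,dv^2$ the fundamental forms, $k_n=II_\alpha/I_\alpha$, $k_1\le k_2$ the principal curvatures, $\mathcal H=(k_1+k_2)/2$, $\mathcal K=k_1k_2$. A mean curvature function $\mathcal M=m(H,K)$ satisfies: (1) $(m-H)^2\le H^2-K$ on $H^2\ge K\ge 0$; (2) $m$ is continuous on $H^2\ge K\ge0$ and analytic on $K>0$; (3) $m(tH,t^2K)=t\,m(H,K)$ for $t\ge 0$. On the surface $\mathcal M$ also denotes $m(\mathcal H,\mathcal K)$. $\mathcal M$-mean curvature lines are the regular curves along which $k_n=\mathcal M$, i.e. solutions of $(g-\mathcal MG)dv^2+2(f-\mathcal MF)du\,dv+(e-\mathcal ME)du^2=0$, in the region $\mathcal K>0$ off the umbilic points. They form two transversal foliations, the minimal one (geodesic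 torsion $\tau_g=-\sqrt{(k_2-\mathcal M)(\mathcal M-k_1)}$) and the maximal one ($\tau_g=+\sqrt{(k_2-\mathcal M)(\mathcal M-k_1)}$); in the formula the sign of $\tau_g$ is $+$ if $c$ is maximal and $-$ if $c$ is minimal. Along $c$, $T=c'$ and $k_g$ is the geodesic curvature. The local chart $(s,v)$ near $c$ is the one in which $\alpha(s,v)=c(s)+v(N\wedge T)(s)+\left[(2\mathcal H(s)-\mathcal M(s))\frac{v^2}2+\frac{A(s)}6v^3+v^3B(s,v)\right]N(s)$ with $B(s,0)=0$; $[\mathcal M]_v$ is the derivative of $\mathcal M$ with respect to $v$ at $v=0$. The Poincaré map $\pi_\alpha:\{s=0\}\to\{s=L\}$ sends $v_0$ to $v(L,v_0)$, where $v(s,v_0)$ is the $\mathcal M$-mean curvature line (of the foliation containing $c$) with $v(0,v_0)=v_0$; $v=0$ corresponds to $c$. *)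

(* Defs.v *)
(* Stdlib reals and Coquelicot. *)
From Stdlib Require Import Reals List.
From Coquelicot Require Import Coquelicot.
Open Scope R_scope.

(** * Mean curvature functions *)

Definition curvature_domain (H K : R) : Prop := 0 <= K <= H ^ 2.

(** Real analyticity at [(H0, K0)] of a function given on [D] only: near that
    point it agrees on [D] with a double power series which converges
    absolutely on a bidisc of radius [rho]. *)
Definition analytic_within (D : R -> R -> Prop) (m : R -> R -> R)
    (H0 K0 : R) : Prop :=
  exists (a : nat -> nat -> R) (rho : R),
    0 < rho /\
    (forall i, ex_series (fun j => Rabs (a i j) * rho ^ j)) /\
    ex_series (fun i => Series (fun j => Rabs (a i j) * rho ^ j) * rho ^ i) /\
    forall h k, Rabs h < rho -> Rabs k < rho -> D (H0 + h) (K0 + k) ->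
      m (H0 + h) (K0 + k) = Series (fun i => Series (fun j => a i j * k ^ j) * h ^ i).

Record mean_curvature_function (m : R -> R -> R) : Prop := {
  mcf_bound : forall H K, curvature_domain H K -> (m H K - H) ^ 2 <= H ^ 2 - K;
  mcf_continuous : forall H K, curvature_domain H K ->
    filterlim (fun p : R * R => m (fst p) (snd p))
      (within (fun p : R * R => curvature_domain (fst p) (snd p)) (locally (H, K)))
      (locally (m H K));
  mcf_analytic : forall H K, curvature_domain H K -> 0 < K ->
    analytic_within curvature_domain m H K;
  mcf_homogeneous : forall t H K, 0 <= t -> curvature_domain H K ->
    m (t * H) (t ^ 2 * K) = t * m H K
}.

(** * Euclidean 3-space *)

Definition R3 : Type := (R * R * R)%type.

Definition x1 (p : R3) : R := fst (fst p).
Definition x2 (p : R3) : R := snd (fst p).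
Definition x3 (p : R3) : R := snd p.

Definition add3 (p q : R3) : R3 := (x1 p + x1 q, x2 p + x2 q, x3 p + x3 q).
Definition scal3 (t : R) (p : R3) : R3 := (t * x1 p, t * x2 p, t * x3 p).
Definition dot (p q : R3) : R := x1 p * x1 q + x2 p * x2 q + x3 p * x3 q.
Definition cross (p q : R3) : R3 :=
  (x2 p * x3 q - x3 p * x2 q,
   x3 p * x1 q - x1 p * x3 q,
   x1 p * x2 q - x2 p * x1 q).
Definition norm3 (p : R3) : R := sqrt (dot p p).

Definition Derive3 (c : R -> R3) (t : R) : R3 :=
  (Derive (fun s => x1 (c s)) t, Derive (fun s => x2 (c s)) t,
   Derive (fun s => x3 (c s)) t).

Definition ex_diff3_n (X : R -> R -> R3) (n : nat) (u v : R) : Prop :=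
  ex_diff_n (fun u v => x1 (X u v)) n u v /\
  ex_diff_n (fun u v => x2 (X u v)) n u v /\
  ex_diff_n (fun u v => x3 (X u v)) n u v.

(** * Local geometry of a parametrized surface [X : (u, v) |-> X u v] *)

Definition d_u (X : R -> R -> R3) (u v : R) : R3 := Derive3 (fun t => X t v) u.
Definition d_v (X : R -> R -> R3) (u v : R) : R3 := Derive3 (fun t => X u t) v.

Definition unit_normal (X : R -> R -> R3) (u v : R) : R3 :=
  scal3 (/ norm3 (cross (d_u X u v) (d_v X u v))) (cross (d_u X u v) (d_v X u v)).

Definition ffE (X : R -> R -> R3) (u v : R) : R := dot (d_u X u v) (d_u X u v).
Definition ffF (X : R -> R -> R3) (u v : R) : R := dot (d_u X u v) (d_v X u v).
Definition ffG (X : R -> R -> R3) (u v : R) : R := dot (d_v X u v) (d_v X u v).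

Definition sfe (X : R -> R -> R3) (u v : R) : R :=
  dot (d_u (d_u X) u v) (unit_normal X u v).
Definition sff (X : R -> R -> R3) (u v : R) : R :=
  dot (d_v (d_u X) u v) (unit_normal X u v).
Definition sfg (X : R -> R -> R3) (u v : R) : R :=
  dot (d_v (d_v X) u v) (unit_normal X u v).

(** The fundamental forms at [X u v], as bilinear forms on the coordinate
    tangent vectors [(a, b)], [(a', b')]. *)
Definition form1 (X : R -> R -> R3) (u v a b a' b' : R) : R :=
  ffE X u v * a * a' + ffF X u v * (a * b' + b * a') + ffG X u v * b * b'.
Definition form2 (X : R -> R -> R3) (u v a b a' b' : R) : R :=
  sfe X u v * a * a' + sff X u v * (a * b' + b * a') + sfg X u v * b * b'.

Definition normal_curvature (X : R -> R -> R3) (u v du dv : R) : R :=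
  form2 X u v du dv du dv / form1 X u v du dv du dv.

(** The principal curvatures are the roots [k] of
    [det (II - k I) = qa k^2 - qb k + qc]. *)
Definition qa (X : R -> R -> R3) (u v : R) : R :=
  ffE X u v * ffG X u v - ffF X u v ^ 2.
Definition qb (X : R -> R -> R3) (u v : R) : R :=
  sfe X u v * ffG X u v - 2 * sff X u v * ffF X u v + sfg X u v * ffE X u v.
Definition qc (X : R -> R -> R3) (u v : R) : R :=
  sfe X u v * sfg X u v - sff X u v ^ 2.

Definition k1 (X : R -> R -> R3) (u v : R) : R :=
  (qb X u v - sqrt (qb X u v ^ 2 - 4 * qa X u v * qc X u v)) / (2 * qa X u v).
Definition k2 (X : R -> R -> R3) (u v : R) : R :=
  (qb X u v + sqrt (qb X u v ^ 2 - 4 * qa X u v * qc X u v)) / (2 * qa X u v).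

Definition mean_curv (X : R -> R -> R3) (u v : R) : R := (k1 X u v + k2 X u v) / 2.
Definition gauss_curv (X : R -> R -> R3) (u v : R) : R := k1 X u v * k2 X u v.

Definition Mcurv (m : R -> R -> R) (X : R -> R -> R3) (u v : R) : R :=
  m (mean_curv X u v) (gauss_curv X u v).

(** Geodesic torsion [II (T, N /\ T)] of the unit vector [T] along
    [du X_u + dv X_v].  The coordinates of [N /\ (du X_u + dv X_v)] are
    [(- (F du + G dv) / w, (E du + F dv) / w)] with [w = sqrt (E G - F^2)].
    Along a curve this is the [tau_g] of the Darboux equations
    [(N /\ T)' = - k_g T + tau_g N]. *)
Definition geodesic_torsion (X : R -> R -> R3) (u v du dv : R) : R :=
  let w := sqrt (ffE X u v * ffG X u v - ffF X u v ^ 2) in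
  form2 X u v du dv
    (- (ffF X u v * du + ffG X u v * dv) / w)
    ((ffE X u v * du + ffF X u v * dv) / w)
  / form1 X u v du dv du dv.

Inductive foliation : Set := minimal | maximal.

Definition foliation_sign (fol : foliation) : R :=
  match fol with minimal => -1 | maximal => 1 end.

Definition tau_g (m : R -> R -> R) (X : R -> R -> R3) (fol : foliation)
    (u v : R) : R :=
  foliation_sign fol *
  sqrt ((Mcurv m X u v - k1 X u v) * (k2 X u v - Mcurv m X u v)).

(** The direction [(du, dv)] at [X u v] is tangent to the given foliation by
    M-mean curvature lines.  The strict inequalities say that the point is not
    umbilic and that the two foliations are transversal there. *)
Definition mean_curvature_direction (m : R -> R -> R) (X : R -> R -> R3)
    (fol : foliation) (u v du dv : R) : Prop :=
  0 < gauss_curv X u v /\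
  k1 X u v < Mcurv m X u v < k2 X u v /\
  (du, dv) <> (0, 0) /\
  normal_curvature X u v du dv = Mcurv m X u v /\
  geodesic_torsion X u v du dv = tau_g m X fol u v.

(** * Compact oriented surfaces *)

(** The coordinate change from [phi] to the parametrization [(D', phi')] is,
    near [(x, y)], of class C^k with positive Jacobian. *)
Definition coordinate_change {V : Type} (k : nat) (phi : R -> R -> V)
    (D' : R -> R -> Prop) (phi' : R -> R -> V) (x y : R) : Prop :=
  forall x' y', D' x' y' -> phi' x' y' = phi x y ->
  exists a b : R -> R -> R,
    a x y = x' /\ b x y = y' /\
    locally_2d (fun u v =>
      D' (a u v) (b u v) /\ phi' (a u v) (b u v) = phi u v /\
      ex_diff_n a k u v /\ ex_diff_n b k u v /\
      0 < Derive (fun t => a t v) u * Derive (fun t => b u t) v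
          - Derive (fun t => a u t) v * Derive (fun t => b t v) u) x y.

Definition injective_on {V : Type} (D : R -> R -> Prop) (phi : R -> R -> V) : Prop :=
  forall u v u' v', D u v -> D u' v' -> phi u v = phi u' v' -> u = u' /\ v = v'.

(** An open set for the topology that an atlas of parametrizations induces. *)
Definition atlas_open {V I : Type} (dom : I -> R -> R -> Prop)
    (par : I -> R -> R -> V) (O : V -> Prop) : Prop :=
  forall i x y, dom i x y -> O (par i x y) ->
    locally_2d (fun u v => O (par i u v)) x y.

(** A (Hausdorff, boundaryless) smooth oriented surface, given by an atlas of
    local parametrizations defined on open subsets of the plane. *)
Record oriented_surface (V : Type) : Type := {
  chart_index : Type;
  dom : chart_index -> R -> R -> Prop;
  par : chart_index -> R -> R -> V;
  dom_open : forall i x y, dom i x y -> locally_2d (dom i) x y;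
  par_inj : forall i, injective_on (dom i) (par i);
  par_cover : forall p, exists i x y, dom i x y /\ par i x y = p;
  par_compatible : forall (k : nat) i j x y, dom i x y ->
    coordinate_change k (par i) (dom j) (par j) x y;
  hausdorff_surface : forall p q : V, p <> q ->
    exists O O', atlas_open dom par O /\ atlas_open dom par O' /\
      O p /\ O' q /\ forall z, ~ (O z /\ O' z)
}.

Arguments chart_index {V} _.
Arguments dom {V} _ _ _ _.
Arguments par {V} _ _ _ _.

Definition compact_surface {V : Type} (S : oriented_surface V) : Prop :=
  forall C : (V -> Prop) -> Prop,
    (forall O, C O -> atlas_open (dom S) (par S) O) ->
    (forall p, exists O, C O /\ O p) ->
    exists l : list (V -> Prop),
      (forall O, In O l -> C O) /\ forall p, exists O, In O l /\ O p.

(** A positive local parametrization of class C^k, not necessarily in the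
    atlas. *)
Definition local_chart {V : Type} (S : oriented_surface V) (k : nat)
    (D : R -> R -> Prop) (phi : R -> R -> V) : Prop :=
  (forall x y, D x y -> locally_2d D x y) /\
  injective_on D phi /\
  forall i x y, D x y -> coordinate_change k phi (dom S i) (par S i) x y.

(** [alpha] read in the parametrization [phi]. *)
Definition in_chart {V : Type} (alpha : V -> R3) (phi : R -> R -> V)
  (u v : R) : R3 := alpha (phi u v).

Definition immersion {V : Type} (S : oriented_surface V) (r : nat)
    (alpha : V -> R3) : Prop :=
  forall i x y, dom S i x y ->
    ex_diff3_n (in_chart alpha (par S i)) r x y /\
    cross (d_u (in_chart alpha (par S i)) x y)
          (d_v (in_chart alpha (par S i)) x y) <> (0, 0, 0).

(** * Closed M-mean curvature lines *)

(** Near [s], the curve [c] is [t |-> phi (a t) (b t)] with [a], [b] of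
    class C^1. *)
Definition curve_coordinates {V : Type} (D : R -> R -> Prop) (phi : R -> R -> V)
    (c : R -> V) (s : R) (a b : R -> R) : Prop :=
  locally s (fun t =>
    D (a t) (b t) /\ phi (a t) (b t) = c t /\
    ex_derive a t /\ ex_derive b t /\
    continuous (Derive a) t /\ continuous (Derive b) t).

Definition C1_curve {V : Type} (S : oriented_surface V) (c : R -> V) : Prop :=
  forall s, exists i a b, curve_coordinates (dom S i) (par S i) c s a b.

(** The M-line equation is required in every positive chart in which it makes
    sense; it does not depend on the chart. *)
Definition mean_curvature_line {V : Type} (S : oriented_surface V)
    (alpha : V -> R3) (m : R -> R -> R) (fol : foliation) (c : R -> V) : Prop :=
  C1_curve S c /\
  forall D phi, local_chart S 2 D phi ->
  forall s a b, curve_coordinates D phi c s a b ->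
    mean_curvature_direction m (in_chart alpha phi) fol
      (a s) (b s) (Derive a s) (Derive b s).

Definition tangent {V : Type} (alpha : V -> R3) (c : R -> V) (s : R) : R3 :=
  Derive3 (fun t => alpha (c t)) s.

Record closed_mean_curvature_line {V : Type} (S : oriented_surface V)
    (alpha : V -> R3) (m : R -> R -> R) (fol : foliation)
    (c : R -> V) (L : R) : Prop := {
  cl_line : mean_curvature_line S alpha m fol c;
  cl_arc_length : forall s, norm3 (tangent alpha c s) = 1;
  cl_length_pos : 0 < L;
  cl_periodic : forall s, c (s + L) = c s;
  cl_simple : forall s t, 0 <= s < L -> 0 <= t < L -> c s = c t -> s = t
}.

(** * The chart [(s, v)] around [c], and the Poincare map *)

(** [Phi] is a chart of the annulus [(R / L Z) x (-eps, eps)], i.e. it is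
    L-periodic in [s] and its restriction to every strip of width L is a local
    chart.  The [N], [H], [M] along [c] are those of the surface at
    [c s = Phi s 0].  For C^r immersions the chart is of class C^(r-2); only
    three derivatives are asked for. *)
Record adapted_chart {V : Type} (S : oriented_surface V) (alpha : V -> R3)
    (m : R -> R -> R) (c : R -> V) (L eps : R) (Phi : R -> R -> V) : Prop := {
  ac_width : 0 < eps;
  ac_chart : forall s0,
    local_chart S 3 (fun s v => Rabs (s - s0) < L / 2 /\ Rabs v < eps) Phi;
  ac_periodic : forall s v, Rabs v < eps -> Phi (s + L) v = Phi s v;
  ac_curve : forall s, Phi s 0 = c s;
  ac_expansion : exists (A : R -> R) (B : R -> R -> R),
    (forall s, B s 0 = 0) /\
    (forall s v, Rabs v < eps -> continuity_2d_pt B s v) /\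
    forall s v, Rabs v < eps ->
      let X := in_chart alpha Phi in
      let T := tangent alpha c s in
      let N := unit_normal X s 0 in
      X s v =
        add3 (add3 (alpha (c s)) (scal3 v (cross N T)))
          (scal3 ((2 * mean_curv X s 0 - Mcurv m X s 0) * (v ^ 2 / 2)
                  + A s / 6 * v ^ 3 + v ^ 3 * B s v) N)
}.

(** [s |-> (s, v s)], [0 <= s <= L], is a line of the given foliation, in the
    coordinates [(s, v)] of [Phi]. *)
Definition chart_line {V : Type} (alpha : V -> R3) (m : R -> R -> R)
    (fol : foliation) (L eps : R) (Phi : R -> R -> V) (v : R -> R) : Prop :=
  forall s, 0 <= s <= L ->
    Rabs (v s) < eps /\ ex_derive v s /\
    mean_curvature_direction m (in_chart alpha Phi) fol s (v s) 1 (Derive v s).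

(** [P] is, near [0], the Poincare map from [s = 0] to [s = L]. *)
Definition poincare_map {V : Type} (alpha : V -> R3) (m : R -> R -> R)
    (fol : foliation) (L eps : R) (Phi : R -> R -> V) (P : R -> R) : Prop :=
  locally 0 (fun v0 => exists v : R -> R,
    chart_line alpha m fol L eps Phi v /\ v 0 = v0 /\ P v0 = v L).

(** [k_g = <T', N /\ T>] along [c]. *)
Definition geodesic_curvature {V : Type} (alpha : V -> R3) (c : R -> V)
    (Phi : R -> R -> V) (s : R) : R :=
  dot (Derive3 (tangent alpha c) s)
      (cross (unit_normal (in_chart alpha Phi) s 0) (tangent alpha c s)).

Definition Mcurv_v {V : Type} (alpha : V -> R3) (m : R -> R -> R)
    (Phi : R -> R -> V) (s : R) : R :=
  Derive (fun v => Mcurv m (in_chart alpha Phi) s v) 0.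

(* Main.v *)
(* Write [T] for the direction of a line of the foliation and [w^2 = E G - F^2].  Solving
   [II (T, .) = M I (T, .) + tau_g I (N /\ T, .)] shows that, near [c], the lines are exactly the
   solutions of [v' = W (s, v)] with [W = (M E - e) / (f - M F + tau_g w)].  Along [c] the numerator
   vanishes and the denominator is [2 tau_g], so [W_v = (M_v E + M E_v - e_v) / (2 tau_g)].  The
   Darboux equations give [E_v = - 2 k_g] and [e_v = tau_g' - 2 H k_g], whence [W_v] is the integrand
   of the formula minus [tau_g' / (2 tau_g)], a term which integrates to zero over the closed curve.
   Finally [ln P'(0)] is the integral of [W_v], because [W] vanishes on [c].

   All the regularity needed is strict differentiability at the points of [c]: it is stable under
   composition, follows from C^1 or from the double power series of [m], makes [W] Lipschitz near
   [c] and [W_v] continuous along [c]. *)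
Require Import Defs.
From Stdlib Require Import Reals Lra Lia Psatz Classical ClassicalEpsilon.
From Coquelicot Require Import Coquelicot.
Open Scope R_scope.

(** * Strict differentiability of functions of two variables *)

(** Strict differentiability compares two arbitrary points near the base point, so the estimate at
    one point already contains a Lipschitz bound on a neighbourhood. It suits [m]: the power series
    at a point yields strict differentiability at that very point, without recentring the series or
    differentiating it nearby. The slope [W] is controlled only near the axis. Compactness of [0, L]
    turns local radii into one; truncation in v gives a globally Lipschitz field, to which Picard
    iteration applies; a growth estimate shows that solutions starting close enough to 0 never reach
    the truncation. The derivative of the Poincare map does not come from smooth dependence on
    initial values: as v = 0 is a solution, v' = om v + o(v) uniformly in s, and an integrating
    factor turns this into P(h) = h exp (int om) + o(h). The estimate concerns every line starting
    near 0, hence every [P] satisfying [poincare_map]. Division by zero and square roots of negative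
    numbers have default values, so nondegeneracy is extracted from the strict inequalities in
    [mean_curvature_direction]. *)

Definition strict_diff (f : R -> R -> R) (x y a b : R) : Prop :=
  forall e, 0 < e -> exists d : posreal, forall u v u' v',
    Rabs (u - x) < d -> Rabs (v - y) < d -> Rabs (u' - x) < d -> Rabs (v' - y) < d ->
    Rabs (f u v - f u' v' - (a * (u - u') + b * (v - v')))
      <= e * (Rabs (u - u') + Rabs (v - v')).

Lemma strict_diff_ext_loc f g x y a b :
  locally_2d (fun u v => f u v = g u v) x y ->
  strict_diff f x y a b -> strict_diff g x y a b.
Proof.
intros [d1 H1] Hf e He.
destruct (Hf e He) as [d2 H2].
exists (mkposreal _ (Rmin_stable_in_posreal d1 d2)).
cbn; intros u v u' v' Hu Hv Hu' Hv'.
rewrite <- (H1 u v), <- (H1 u' v'); try (eapply Rlt_le_trans; [eassumption|apply Rmin_l]).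
apply H2; (eapply Rlt_le_trans; [eassumption|apply Rmin_r]).
Qed.

Lemma strict_diff_lipschitz f x y a b :
  strict_diff f x y a b ->
  exists d : posreal, forall u v u' v',
    Rabs (u - x) < d -> Rabs (v - y) < d -> Rabs (u' - x) < d -> Rabs (v' - y) < d ->
    Rabs (f u v - f u' v') <= (Rabs a + Rabs b + 1) * (Rabs (u - u') + Rabs (v - v')).
Proof.
intros Hf.
destruct (Hf 1 Rlt_0_1) as [d H].
exists d; intros u v u' v' Hu Hv Hu' Hv'.
specialize (H u v u' v' Hu Hv Hu' Hv').
replace (f u v - f u' v') with
  ((f u v - f u' v' - (a * (u - u') + b * (v - v'))) + (a * (u - u') + b * (v - v'))) by ring.
eapply Rle_trans; [apply Rabs_triang|].
assert (Rabs (a * (u - u') + b * (v - v')) <= Rabs a * Rabs (u - u') + Rabs b * Rabs (v - v')).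
{ eapply Rle_trans; [apply Rabs_triang|]. rewrite !Rabs_mult. lra. }
pose proof (Rabs_pos a); pose proof (Rabs_pos b);
pose proof (Rabs_pos (u - u')); pose proof (Rabs_pos (v - v')).
nra.
Qed.

(** The Lipschitz bound holds between any two points of a box, so information at one point gives
    continuity throughout the box of half the radius. *)
Lemma strict_diff_continuity f x y a b :
  strict_diff f x y a b -> locally_2d (continuity_2d_pt f) x y.
Proof.
intros Hf.
destruct (strict_diff_lipschitz _ _ _ _ _ Hf) as [d H].
set (K := Rabs a + Rabs b + 1) in *.
assert (HK : 0 < K) by (unfold K; pose proof (Rabs_pos a); pose proof (Rabs_pos b); lra).
exists (mkposreal (d / 2) (is_pos_div_2 d)); cbn; intros u v Hu Hv e.
assert (He : 0 < Rmin (d / 2) (e / (2 * K))).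
{ apply Rmin_pos; [apply is_pos_div_2|]. apply Rdiv_lt_0_compat; [apply cond_pos|lra]. }
exists (mkposreal _ He); cbn; intros u' v' Hu' Hv'.
assert (Ha : Rmin (d / 2) (e / (2 * K)) <= d / 2) by apply Rmin_l.
assert (Hb : Rmin (d / 2) (e / (2 * K)) <= e / (2 * K)) by apply Rmin_r.
apply Rle_lt_trans with (K * (Rabs (u' - u) + Rabs (v' - v))).
- apply H; try lra.
  + replace (u' - x) with ((u' - u) + (u - x)) by ring.
    eapply Rle_lt_trans; [apply Rabs_triang|]; lra.
  + replace (v' - y) with ((v' - v) + (v - y)) by ring.
    eapply Rle_lt_trans; [apply Rabs_triang|]; lra.
- apply Rlt_le_trans with (K * (e / (2 * K) + e / (2 * K))).
  + apply Rmult_lt_compat_l; lra.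
  + right; field; lra.
Qed.

Lemma strict_diff_continuity_pt f x y a b :
  strict_diff f x y a b -> continuity_2d_pt f x y.
Proof. intros Hf. exact (locally_2d_singleton _ _ _ (strict_diff_continuity _ _ _ _ _ Hf)). Qed.

Lemma strict_diff_is_derive_1 f x y a b :
  strict_diff f x y a b -> is_derive (fun t => f t y) x a.
Proof.
intros Hf. apply is_derive_Reals. intros e He.
destruct (Hf (e / 2)) as [d H]; [lra|].
exists d; intros h Hh Hd.
specialize (H (x + h) y x y).
replace (x + h - x) with h in H by ring. replace (x - x) with 0 in H by ring.
replace (y - y) with 0 in H by ring. rewrite Rabs_R0 in H.
pose proof (cond_pos d).
specialize (H Hd ltac:(lra) ltac:(lra) ltac:(lra)).
replace ((f (x + h) y - f x y) / h - a) with
  ((f (x + h) y - f x y - (a * h + b * 0)) / h) by (field; auto).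
unfold Rdiv. rewrite Rabs_mult, Rabs_inv.
assert (0 < Rabs h) by now apply Rabs_pos_lt.
apply Rle_lt_trans with (e / 2 * (Rabs h + 0) * / Rabs h).
- apply Rmult_le_compat_r; [left; now apply Rinv_0_lt_compat|exact H].
- replace (e / 2 * (Rabs h + 0) * / Rabs h) with (e / 2) by (field; lra). lra.
Qed.

Lemma strict_diff_swap f x y a b :
  strict_diff f x y a b -> strict_diff (fun u v => f v u) y x b a.
Proof.
intros Hf e He. destruct (Hf e He) as [d H].
exists d; intros u v u' v' Hu Hv Hu' Hv'.
specialize (H v u v' u' Hv Hu Hv' Hu').
rewrite (Rplus_comm (b * _)), (Rplus_comm (Rabs (u - u'))). exact H.
Qed.

Lemma strict_diff_is_derive_2 f x y a b :
  strict_diff f x y a b -> is_derive (fun t => f x t) y b.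
Proof. intros Hf. exact (strict_diff_is_derive_1 _ _ _ _ _ (strict_diff_swap _ _ _ _ _ Hf)). Qed.

Lemma strict_diff_comp g f1 f2 x y A B a1 b1 a2 b2 :
  strict_diff g (f1 x y) (f2 x y) A B ->
  strict_diff f1 x y a1 b1 -> strict_diff f2 x y a2 b2 ->
  strict_diff (fun u v => g (f1 u v) (f2 u v)) x y (A * a1 + B * a2) (A * b1 + B * b2).
Proof.
intros Hg H1 H2 e He.
destruct (strict_diff_lipschitz _ _ _ _ _ H1) as [d1 L1].
destruct (strict_diff_lipschitz _ _ _ _ _ H2) as [d2 L2].
set (K1 := Rabs a1 + Rabs b1 + 1) in *.
set (K2 := Rabs a2 + Rabs b2 + 1) in *.
assert (HK1 : 0 < K1) by (unfold K1; pose proof (Rabs_pos a1); pose proof (Rabs_pos b1); lra).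
assert (HK2 : 0 < K2) by (unfold K2; pose proof (Rabs_pos a2); pose proof (Rabs_pos b2); lra).
pose proof (Rabs_pos A) as HA; pose proof (Rabs_pos B) as HB.
(* The error of [g] is multiplied by at most K1 + K2, those of [f1] and [f2] by |A| and |B|; with
   [e1] and [e2] each of the two sources contributes at most half of [e]. The 1 in [e2] keeps its
   divisor positive when A = B = 0. *)
set (e1 := e / (2 * (K1 + K2))).
set (e2 := e / (2 * (Rabs A + Rabs B + 1))).
assert (He1 : 0 < e1) by (apply Rdiv_lt_0_compat; lra).
assert (He2 : 0 < e2) by (apply Rdiv_lt_0_compat; lra).
destruct (Hg e1 He1) as [dg Eg].
destruct (H1 e2 He2) as [d3 E1].
destruct (H2 e2 He2) as [d4 E2].
destruct (strict_diff_continuity_pt _ _ _ _ _ H1 dg) as [d5 C1].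
destruct (strict_diff_continuity_pt _ _ _ _ _ H2 dg) as [d6 C2].
assert (Hd : exists d : posreal, d <= d1 /\ d <= d2 /\ d <= d3 /\ d <= d4 /\ d <= d5 /\ d <= d6).
{ assert (Hp : 0 < Rmin (Rmin d1 d2) (Rmin (Rmin d3 d4) (Rmin d5 d6))).
  { repeat apply Rmin_pos; apply cond_pos. }
  exists (mkposreal _ Hp); cbn.
  pose proof (Rmin_l (Rmin d1 d2) (Rmin (Rmin d3 d4) (Rmin d5 d6))).
  pose proof (Rmin_r (Rmin d1 d2) (Rmin (Rmin d3 d4) (Rmin d5 d6))).
  pose proof (Rmin_l d1 d2); pose proof (Rmin_r d1 d2).
  pose proof (Rmin_l (Rmin d3 d4) (Rmin d5 d6)); pose proof (Rmin_r (Rmin d3 d4) (Rmin d5 d6)).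
  pose proof (Rmin_l d3 d4); pose proof (Rmin_r d3 d4).
  pose proof (Rmin_l d5 d6); pose proof (Rmin_r d5 d6).
  lra. }
destruct Hd as [d (Q1 & Q2 & Q3 & Q4 & Q5 & Q6)].
exists d; intros u v u' v' Hu Hv Hu' Hv'.
specialize (L1 u v u' v' ltac:(lra) ltac:(lra) ltac:(lra) ltac:(lra)).
specialize (L2 u v u' v' ltac:(lra) ltac:(lra) ltac:(lra) ltac:(lra)).
specialize (E1 u v u' v' ltac:(lra) ltac:(lra) ltac:(lra) ltac:(lra)).
specialize (E2 u v u' v' ltac:(lra) ltac:(lra) ltac:(lra) ltac:(lra)).
specialize (Eg (f1 u v) (f2 u v) (f1 u' v') (f2 u' v')
  (C1 u v ltac:(lra) ltac:(lra)) (C2 u v ltac:(lra) ltac:(lra))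
  (C1 u' v' ltac:(lra) ltac:(lra)) (C2 u' v' ltac:(lra) ltac:(lra))).
set (D1 := f1 u v - f1 u' v') in *.
set (D2 := f2 u v - f2 u' v') in *.
set (t := Rabs (u - u') + Rabs (v - v')) in *.
assert (Ht : 0 <= t) by (unfold t; pose proof (Rabs_pos (u - u')); pose proof (Rabs_pos (v - v')); lra).
set (G := g (f1 u v) (f2 u v) - g (f1 u' v') (f2 u' v')) in *.
replace (G - _) with ((G - (A * D1 + B * D2))
  + (A * (D1 - (a1 * (u - u') + b1 * (v - v'))) + B * (D2 - (a2 * (u - u') + b2 * (v - v'))))) by ring.
eapply Rle_trans; [apply Rabs_triang|].
apply Rle_trans with (e1 * ((K1 + K2) * t) + (Rabs A + Rabs B) * (e2 * t)).
- apply Rplus_le_compat.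
  + eapply Rle_trans; [exact Eg|]. apply Rmult_le_compat_l; lra.
  + eapply Rle_trans; [apply Rabs_triang|]. rewrite !Rabs_mult.
    rewrite Rmult_plus_distr_r. apply Rplus_le_compat; apply Rmult_le_compat_l; auto.
- replace (e1 * ((K1 + K2) * t)) with (e * t / 2) by (unfold e1; field; lra).
  replace ((Rabs A + Rabs B) * (e2 * t)) with
    (e * t / 2 * ((Rabs A + Rabs B) / (Rabs A + Rabs B + 1))) by (unfold e2; field; lra).
  assert ((Rabs A + Rabs B) / (Rabs A + Rabs B + 1) <= 1).
  { apply Rmult_le_reg_r with (Rabs A + Rabs B + 1); [lra|].
    unfold Rdiv. rewrite Rmult_assoc, Rinv_l; lra. }
  assert (0 <= e * t / 2) by nra.
  nra.
Qed.

Lemma is_derive_continuity_pt (f : R -> R) x l : is_derive f x l -> continuity_pt f x.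
Proof.
intros H. apply derivable_continuous_pt. exists l. now apply is_derive_Reals.
Qed.

(** The increment is split at the corner (u', v) and the mean value theorem is applied on each leg;
    the intermediate points stay in the box where the partials are within [e] of their values at the
    base point. *)
Lemma strict_diff_C1 (f fx fy : R -> R -> R) x y :
  locally_2d (fun u v => is_derive (fun t => f t v) u (fx u v) /\
                         is_derive (fun t => f u t) v (fy u v)) x y ->
  continuity_2d_pt fx x y -> continuity_2d_pt fy x y ->
  strict_diff f x y (fx x y) (fy x y).
Proof.
intros [d0 D] Cx Cy e He.
destruct (Cx (mkposreal e He)) as [d1 H1].
destruct (Cy (mkposreal e He)) as [d2 H2]. cbn in H1, H2.
assert (Hp : 0 < Rmin d0 (Rmin d1 d2)) by (repeat apply Rmin_pos; apply cond_pos).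
exists (mkposreal _ Hp); cbn.
pose proof (Rmin_l d0 (Rmin d1 d2)); pose proof (Rmin_r d0 (Rmin d1 d2));
pose proof (Rmin_l d1 d2); pose proof (Rmin_r d1 d2).
set (d := Rmin d0 (Rmin d1 d2)) in *.
assert (Bt : forall z a b c, Rabs (a - z) < d -> Rabs (b - z) < d ->
   Rmin a b <= c <= Rmax a b -> Rabs (c - z) < d).
{ intros z a b c Ha Hb. unfold Rmin, Rmax. destruct Rle_dec; intros Hc;
  apply Rabs_def2 in Ha; apply Rabs_def2 in Hb; apply Rabs_def1; lra. }
intros u v u' v' Hu Hv Hu' Hv'.
destruct (MVT_gen (fun t => f t v) u' u (fun t => fx t v)) as [c1 [B1 E1]].
{ intros c Hc. assert (Rabs (c - x) < d) by (apply (Bt x u' u); auto; lra).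
  refine (proj1 (D c v _ _)); lra. }
{ intros c Hc. assert (Rabs (c - x) < d) by (apply (Bt x u' u); auto; lra).
  apply (is_derive_continuity_pt _ _ (fx c v)). refine (proj1 (D c v _ _)); lra. }
destruct (MVT_gen (fun t => f u' t) v' v (fun t => fy u' t)) as [c2 [B2 E2]].
{ intros c Hc. assert (Rabs (c - y) < d) by (apply (Bt y v' v); auto; lra).
  refine (proj2 (D u' c _ _)); lra. }
{ intros c Hc. assert (Rabs (c - y) < d) by (apply (Bt y v' v); auto; lra).
  apply (is_derive_continuity_pt _ _ (fy u' c)). refine (proj2 (D u' c _ _)); lra. }
apply (Bt x) in B1; auto. apply (Bt y) in B2; auto.
specialize (H1 c1 v ltac:(lra) ltac:(lra)).
specialize (H2 u' c2 ltac:(lra) ltac:(lra)).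
replace (f u v - f u' v' - _) with
  ((fx c1 v - fx x y) * (u - u') + (fy u' c2 - fy x y) * (v - v')) by (cbn in E1, E2; nra).
eapply Rle_trans; [apply Rabs_triang|]. rewrite !Rabs_mult.
rewrite Rmult_plus_distr_l.
apply Rplus_le_compat; apply Rmult_le_compat_r; try apply Rabs_pos; lra.
Qed.

Lemma strict_diff_const c x y : strict_diff (fun _ _ => c) x y 0 0.
Proof.
intros e He. exists (mkposreal 1 Rlt_0_1). intros u v u' v' _ _ _ _.
replace (_ - _ - _) with 0 by ring. rewrite Rabs_R0.
apply Rmult_le_pos; [lra|]. pose proof (Rabs_pos (u - u')); pose proof (Rabs_pos (v - v')); lra.
Qed.

Lemma strict_diff_plus f g x y a b a' b' :
  strict_diff f x y a b -> strict_diff g x y a' b' ->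
  strict_diff (fun u v => f u v + g u v) x y (a + a') (b + b').
Proof.
intros Hf Hg.
replace (a + a') with (1 * a + 1 * a') by ring.
replace (b + b') with (1 * b + 1 * b') by ring.
apply (strict_diff_comp Rplus); auto.
apply (strict_diff_C1 Rplus (fun _ _ => 1) (fun _ _ => 1)).
- apply locally_2d_forall; intros; split; auto_derive; auto; ring.
- apply continuity_2d_pt_const.
- apply continuity_2d_pt_const.
Qed.

Lemma strict_diff_minus f g x y a b a' b' :
  strict_diff f x y a b -> strict_diff g x y a' b' ->
  strict_diff (fun u v => f u v - g u v) x y (a - a') (b - b').
Proof.
intros Hf Hg.
replace (a - a') with (1 * a + - 1 * a') by ring.
replace (b - b') with (1 * b + - 1 * b') by ring.
apply (strict_diff_comp Rminus); auto.
apply (strict_diff_C1 Rminus (fun _ _ => 1) (fun _ _ => -1)).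
- apply locally_2d_forall; intros; split; auto_derive; auto; ring.
- apply continuity_2d_pt_const.
- apply continuity_2d_pt_const.
Qed.

Lemma strict_diff_mult f g x y a b a' b' :
  strict_diff f x y a b -> strict_diff g x y a' b' ->
  strict_diff (fun u v => f u v * g u v) x y
    (g x y * a + f x y * a') (g x y * b + f x y * b').
Proof.
intros Hf Hg.
apply (strict_diff_comp Rmult); auto.
apply (strict_diff_C1 Rmult (fun _ q => q) (fun p _ => p)).
- apply locally_2d_forall; intros; split; auto_derive; auto; ring.
- apply continuity_2d_pt_id2.
- apply continuity_2d_pt_id1.
Qed.

Lemma strict_diff_comp1 (g g' : R -> R) f x y a b :
  locally (f x y) (fun t => is_derive g t (g' t)) -> continuous g' (f x y) ->
  strict_diff f x y a b ->
  strict_diff (fun u v => g (f u v)) x y (g' (f x y) * a) (g' (f x y) * b).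
Proof.
intros Hg Cg Hf.
replace (g' (f x y) * a) with (g' (f x y) * a + 0 * a) by ring.
replace (g' (f x y) * b) with (g' (f x y) * b + 0 * b) by ring.
(* [g] is viewed as a function of two arguments that ignores the second; that slot is filled with
   [f] again and has coefficient 0. *)
apply (strict_diff_comp (fun p _ => g p) f f); auto.
apply (strict_diff_C1 (fun p _ => g p) (fun p _ => g' p) (fun p _ => 0)).
- destruct Hg as [d Hg]. exists d; intros u v Hu Hv; split.
  + apply Hg, Hu.
  + apply @is_derive_const.
- apply (continuity_1d_2d_pt_comp g' (fun p _ => p)).
  + now apply continuity_pt_filterlim.
  + apply continuity_2d_pt_id1.
- apply continuity_2d_pt_const.
Qed.

Lemma strict_diff_inv f x y a b :
  f x y <> 0 -> strict_diff f x y a b ->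
  strict_diff (fun u v => / f u v) x y (- / f x y ^ 2 * a) (- / f x y ^ 2 * b).
Proof.
intros Hn Hf.
apply (strict_diff_comp1 Rinv (fun t => - / t ^ 2)); auto.
- assert (Hp : 0 < Rabs (f x y)) by now apply Rabs_pos_lt.
  exists (mkposreal _ Hp); intros t Ht.
  change (Rabs (t - f x y) < Rabs (f x y)) in Ht.
  assert (t <> 0).
  { intros ->. rewrite Rminus_0_l, Rabs_Ropp in Ht. lra. }
  auto_derive; auto. field; auto.
- apply (@ex_derive_continuous R_AbsRing R_NormedModule). auto_derive.
  now apply Rmult_integral_contrapositive_currified; rewrite ?Rmult_1_r.
Qed.

Lemma strict_diff_sqrt f x y a b :
  0 < f x y -> strict_diff f x y a b ->
  strict_diff (fun u v => sqrt (f u v)) x y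
    (/ (2 * sqrt (f x y)) * a) (/ (2 * sqrt (f x y)) * b).
Proof.
intros Hn Hf.
apply (strict_diff_comp1 sqrt (fun t => / (2 * sqrt t))); auto.
- exists (mkposreal _ Hn); intros t Ht.
  change (Rabs (t - f x y) < f x y) in Ht. apply Rabs_def2 in Ht.
  apply is_derive_Reals, derivable_pt_lim_sqrt. lra.
- apply (@ex_derive_continuous R_AbsRing R_NormedModule). auto_derive.
  pose proof (sqrt_lt_R0 _ Hn). repeat split; lra.
Qed.

Lemma strict_diff_div f g x y a b a' b' :
  g x y <> 0 -> strict_diff f x y a b -> strict_diff g x y a' b' ->
  strict_diff (fun u v => f u v / g u v) x y
    ((a * g x y - f x y * a') / g x y ^ 2) ((b * g x y - f x y * b') / g x y ^ 2).
Proof.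
intros Hn Hf Hg.
pose proof (strict_diff_mult _ _ _ _ _ _ _ _ Hf (strict_diff_inv _ _ _ _ _ Hn Hg)) as H.
replace ((a * g x y - f x y * a') / g x y ^ 2) with
  (/ g x y * a + f x y * (- / g x y ^ 2 * a')) by (field; auto).
replace ((b * g x y - f x y * b') / g x y ^ 2) with
  (/ g x y * b + f x y * (- / g x y ^ 2 * b')) by (field; auto).
exact H.
Qed.

Lemma strict_diff_unique f x y a b a' b' :
  strict_diff f x y a b -> strict_diff f x y a' b' -> a = a' /\ b = b'.
Proof.
intros H H'. split.
- rewrite <- (is_derive_unique _ _ _ (strict_diff_is_derive_1 _ _ _ _ _ H)).
  exact (is_derive_unique _ _ _ (strict_diff_is_derive_1 _ _ _ _ _ H')).
- rewrite <- (is_derive_unique _ _ _ (strict_diff_is_derive_2 _ _ _ _ _ H)).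
  exact (is_derive_unique _ _ _ (strict_diff_is_derive_2 _ _ _ _ _ H')).
Qed.

Lemma locally_2d_pos f x y : continuity_2d_pt f x y -> 0 < f x y ->
  locally_2d (fun u v => 0 < f u v) x y.
Proof.
intros C Hp. destruct (C (mkposreal _ Hp)) as [d H]. exists d; intros u v Hu Hv.
specialize (H u v Hu Hv); cbn in H. apply Rabs_def2 in H. lra.
Qed.

(** * Strict differentiability of double power series *)

Lemma pow_diff_bound r x y n : Rabs x <= r -> Rabs y <= r ->
  Rabs (x ^ S n - y ^ S n) <= INR (S n) * r ^ n * Rabs (x - y).
Proof.
intros Hx Hy.
assert (Hr : 0 <= r) by (pose proof (Rabs_pos x); lra).
induction n as [|n IH].
- simpl. rewrite !Rmult_1_r, !Rmult_1_l. lra.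
- replace (x ^ S (S n) - y ^ S (S n)) with
    (x * (x ^ S n - y ^ S n) + y ^ S n * (x - y)) by (simpl; ring).
  eapply Rle_trans; [apply Rabs_triang|]. rewrite !Rabs_mult.
  replace (INR (S (S n)) * r ^ S n * Rabs (x - y)) with
    (r * (INR (S n) * r ^ n * Rabs (x - y)) + r ^ S n * Rabs (x - y)).
  2:{ rewrite (S_INR (S n)). simpl (r ^ S n). ring. }
  apply Rplus_le_compat.
  + apply Rmult_le_compat; auto using Rabs_pos.
  + apply Rmult_le_compat_r; [apply Rabs_pos|].
    rewrite <- RPow_abs. apply pow_incr. split; auto using Rabs_pos.
Qed.

(** The factor n + 1 that comes from differences of powers is absorbed by the 2^n gained when the
    radius is halved. *)
Lemma INR_le_pow2 n : INR (S n) <= 2 ^ n.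
Proof.
induction n as [|n IH]; [simpl; lra|].
rewrite S_INR. simpl (2 ^ S n).
assert (1 <= 2 ^ n) by (apply pow_R1_Rle; lra). lra.
Qed.

Section PowerSeries.
Context (p : nat -> R) (rho : R) (Hrho : 0 < rho)
  (Hp : ex_series (fun j => Rabs (p j) * rho ^ j)).

Let term_pos j : 0 <= Rabs (p j) * rho ^ j.
Proof. apply Rmult_le_pos; [apply Rabs_pos|]. left. now apply pow_lt. Qed.

Lemma ex_series_powers x : Rabs x <= rho -> ex_series (fun j => p j * x ^ j).
Proof.
intros Hx. apply (@ex_series_le R_AbsRing R_CompleteNormedModule) with (2 := Hp).
intros j. change norm with Rabs. rewrite Rabs_mult.
apply Rmult_le_compat_l; [apply Rabs_pos|].
rewrite <- RPow_abs. apply pow_incr. split; auto using Rabs_pos.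
Qed.

Lemma Series_tail_le n :
  Series (fun j => Rabs (p (n + j)%nat) * rho ^ (n + j)) <= Series (fun j => Rabs (p j) * rho ^ j).
Proof.
induction n as [|n IH]; [right; reflexivity|].
eapply Rle_trans; [|exact IH].
rewrite (Series_incr_1 (fun j => Rabs (p (n + j)%nat) * rho ^ (n + j))).
- rewrite (Series_ext (fun k => Rabs (p (n + S k)%nat) * rho ^ (n + S k))
    (fun j => Rabs (p (S n + j)%nat) * rho ^ (S n + j))).
  + pose proof (term_pos (n + 0)). lra.
  + intros k. now replace (n + S k)%nat with (S n + k)%nat by lia.
- now apply (ex_series_incr_n (fun j => Rabs (p j) * rho ^ j)).
Qed.

(** Used once the first [n] terms of a difference have cancelled: what remains is dominated by a
    tail of the majorant series, and a tail is at most the whole sum. *)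
Lemma Series_tail_bound n (t : nat -> R) C : 0 <= C ->
  (forall j, Rabs (t j) <= Rabs (p (n + j)%nat) * rho ^ (n + j) * C) ->
  ex_series t /\ Rabs (Series t) <= Series (fun j => Rabs (p j) * rho ^ j) * C.
Proof.
intros HC Ht.
assert (He : ex_series (fun j => Rabs (p (n + j)%nat) * rho ^ (n + j) * C)).
{ apply ex_series_scal_r. now apply (ex_series_incr_n (fun j => Rabs (p j) * rho ^ j)). }
assert (Hr : ex_series (fun j => Rabs (t j))).
{ apply (@ex_series_le R_AbsRing R_CompleteNormedModule) with (2 := He).
  intros j. change norm with Rabs. now rewrite Rabs_Rabsolu. }
split; [now apply ex_series_Rabs|].
eapply Rle_trans; [now apply Series_Rabs|].
eapply Rle_trans.
- apply Series_le; [|exact He]. intros j; split; [apply Rabs_pos|apply Ht].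
- rewrite Series_scal_r. apply Rmult_le_compat_r; [exact HC|apply Series_tail_le].
Qed.

(** Constant terms cancel, and each later difference of powers of degree j + 1 costs (j + 1) (rho /
    2)^j |x - y|, at most rho^j |x - y|. *)
Lemma power_series_lipschitz x y : Rabs x <= rho / 2 -> Rabs y <= rho / 2 ->
  Rabs (Series (fun j => p j * x ^ j) - Series (fun j => p j * y ^ j))
    <= Series (fun j => Rabs (p j) * rho ^ j) * (/ rho * Rabs (x - y)).
Proof.
intros Hx Hy.
assert (Ex : ex_series (fun j => p j * x ^ j)) by (apply ex_series_powers; lra).
assert (Ey : ex_series (fun j => p j * y ^ j)) by (apply ex_series_powers; lra).
rewrite (Series_incr_1 _ Ex), (Series_incr_1 _ Ey).
apply ex_series_incr_1 in Ex. apply ex_series_incr_1 in Ey.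
replace (_ + _ - _) with
  (Series (fun k => p (S k) * x ^ S k) - Series (fun k => p (S k) * y ^ S k)) by (simpl; ring).
rewrite <- Series_minus; auto.
apply (Series_tail_bound 1).
- apply Rmult_le_pos; [left; now apply Rinv_0_lt_compat|apply Rabs_pos].
- intros j. rewrite <- Rmult_minus_distr_l, Rabs_mult, !Rmult_assoc.
  apply Rmult_le_compat_l; [apply Rabs_pos|].
  eapply Rle_trans; [apply (pow_diff_bound (rho / 2)); auto|].
  rewrite <- Rmult_assoc. apply Rmult_le_compat_r; [apply Rabs_pos|].
  replace (rho ^ (1 + j) * / rho) with (rho ^ j) by (simpl; field; lra).
  unfold Rdiv. rewrite Rpow_mult_distr, pow_inv.
  pose proof (INR_le_pow2 j). assert (0 < 2 ^ j) by (apply pow_lt; lra).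
  apply Rmult_le_reg_r with (2 ^ j); auto.
  replace (INR (S j) * (rho ^ j * / 2 ^ j) * 2 ^ j) with (rho ^ j * INR (S j)) by (field; lra).
  apply Rmult_le_compat_l; auto. left. now apply pow_lt.
Qed.

(** Without the constant and linear terms every remaining difference of powers has degree at least
    2, which leaves a factor [delta] besides |x - y|. *)
Lemma power_series_strict delta x y : delta <= rho / 2 -> Rabs x <= delta -> Rabs y <= delta ->
  Rabs (Series (fun j => p j * x ^ j) - Series (fun j => p j * y ^ j) - p 1%nat * (x - y))
    <= Series (fun j => Rabs (p j) * rho ^ j) * (2 * delta / rho ^ 2 * Rabs (x - y)).
Proof.
intros Hd Hx Hy.
assert (Hd0 : 0 <= delta) by (pose proof (Rabs_pos x); lra).
assert (Ex : ex_series (fun j => p j * x ^ j)) by (apply ex_series_powers; lra).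
assert (Ey : ex_series (fun j => p j * y ^ j)) by (apply ex_series_powers; lra).
rewrite (Series_incr_1 _ Ex), (Series_incr_1 _ Ey).
apply ex_series_incr_1 in Ex. apply ex_series_incr_1 in Ey.
rewrite (Series_incr_1 _ Ex), (Series_incr_1 _ Ey).
apply ex_series_incr_1 in Ex. apply ex_series_incr_1 in Ey.
replace (_ - _ - _) with
  (Series (fun k => p (S (S k)) * x ^ S (S k)) - Series (fun k => p (S (S k)) * y ^ S (S k)))
  by (simpl; ring).
rewrite <- Series_minus; auto.
assert (Hr2 : 0 < rho ^ 2) by now apply pow_lt.
apply (Series_tail_bound 2).
- apply Rmult_le_pos; [|apply Rabs_pos]. apply Rmult_le_pos; [lra|].
  left; now apply Rinv_0_lt_compat.
- intros j. rewrite <- Rmult_minus_distr_l, Rabs_mult, !Rmult_assoc.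
  apply Rmult_le_compat_l; [apply Rabs_pos|].
  eapply Rle_trans; [apply (pow_diff_bound delta); auto|].
  replace (rho ^ (2 + j) * (2 * delta / rho ^ 2 * Rabs (x - y))) with
    (delta * (2 * rho ^ j) * Rabs (x - y)) by (simpl; field; lra).
  apply Rmult_le_compat_r; [apply Rabs_pos|].
  replace (INR (S (S j)) * delta ^ S j) with (delta * (INR (S (S j)) * delta ^ j)) by (simpl; ring).
  apply Rmult_le_compat_l; auto.
  apply Rle_trans with (INR (S (S j)) * (rho / 2) ^ j).
  { apply Rmult_le_compat_l; [apply pos_INR|]. apply pow_incr; lra. }
  unfold Rdiv. rewrite Rpow_mult_distr, pow_inv.
  pose proof (INR_le_pow2 (S j)). assert (0 < 2 ^ j) by (apply pow_lt; lra).
  apply Rmult_le_reg_r with (2 ^ j); auto.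
  replace (INR (S (S j)) * (rho ^ j * / 2 ^ j) * 2 ^ j) with (rho ^ j * INR (S (S j))) by (field; lra).
  replace (2 * rho ^ j * 2 ^ j) with (rho ^ j * 2 ^ S j) by (simpl; ring).
  apply Rmult_le_compat_l; auto. left. now apply pow_lt.
Qed.

End PowerSeries.

(** The increment is split at (h', k). Along the first leg the sum is a power series in h with
    coefficients [c i k]; along the second, row 0 is a power series in k and all other rows carry a
    factor h'. *)
Lemma double_power_series_strict_diff (a : nat -> nat -> R) rho : 0 < rho ->
  (forall i, ex_series (fun j => Rabs (a i j) * rho ^ j)) ->
  ex_series (fun i => Series (fun j => Rabs (a i j) * rho ^ j) * rho ^ i) ->
  strict_diff (fun h k => Series (fun i => Series (fun j => a i j * k ^ j) * h ^ i)) 0 0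
    (a 1%nat 0%nat) (a 0%nat 1%nat).
Proof.
intros Hrho Hin Hout.
set (A := fun i => Series (fun j => Rabs (a i j) * rho ^ j)).
set (c := fun i k => Series (fun j => a i j * k ^ j)).
set (Phi := fun h k => Series (fun i => c i k * h ^ i)).
assert (HA : forall i, 0 <= A i).
{ intros i. rewrite <- (Rmult_0_r (A i)).
  replace (A i * 0) with (Series (fun j : nat => 0 * 0)) by (rewrite Series_scal_l; ring).
  apply Series_le; [|apply Hin]. intros j. rewrite Rmult_0_l. split; [lra|].
  apply Rmult_le_pos; [apply Rabs_pos|]. left. now apply pow_lt. }
assert (HAe : ex_series (fun i => Rabs (A i) * rho ^ i)).
{ apply ex_series_ext with (2 := Hout). intros i. now rewrite (Rabs_pos_eq (A i)). }
(* [A i] will bound [c i k] for all |k| <= rho, so that [S0] is a common majorant for the power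
   series in h, whatever k is. *)
set (S0 := Series (fun i => Rabs (A i) * rho ^ i)).
assert (HS0 : forall i, A i * rho ^ i <= S0).
{ intros i. pose proof (Series_tail_le A rho Hrho HAe i) as H. fold S0 in H.
  rewrite Series_incr_1 in H by now apply (ex_series_incr_n (fun i => Rabs (A i) * rho ^ i)).
  rewrite Nat.add_0_r, (Rabs_pos_eq (A i)) in H by apply HA.
  eapply Rle_trans; [|exact H].
  assert (0 <= Series (fun k => Rabs (A (i + S k)%nat) * rho ^ (i + S k))); [|lra].
  replace 0 with (Series (fun j : nat => 0 * 0)) by (rewrite Series_scal_l; ring).
  apply Series_le.
  - intros j. rewrite Rmult_0_l. split; [lra|].
    apply Rmult_le_pos; [apply Rabs_pos|]. left. now apply pow_lt.
  - apply (ex_series_ext (fun k => Rabs (A (S i + k)%nat) * rho ^ (S i + k))).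
    + intros k. now replace (S i + k)%nat with (i + S k)%nat by lia.
    + now apply (ex_series_incr_n (fun i => Rabs (A i) * rho ^ i)). }
assert (HS0p : 0 <= S0) by (pose proof (HS0 O); pose proof (HA O); simpl in *; lra).
assert (Hck : forall i k, Rabs k <= rho -> Rabs (c i k) <= A i).
{ intros i k Hk. unfold c.
  destruct (Series_tail_bound (a i) rho Hrho (Hin i) 0 (fun j => a i j * k ^ j) 1) as [_ H]; [lra| |].
  - intros j. rewrite Rabs_mult, Rmult_1_r. apply Rmult_le_compat_l; [apply Rabs_pos|].
    rewrite <- RPow_abs. apply pow_incr. split; auto using Rabs_pos.
  - rewrite Rmult_1_r in H. exact H. }
assert (Hce : forall k, Rabs k <= rho -> ex_series (fun i => Rabs (c i k) * rho ^ i)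
   /\ Series (fun i => Rabs (c i k) * rho ^ i) <= S0).
{ intros k Hk.
  assert (Hb : forall i, 0 <= Rabs (c i k) * rho ^ i <= Rabs (A i) * rho ^ i).
  { intros i. assert (0 < rho ^ i) by now apply pow_lt. split.
    - apply Rmult_le_pos; [apply Rabs_pos|lra].
    - apply Rmult_le_compat_r; [lra|]. rewrite (Rabs_pos_eq (A i)); auto. }
  split.
  - apply (@ex_series_le R_AbsRing R_CompleteNormedModule) with (2 := HAe).
    intros i. change norm with Rabs. rewrite Rabs_pos_eq; apply Hb.
  - apply Series_le; auto. }
assert (Hir : 0 < / rho) by now apply Rinv_0_lt_compat.
assert (HA0 : A 0%nat <= S0) by (pose proof (HS0 0%nat); simpl in *; lra).
assert (HA1 : A 1%nat <= S0 * / rho).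
{ pose proof (HS0 1%nat) as H. rewrite pow_1 in H.
  apply Rmult_le_reg_r with rho; auto. rewrite Rmult_assoc, Rinv_l; lra. }
set (K := S0 * / rho ^ 2).
assert (HK : 0 <= K) by (apply Rmult_le_pos; [auto|]; left; apply Rinv_0_lt_compat; now apply pow_lt).
(* all errors are at most [const * delta * K] times the increment *)
intros e He.
(* The one-variable estimates require rho / 2; each leg errs by at most 3 delta K times its
   increment, which 8 delta K <= e covers. *)
set (delta := Rmin (rho / 2) (e / (8 * (K + 1)))).
assert (Hdelta : 0 < delta).
{ apply Rmin_pos; [lra|]. apply Rdiv_lt_0_compat; lra. }
assert (Hd1 : delta <= rho / 2) by apply Rmin_l.
assert (Hd2 : 8 * (delta * K) <= e).
{ assert (delta <= e / (8 * (K + 1))) by apply Rmin_r.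
  assert (8 * (delta * (K + 1)) <= e); [|nra].
  apply Rle_trans with (8 * (e / (8 * (K + 1)) * (K + 1))).
  - apply Rmult_le_compat_l; [lra|]. apply Rmult_le_compat_r; lra.
  - right; field; lra. }
exists (mkposreal _ Hdelta); cbn; intros h k h' k' Hh Hk Hh' Hk'.
rewrite Rminus_0_r in Hh, Hk, Hh', Hk'.
change (Rabs (Phi h k - Phi h' k' - (a 1%nat 0%nat * (h - h') + a 0%nat 1%nat * (k - k')))
  <= e * (Rabs (h - h') + Rabs (k - k'))).
pose proof (Rabs_pos (h - h')) as P1. pose proof (Rabs_pos (k - k')) as P2.
(* The linear coefficient in h is [c 1 k] rather than [a 1 0]; the Lipschitz bound for row 1 makes
   the difference a multiple of [delta]. *)
assert (B1 : Rabs (Phi h k - Phi h' k - a 1%nat 0%nat * (h - h')) <= e * Rabs (h - h')).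
{ destruct (Hce k) as [E1 E2]; [lra|].
  pose proof (power_series_strict (fun i => c i k) rho Hrho E1 delta h h' Hd1 ltac:(lra) ltac:(lra)) as Q1.
  cbv beta in Q1. fold (Phi h k) in Q1. fold (Phi h' k) in Q1.
  pose proof (power_series_lipschitz (a 1%nat) rho Hrho (Hin 1%nat) k 0 ltac:(lra)
     ltac:(rewrite Rabs_R0; lra)) as Q2.
  fold (c 1%nat k) in Q2. fold (A 1%nat) in Q2. rewrite Rminus_0_r in Q2.
  assert (Z : Series (fun j => a 1%nat j * 0 ^ j) = a 1%nat 0%nat).
  { rewrite Series_incr_1.
    - rewrite (Series_ext _ (fun _ : nat => 0 * 0)).
      + rewrite Series_scal_l. simpl. ring.
      + intros j; simpl; ring.
    - apply (ex_series_powers (a 1%nat) rho (Hin 1%nat)). rewrite Rabs_R0; lra. }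
  rewrite Z in Q2.
  replace (Phi h k - Phi h' k - a 1%nat 0%nat * (h - h')) with
    ((Phi h k - Phi h' k - c 1%nat k * (h - h')) + (c 1%nat k - a 1%nat 0%nat) * (h - h')) by ring.
  eapply Rle_trans; [apply Rabs_triang|]. rewrite Rabs_mult.
  apply Rle_trans with (2 * (delta * K) * Rabs (h - h') + (delta * K) * Rabs (h - h')); [|nra].
  apply Rplus_le_compat.
  - eapply Rle_trans; [exact Q1|].
    replace (2 * (delta * K) * Rabs (h - h')) with (S0 * (2 * delta / rho ^ 2 * Rabs (h - h')))
      by (unfold K; field; lra).
    apply Rmult_le_compat_r; auto. apply Rmult_le_pos; auto.
    apply Rmult_le_pos; [lra|]. left; apply Rinv_0_lt_compat; now apply pow_lt.
  - apply Rmult_le_compat_r; auto. eapply Rle_trans; [exact Q2|].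
    apply Rle_trans with ((S0 * / rho) * (/ rho * delta)).
    + apply Rmult_le_compat; auto.
      * apply Rmult_le_pos; [lra|apply Rabs_pos].
      * apply Rmult_le_compat_l; lra.
    + right; unfold K; field; lra. }
(* Row 0 supplies the linear term in k; in each row i + 1 the power of h' contributes at least one
   factor [delta]. *)
assert (B2 : Rabs (Phi h' k - Phi h' k' - a 0%nat 1%nat * (k - k')) <= e * Rabs (k - k')).
{ destruct (Hce k) as [E1 _]; [lra|]. destruct (Hce k') as [E2 _]; [lra|].
  assert (F1 : ex_series (fun i => c i k * h' ^ i)) by (apply (ex_series_powers _ rho); auto; lra).
  assert (F2 : ex_series (fun i => c i k' * h' ^ i)) by (apply (ex_series_powers _ rho); auto; lra).
  unfold Phi. rewrite (Series_incr_1 _ F1), (Series_incr_1 _ F2).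
  apply ex_series_incr_1 in F1. apply ex_series_incr_1 in F2.
  set (R1 := Series (fun i => c (S i) k * h' ^ S i)). set (R2 := Series (fun i => c (S i) k' * h' ^ S i)).
  replace (_ - _ - _) with ((c 0%nat k - c 0%nat k' - a 0%nat 1%nat * (k - k')) + (R1 - R2))
    by (simpl; ring).
  pose proof (power_series_strict (a 0%nat) rho Hrho (Hin 0%nat) delta k k' Hd1 ltac:(lra) ltac:(lra)) as Q1.
  fold (c 0%nat k) in Q1. fold (c 0%nat k') in Q1. fold (A 0%nat) in Q1.
  eapply Rle_trans; [apply Rabs_triang|].
  apply Rle_trans with (2 * (delta * K) * Rabs (k - k') + (delta * K) * Rabs (k - k')); [|nra].
  apply Rplus_le_compat.
  - eapply Rle_trans; [exact Q1|].
    replace (2 * (delta * K) * Rabs (k - k')) with (S0 * (2 * delta / rho ^ 2 * Rabs (k - k')))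
      by (unfold K; field; lra).
    apply Rmult_le_compat_r; auto. apply Rmult_le_pos; auto.
    apply Rmult_le_pos; [lra|]. left; apply Rinv_0_lt_compat; now apply pow_lt.
  - unfold R1, R2. rewrite <- Series_minus; auto.
    destruct (Series_tail_bound A rho Hrho HAe 1
      (fun i => c (S i) k * h' ^ S i - c (S i) k' * h' ^ S i) (/ rho ^ 2 * delta * Rabs (k - k'))) as [_ Q].
    + apply Rmult_le_pos; auto. apply Rmult_le_pos; [|lra].
      left; apply Rinv_0_lt_compat; now apply pow_lt.
    + intros i. rewrite <- Rmult_minus_distr_r, Rabs_mult.
      pose proof (power_series_lipschitz (a (S i)) rho Hrho (Hin (S i)) k k' ltac:(lra) ltac:(lra)) as Q2.
      fold (c (S i) k) in Q2. fold (c (S i) k') in Q2. fold (A (S i)) in Q2.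
      apply Rle_trans with (A (S i) * (/ rho * Rabs (k - k')) * (delta * rho ^ i)).
      * apply Rmult_le_compat; auto using Rabs_pos.
        rewrite <- RPow_abs. simpl. apply Rmult_le_compat; auto using Rabs_pos; try lra.
        -- apply pow_le, Rabs_pos.
        -- apply pow_incr. split; [apply Rabs_pos|lra].
      * right. change (1 + i)%nat with (S i). rewrite (Rabs_pos_eq (A (S i))) by auto.
        simpl. field. lra.
    + eapply Rle_trans; [exact Q|]. fold S0. right. unfold K. field. lra. }
replace (Phi h k - Phi h' k' - _) with ((Phi h k - Phi h' k - a 1%nat 0%nat * (h - h'))
  + (Phi h' k - Phi h' k' - a 0%nat 1%nat * (k - k'))) by ring.
eapply Rle_trans; [apply Rabs_triang|]. lra.
Qed.

Lemma analytic_within_strict_diff D m H0 K0 :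
  analytic_within D m H0 K0 -> locally_2d D H0 K0 ->
  exists a b, strict_diff m H0 K0 a b.
Proof.
intros (a & rho & Hrho & Hin & Hout & Hm) [d HD].
pose proof (double_power_series_strict_diff a rho Hrho Hin Hout) as Hs.
set (Psi := fun h k => Series (fun i => Series (fun j => a i j * k ^ j) * h ^ i)) in *.
exists (a 1%nat 0%nat), (a 0%nat 1%nat).
apply strict_diff_ext_loc with (fun H K => Psi (H - H0) (K - K0)).
- assert (Hp : 0 < Rmin d rho) by (apply Rmin_pos; auto; apply cond_pos).
  exists (mkposreal _ Hp); cbn; intros H K HH HK.
  pose proof (Rmin_l d rho); pose proof (Rmin_r d rho).
  symmetry. replace H with (H0 + (H - H0)) at 1 by ring.
  replace K with (K0 + (K - K0)) at 1 by ring.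
  apply Hm; try lra.
  replace (H0 + (H - H0)) with H by ring. replace (K0 + (K - K0)) with K by ring.
  apply HD; lra.
- intros e He. destruct (Hs e He) as [d' H']. exists d'; intros u v u' v' Hu Hv Hu' Hv'.
  specialize (H' (u - H0) (v - K0) (u' - H0) (v' - K0)).
  rewrite !Rminus_0_r in H'.
  replace (u - H0 - (u' - H0)) with (u - u') in H' by ring.
  replace (v - K0 - (v' - K0)) with (v - v') in H' by ring.
  auto.
Qed.

(** K < H^2 makes (H, K) interior to [curvature_domain], so the series represents [m] on a full
    neighbourhood and not just on one side of the umbilic curve K = H^2. *)
Lemma mean_curvature_function_strict_diff m H K :
  mean_curvature_function m -> 0 < K < H ^ 2 -> exists a b, strict_diff m H K a b.
Proof.
intros hm HK. apply (analytic_within_strict_diff curvature_domain).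
- apply (mcf_analytic m hm); unfold curvature_domain; lra.
- assert (C1 := locally_2d_pos (fun _ k => k) H K (continuity_2d_pt_id2 H K) ltac:(lra)).
  assert (C2 := locally_2d_pos (fun h k => h * h - k) H K
    (continuity_2d_pt_minus _ _ _ _ (continuity_2d_pt_mult _ _ _ _ (continuity_2d_pt_id1 H K)
      (continuity_2d_pt_id1 H K)) (continuity_2d_pt_id2 H K)) ltac:(nra)).
  generalize (locally_2d_and _ _ _ _ C1 C2). apply locally_2d_impl.
  apply locally_2d_forall. unfold curvature_domain. intros u v []. nra.
Qed.

(** * Functions and charts of class C^n *)

Lemma locally_2d_locally_2d P x y :
  locally_2d P x y -> locally_2d (fun u v => locally_2d P u v) x y.
Proof.
intros H. apply locally_2d_impl_strong with (2 := H). now apply locally_2d_forall.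
Qed.

Lemma locally_2d_comp P f1 f2 x y :
  continuity_2d_pt f1 x y -> continuity_2d_pt f2 x y ->
  locally_2d P (f1 x y) (f2 x y) -> locally_2d (fun u v => P (f1 u v) (f2 u v)) x y.
Proof.
intros C1 C2 [d H].
generalize (locally_2d_and _ _ _ _ (C1 d) (C2 d)). apply locally_2d_impl.
apply locally_2d_forall. intros u v [H1 H2]. now apply H.
Qed.

Lemma ex_diff_n_strict_diff n f x y : locally_2d (ex_diff_n f (S n)) x y ->
  strict_diff f x y (Derive (fun t => f t y) x) (Derive (fun t => f x t) y).
Proof.
intros H.
destruct (locally_2d_singleton _ _ _ H) as (_ & _ & _ & D1 & D2).
apply (strict_diff_C1 f (fun u v => Derive (fun t => f t v) u) (fun u v => Derive (fun t => f u t) v)).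
- revert H. apply locally_2d_impl, locally_2d_forall. intros u v (_ & E1 & E2 & _).
  split; now apply Derive_correct.
- destruct n; apply D1.
- destruct n; apply D2.
Qed.

Lemma ex_diff_n_continuity n f x y : ex_diff_n f n x y -> continuity_2d_pt f x y.
Proof. destruct n; intros H; apply H. Qed.

Lemma ex_diff_n_locally_pred n f x y :
  locally_2d (ex_diff_n f (S n)) x y -> locally_2d (ex_diff_n f n) x y.
Proof.
apply locally_2d_impl, locally_2d_forall. intros u v. apply ex_diff_n_m. lia.
Qed.

(** Stated on neighbourhoods because the induction differentiates the formula for the partials of
    the sum, which must therefore hold near the point and not only at it. *)
Lemma ex_diff_n_plus n f g x y :
  locally_2d (ex_diff_n f n) x y -> locally_2d (ex_diff_n g n) x y ->
  locally_2d (ex_diff_n (fun u v => f u v + g u v) n) x y.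
Proof.
revert f g x y. induction n as [|n IH]; intros f g x y Hf Hg.
- generalize (locally_2d_and _ _ _ _ Hf Hg). apply locally_2d_impl, locally_2d_forall.
  intros u v [[Cf _] [Cg _]]. split; auto. now apply continuity_2d_pt_plus.
- generalize (locally_2d_locally_2d _ _ _ (locally_2d_and _ _ _ _ Hf Hg)).
  apply locally_2d_impl, locally_2d_forall. intros u v H.
  destruct (locally_2d_singleton _ _ _ H) as [(Cf & F1 & F2 & _) (Cg & G1 & G2 & _)].
  split; [now apply continuity_2d_pt_plus|].
  split; [now apply @ex_derive_plus|]. split; [now apply @ex_derive_plus|].
  split.
  + apply ex_diff_n_ext_loc with
      (fun u v => Derive (fun t => f t v) u + Derive (fun t => g t v) u).
    * revert H. apply locally_2d_impl, locally_2d_forall.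
      intros u' v' [(_ & E1 & _) (_ & E2 & _)]. symmetry. now apply Derive_plus.
    * apply locally_2d_singleton, IH; revert H; apply locally_2d_impl, locally_2d_forall.
      -- intros u' v' [(_ & _ & _ & E & _) _]. exact E.
      -- intros u' v' [_ (_ & _ & _ & E & _)]. exact E.
  + apply ex_diff_n_ext_loc with
      (fun u v => Derive (fun t => f u t) v + Derive (fun t => g u t) v).
    * revert H. apply locally_2d_impl, locally_2d_forall.
      intros u' v' [(_ & _ & E1 & _) (_ & _ & E2 & _)]. symmetry. now apply Derive_plus.
    * apply locally_2d_singleton, IH; revert H; apply locally_2d_impl, locally_2d_forall.
      -- intros u' v' [(_ & _ & _ & _ & E) _]. exact E.
      -- intros u' v' [_ (_ & _ & _ & _ & E)]. exact E.
Qed.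

Lemma ex_diff_n_mult n f g x y :
  locally_2d (ex_diff_n f n) x y -> locally_2d (ex_diff_n g n) x y ->
  locally_2d (ex_diff_n (fun u v => f u v * g u v) n) x y.
Proof.
revert f g x y. induction n as [|n IH]; intros f g x y Hf Hg.
- generalize (locally_2d_and _ _ _ _ Hf Hg). apply locally_2d_impl, locally_2d_forall.
  intros u v [[Cf _] [Cg _]]. split; auto. now apply continuity_2d_pt_mult.
- generalize (locally_2d_locally_2d _ _ _ (locally_2d_and _ _ _ _ Hf Hg)).
  apply locally_2d_impl, locally_2d_forall. intros u v H.
  destruct (locally_2d_singleton _ _ _ H) as [(Cf & F1 & F2 & _) (Cg & G1 & G2 & _)].
  assert (Lf : locally_2d (ex_diff_n f n) u v).
  { apply ex_diff_n_locally_pred. revert H; apply locally_2d_impl, locally_2d_forall. tauto. }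
  assert (Lg : locally_2d (ex_diff_n g n) u v).
  { apply ex_diff_n_locally_pred. revert H; apply locally_2d_impl, locally_2d_forall. tauto. }
  split; [now apply continuity_2d_pt_mult|].
  split; [now apply ex_derive_mult|]. split; [now apply ex_derive_mult|].
  split.
  + apply ex_diff_n_ext_loc with
      (fun u v => Derive (fun t => f t v) u * g u v + f u v * Derive (fun t => g t v) u).
    * revert H. apply locally_2d_impl, locally_2d_forall.
      intros u' v' [(_ & E1 & _) (_ & E2 & _)]. symmetry. now apply (Derive_mult (fun t => f t v') (fun t => g t v')).
    * apply locally_2d_singleton, ex_diff_n_plus; apply IH; auto;
      revert H; apply locally_2d_impl, locally_2d_forall.
      -- intros u' v' [(_ & _ & _ & E & _) _]. exact E.
      -- intros u' v' [_ (_ & _ & _ & E & _)]. exact E.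
  + apply ex_diff_n_ext_loc with
      (fun u v => Derive (fun t => f u t) v * g u v + f u v * Derive (fun t => g u t) v).
    * revert H. apply locally_2d_impl, locally_2d_forall.
      intros u' v' [(_ & _ & E1 & _) (_ & _ & E2 & _)]. symmetry. now apply (Derive_mult (fun t => f u' t) (fun t => g u' t)).
    * apply locally_2d_singleton, ex_diff_n_plus; apply IH; auto;
      revert H; apply locally_2d_impl, locally_2d_forall.
      -- intros u' v' [(_ & _ & _ & _ & E) _]. exact E.
      -- intros u' v' [_ (_ & _ & _ & _ & E)]. exact E.
Qed.

(** The strict chain rule writes the partials as sums of products, in which the partials of [g],
    composed with (f1, f2), fall under the induction hypothesis. *)
Lemma ex_diff_n_comp n g f1 f2 x y :
  locally_2d (ex_diff_n g n) (f1 x y) (f2 x y) ->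
  locally_2d (ex_diff_n f1 n) x y -> locally_2d (ex_diff_n f2 n) x y ->
  locally_2d (ex_diff_n (fun u v => g (f1 u v) (f2 u v)) n) x y.
Proof.
revert g f1 f2 x y. induction n as [|n IH]; intros g f1 f2 x y Hg H1 H2.
- apply locally_2d_locally_2d in Hg.
  apply (locally_2d_comp _ f1 f2) in Hg.
  2,3: eapply ex_diff_n_continuity, locally_2d_singleton; eassumption.
  generalize (locally_2d_and _ _ _ _ Hg (locally_2d_and _ _ _ _ H1 H2)).
  apply locally_2d_impl, locally_2d_forall. intros u v (Lg & [C1 _] & [C2 _]).
  split; auto. intros e.
  exact (locally_2d_comp _ f1 f2 u v C1 C2 (proj1 (locally_2d_singleton _ _ _ Lg) e)).
- assert (Hg' := locally_2d_locally_2d _ _ _ Hg).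
  apply (locally_2d_comp _ f1 f2) in Hg'.
  2,3: eapply ex_diff_n_continuity, locally_2d_singleton; eassumption.
  generalize (locally_2d_locally_2d _ _ _ (locally_2d_and _ _ _ _ Hg' (locally_2d_and _ _ _ _ H1 H2))).
  apply locally_2d_impl, locally_2d_forall. clear x y Hg H1 H2 Hg'. intros x y H.
  assert (Lg : locally_2d (ex_diff_n g (S n)) (f1 x y) (f2 x y)) by apply (locally_2d_singleton _ _ _ H).
  assert (L1 : locally_2d (ex_diff_n f1 (S n)) x y).
  { revert H; apply locally_2d_impl, locally_2d_forall. tauto. }
  assert (L2 : locally_2d (ex_diff_n f2 (S n)) x y).
  { revert H; apply locally_2d_impl, locally_2d_forall. tauto. }
  set (gx := fun u v => Derive (fun t => g t v) u).
  set (gy := fun u v => Derive (fun t => g u t) v).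
  assert (S : locally_2d (fun u v => strict_diff (fun u v => g (f1 u v) (f2 u v)) u v
     (gx (f1 u v) (f2 u v) * Derive (fun t => f1 t v) u + gy (f1 u v) (f2 u v) * Derive (fun t => f2 t v) u)
     (gx (f1 u v) (f2 u v) * Derive (fun t => f1 u t) v + gy (f1 u v) (f2 u v) * Derive (fun t => f2 u t) v)) x y).
  { generalize (locally_2d_locally_2d _ _ _ H). apply locally_2d_impl, locally_2d_forall.
    intros u v H'. apply strict_diff_comp; apply (ex_diff_n_strict_diff n).
    - apply (locally_2d_singleton _ _ _ H').
    - revert H'; apply locally_2d_impl, locally_2d_forall. tauto.
    - revert H'; apply locally_2d_impl, locally_2d_forall. tauto. }
  assert (S0 := locally_2d_singleton _ _ _ S). cbv beta in S0.
  assert (Hn1 := ex_diff_n_locally_pred _ _ _ _ L1).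
  assert (Hn2 := ex_diff_n_locally_pred _ _ _ _ L2).
  assert (Gx : locally_2d (ex_diff_n (fun u v => gx (f1 u v) (f2 u v)) n) x y).
  { apply IH; auto. revert Lg; apply locally_2d_impl, locally_2d_forall. intros u v E; apply E. }
  assert (Gy : locally_2d (ex_diff_n (fun u v => gy (f1 u v) (f2 u v)) n) x y).
  { apply IH; auto. revert Lg; apply locally_2d_impl, locally_2d_forall. intros u v E; apply E. }
  split; [exact (strict_diff_continuity_pt _ _ _ _ _ S0)|].
  split; [eexists; exact (strict_diff_is_derive_1 _ _ _ _ _ S0)|].
  split; [eexists; exact (strict_diff_is_derive_2 _ _ _ _ _ S0)|].
  split.
  + apply ex_diff_n_ext_loc with (fun u v => gx (f1 u v) (f2 u v) * Derive (fun t => f1 t v) u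
       + gy (f1 u v) (f2 u v) * Derive (fun t => f2 t v) u).
    * revert S. apply locally_2d_impl, locally_2d_forall. intros u v E. symmetry.
      exact (is_derive_unique _ _ _ (strict_diff_is_derive_1 _ _ _ _ _ E)).
    * apply locally_2d_singleton, ex_diff_n_plus; apply ex_diff_n_mult; auto.
      -- revert L1; apply locally_2d_impl, locally_2d_forall. intros u v E; apply E.
      -- revert L2; apply locally_2d_impl, locally_2d_forall. intros u v E; apply E.
  + apply ex_diff_n_ext_loc with (fun u v => gx (f1 u v) (f2 u v) * Derive (fun t => f1 u t) v
       + gy (f1 u v) (f2 u v) * Derive (fun t => f2 u t) v).
    * revert S. apply locally_2d_impl, locally_2d_forall. intros u v E. symmetry.
      exact (is_derive_unique _ _ _ (strict_diff_is_derive_2 _ _ _ _ _ E)).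
    * apply locally_2d_singleton, ex_diff_n_plus; apply ex_diff_n_mult; auto.
      -- revert L1; apply locally_2d_impl, locally_2d_forall. intros u v E; apply E.
      -- revert L2; apply locally_2d_impl, locally_2d_forall. intros u v E; apply E.
Qed.

(** Near the point, [alpha] read in [phi] is [alpha] read in an atlas chart composed with the
    coordinate change (a, b), itself of class C^k. [pr] stands for one coordinate of R^3. *)
Lemma local_chart_ex_diff_n {V : Type} (S : oriented_surface V) (alpha : V -> R3) (pr : R3 -> R)
    r k D phi x y :
  (forall i x y, dom S i x y ->
     ex_diff_n (fun u v => pr (in_chart alpha (par S i) u v)) r x y) ->
  (k <= r)%nat -> local_chart S k D phi -> D x y ->
  locally_2d (ex_diff_n (fun u v => pr (in_chart alpha phi u v)) k) x y.
Proof.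
intros Ha Hk (_ & _ & Hc) HD.
destruct (par_cover V S (phi x y)) as (i & x' & y' & Hd & Hp).
destruct (Hc i x y HD x' y' Hd Hp) as (a & b & Ea & Eb & Hloc).
assert (L : locally_2d (ex_diff_n (fun u v => pr (in_chart alpha (par S i) (a u v) (b u v))) k) x y).
{ apply (ex_diff_n_comp k (fun u v => pr (in_chart alpha (par S i) u v)) a b).
  - rewrite Ea, Eb. generalize (dom_open V S i x' y' Hd).
    apply locally_2d_impl, locally_2d_forall. intros u v Huv.
    apply ex_diff_n_m with (1 := Hk). now apply Ha.
  - revert Hloc; apply locally_2d_impl, locally_2d_forall. tauto.
  - revert Hloc; apply locally_2d_impl, locally_2d_forall. tauto. }
generalize (locally_2d_and _ _ _ _ L (locally_2d_locally_2d _ _ _ Hloc)).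
apply locally_2d_impl, locally_2d_forall. intros u v [E HL].
apply ex_diff_n_ext_loc with (2 := E).
revert HL; apply locally_2d_impl, locally_2d_forall. intros u' v' (_ & E' & _).
unfold in_chart. now rewrite E'.
Qed.

Lemma ex_diff_n_Schwarz f x y : locally_2d (ex_diff_n f 2) x y ->
  Derive (fun z => Derive (fun t => f z t) y) x = Derive (fun z => Derive (fun t => f t z) x) y.
Proof.
intros H.
destruct (locally_2d_singleton _ _ _ H) as (_ & _ & _ & (_ & _ & _ & _ & A1 & _) & (_ & _ & _ & (A2 & _) & _)).
apply Schwarz; auto.
revert H; apply locally_2d_impl, locally_2d_forall.
intros u v (_ & E1 & E2 & (_ & _ & E3 & _) & (_ & E4 & _)). auto.
Qed.

(** * Scalar differential equations *)

(** Compactness of the segment: [compactness_value_1d] gives one radius that, up to double negation,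
    lies below the gauge of some centre close to each point, and [Q] passes to smaller radii. *)
Lemma segment_uniform (Q : R -> R -> Prop) a b :
  (forall s d d', d <= d' -> Q s d' -> Q s d) ->
  (forall s0, a <= s0 <= b -> exists d : posreal, forall s, Rabs (s - s0) < d -> Q s d) ->
  exists d : posreal, forall s, a <= s <= b -> Q s d.
Proof.
intros Qmono Hloc.
assert (Hch : forall s0, exists d : posreal, a <= s0 <= b -> forall s, Rabs (s - s0) < d -> Q s d).
{ intros s0. destruct (classic (a <= s0 <= b)) as [H|H].
  - destruct (Hloc s0 H) as [d Hd]. now exists d.
  - exists (mkposreal 1 Rlt_0_1). contradiction. }
set (delta := fun s0 => proj1_sig (constructive_indefinite_description _ (Hch s0))).
destruct (compactness_value_1d a b delta) as [d Hd].
exists d; intros s Hs. apply NNPP; intros Hn. apply (Hd s Hs).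
intros (t & Ht & Hst & Hdt). apply Hn. apply (Qmono _ _ _ Hdt).
unfold delta in *. destruct (constructive_indefinite_description _ (Hch t)) as [dt Hdt']; simpl in *.
auto.
Qed.

Lemma continuous_bounded (f : R -> R) a b : a <= b -> (forall x, continuous f x) ->
  exists M, 0 < M /\ forall x, a <= x <= b -> Rabs (f x) <= M.
Proof.
intros Hab Hf.
destruct (continuity_ab_maj (fun x => Rabs (f x)) a b Hab) as [m [Hm _]].
- intros c _. apply continuity_pt_filterlim. apply (continuous_comp f Rabs); [apply Hf|].
  apply continuous_Rabs.
- exists (Rabs (f m) + 1). split; [pose proof (Rabs_pos (f m)); lra|].
  intros x Hx. specialize (Hm x Hx). lra.
Qed.

(* The square of [v] discounted by [exp (- 2 C s)] is nonincreasing as long as [|v| < delta]. *)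
Lemma growth_step (v w : R -> R) C t delta : 0 <= t -> 0 <= C ->
  (forall s, 0 <= s <= t -> is_derive v s (w s)) ->
  (forall s, 0 <= s < t -> Rabs (v s) < delta -> Rabs (w s) <= C * Rabs (v s)) ->
  (forall s, 0 <= s < t -> Rabs (v s) < delta) ->
  Rabs (v t) <= Rabs (v 0) * exp (C * t).
Proof.
intros Ht HC Hv Hw Hd.
destruct (Req_dec t 0) as [->|Ht0].
{ rewrite Rmult_0_r, exp_0. lra. }
destruct (MVT_cor2 (fun s => v s ^ 2 * exp (- 2 * C * s))
  (fun s => (2 * v s * w s - 2 * C * v s ^ 2) * exp (- 2 * C * s)) 0 t) as (c & Hc & Hct); [lra| |].
{ intros c Hc. apply is_derive_Reals.
  pose proof (Hv c Hc) as D.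
  evar_last.
  - apply (is_derive_mult (fun s => v s ^ 2) (fun s => exp (- 2 * C * s))).
    + apply is_derive_pow. exact D.
    + auto_derive; [auto|]. reflexivity.
    + intros; apply Rmult_comm.
  - unfold plus, mult; simpl. ring. }
assert (Hle : (2 * v c * w c - 2 * C * v c ^ 2) * exp (- 2 * C * c) * (t - 0) <= 0).
{ specialize (Hw c ltac:(lra) ltac:(apply Hd; lra)).
  assert (v c * w c <= C * v c ^ 2).
  { apply Rle_trans with (Rabs (v c * w c)); [apply Rle_abs|].
    rewrite Rabs_mult, <- (pow2_abs (v c)). pose proof (Rabs_pos (v c)). nra. }
  pose proof (exp_pos (- 2 * C * c)).
  assert ((2 * v c * w c - 2 * C * v c ^ 2) * exp (- 2 * C * c) <= 0) by nra. nra. }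
rewrite <- Hc in Hle. rewrite Rmult_0_r, exp_0 in Hle.
assert (He : exp (- 2 * C * t) = / exp (C * t) ^ 2).
{ replace (- 2 * C * t) with (- (C * t + C * t)) by ring. rewrite exp_Ropp, exp_plus. f_equal; ring. }
rewrite He in Hle. pose proof (exp_pos (C * t)) as Hp.
assert (v t ^ 2 <= v 0 ^ 2 * exp (C * t) ^ 2).
{ assert (0 < exp (C * t) ^ 2) by now apply pow_lt.
  apply Rmult_le_reg_r with (/ exp (C * t) ^ 2); [now apply Rinv_0_lt_compat|].
  rewrite Rmult_assoc, Rinv_r; lra. }
apply Rsqr_incr_0; unfold Rsqr.
- replace (Rabs (v t) * Rabs (v t)) with (v t ^ 2) by (rewrite <- pow2_abs; ring).
  replace (Rabs (v 0) * exp (C * t) * (Rabs (v 0) * exp (C * t))) with (v 0 ^ 2 * exp (C * t) ^ 2)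
    by (rewrite <- (pow2_abs (v 0)); ring).
  assumption.
- apply Rabs_pos.
- apply Rmult_le_pos; [apply Rabs_pos|lra].
Qed.

(** Continuation argument: while |v| < delta the growth bound holds, and that bound is itself
    strictly below [delta], so by continuity the good times cannot stop before L. Control of the
    derivative is assumed only where |v| < delta. *)
Lemma trapped_growth (v w : R -> R) C L delta : 0 <= L -> 0 <= C ->
  (forall s, 0 <= s <= L -> is_derive v s (w s)) ->
  (forall s, 0 <= s <= L -> Rabs (v s) < delta -> Rabs (w s) <= C * Rabs (v s)) ->
  Rabs (v 0) * exp (C * L) < delta ->
  forall s, 0 <= s <= L -> Rabs (v s) <= Rabs (v 0) * exp (C * s).
Proof.
intros HL HC Hv Hw H0.
assert (Hexp : forall s, s <= L -> Rabs (v 0) * exp (C * s) < delta).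
{ intros s Hs. apply Rle_lt_trans with (2 := H0). apply Rmult_le_compat_l; [apply Rabs_pos|].
  destruct (Req_dec s L) as [->|Hn]; [lra|].
  destruct (Req_dec C 0) as [->|HC0]; [rewrite !Rmult_0_l; lra|].
  left. apply exp_increasing. apply Rmult_lt_compat_l; lra. }
assert (Hstep : forall t, 0 <= t <= L -> (forall s, 0 <= s < t -> Rabs (v s) < delta) ->
  Rabs (v t) <= Rabs (v 0) * exp (C * t)).
{ intros t Ht Hs. apply growth_step with w delta; try lra; auto.
  - intros s Hs'. apply Hv; lra.
  - intros s Hs'. apply Hw; lra. }
assert (Hstep' : forall t, 0 <= t <= L -> (forall s, 0 <= s < t -> Rabs (v s) < delta) -> Rabs (v t) < delta).
{ intros t Ht Hs. eapply Rle_lt_trans; [now apply Hstep|]. apply Hexp; lra. }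
set (E := fun t => 0 <= t <= L /\ forall s, 0 <= s <= t -> Rabs (v s) < delta).
assert (E0 : E 0).
{ split; [lra|]. intros s Hs. replace s with 0 by lra. apply Hstep'; [lra|]. intros; lra. }
destruct (completeness E) as [T [HT1 HT2]].
{ exists L. intros x [Hx _]. lra. }
{ now exists 0. }
assert (HT : 0 <= T <= L).
{ split; [now apply HT1|]. apply HT2. intros x [Hx _]. lra. }
assert (HTs : forall s, 0 <= s < T -> Rabs (v s) < delta).
{ intros s Hs. apply NNPP. intros Hn.
  assert (T <= s); [|lra]. apply HT2. intros x [Hx1 Hx2].
  apply Rnot_lt_le. intros Hsx. apply Hn, Hx2. lra. }
assert (HTT : T = L).
{ apply NNPP. intros Hn.
  pose proof (Hstep' T HT HTs) as HvT.
  assert (Cv := is_derive_continuity_pt _ _ _ (Hv T HT)).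
  destruct (Cv (delta - Rabs (v T))) as [eta [Heta Hc]]; [lra|].
  (* A time beyond the supremum [T] that still belongs to [E]: eta / 2 stays within the continuity
     radius at [T], and L - T within the interval. *)
  set (t := T + Rmin (eta / 2) (L - T)).
  assert (0 < Rmin (eta / 2) (L - T)) by (apply Rmin_pos; lra).
  pose proof (Rmin_l (eta / 2) (L - T)); pose proof (Rmin_r (eta / 2) (L - T)).
  assert (Et : E t); [|apply HT1 in Et; unfold t in Et; lra].
  split; [unfold t; lra|]. intros s Hs.
  destruct (Rlt_le_dec s T) as [Hlt|Hle]; [apply HTs; lra|].
  destruct (Req_dec s T) as [->|Hne]; [exact HvT|].
  specialize (Hc s). simpl in Hc. unfold R_dist, D_x, no_cond in Hc.
  assert (Rabs (v s - v T) < delta - Rabs (v T)).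
  { apply Hc. split; [split; auto|]. unfold t in Hs. rewrite Rabs_pos_eq; lra. }
  replace (v s) with ((v s - v T) + v T) by ring.
  eapply Rle_lt_trans; [apply Rabs_triang|]. lra. }
subst T. intros s Hs. apply Hstep; auto. intros s' Hs'. apply HTs. lra.
Qed.

(** Integrating factor: (v exp (- Om))' = (w - om v) exp (- Om), and the mean value theorem bounds
    its total change. [K] is fixed before [v] and [e], so that [e] may later be chosen in terms of
    [K]. *)
Lemma linearized_growth (om : R -> R) C L : 0 < L -> 0 <= C -> (forall s, continuous om s) ->
  exists K, 0 < K /\ forall v w e, 0 <= e ->
    (forall s, 0 <= s <= L -> is_derive v s (w s)) ->
    (forall s, 0 <= s <= L -> Rabs (w s - om s * v s) <= e * Rabs (v s)) ->
    (forall s, 0 <= s <= L -> Rabs (v s) <= Rabs (v 0) * exp (C * s)) ->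
    Rabs (v L - v 0 * exp (RInt om 0 L)) <= K * e * Rabs (v 0).
Proof.
intros HL HC Hom.
set (Om := fun s => RInt om 0 s).
assert (HOm : forall s, is_derive Om s (om s)).
{ intros s. apply (is_derive_RInt om Om 0 s); [|apply Hom].
  apply filter_forall. intros x. apply (@RInt_correct R_CompleteNormedModule), ex_RInt_continuous.
  intros; apply Hom. }
destruct (continuous_bounded (fun s => exp (- Om s)) 0 L) as (M & HM & HMb); [lra| |].
{ intros x. apply (@ex_derive_continuous R_AbsRing R_NormedModule).
  eexists. apply (is_derive_comp exp (fun s => - Om s)); [apply is_derive_exp|].
  apply (is_derive_opp Om), HOm. }
exists (exp (Om L) * (M * exp (C * L) * L)). split.
{ pose proof (exp_pos (Om L)). pose proof (exp_pos (C * L)).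
  repeat apply Rmult_lt_0_compat; auto. }
intros v w e He Hv Hw Hg.
destruct (MVT_cor2 (fun s => v s * exp (- Om s)) (fun s => (w s - om s * v s) * exp (- Om s)) 0 L)
  as (c & Hc & Hct); [lra| |].
{ intros c Hc. apply is_derive_Reals. evar_last.
  - apply (is_derive_mult v (fun s => exp (- Om s))).
    + now apply Hv.
    + apply (is_derive_comp exp (fun s => - Om s)); [apply is_derive_exp|].
      apply (is_derive_opp Om), HOm.
    + intros; apply Rmult_comm.
  - unfold plus, mult, scal, opp; simpl. unfold mult; simpl. ring. }
assert (Om0 : Om 0 = 0) by (apply (@RInt_point R_CompleteNormedModule)).
rewrite Om0, Ropp_0, exp_0, Rmult_1_r in Hc.
fold (Om L).
replace (v L - v 0 * exp (Om L)) with (exp (Om L) * (v L * exp (- Om L) - v 0)).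
2:{ rewrite exp_Ropp. field. pose proof (exp_pos (Om L)); lra. }
rewrite Hc, !Rabs_mult, (Rabs_pos_eq (exp (Om L))), (Rabs_pos_eq (L - 0)); [|lra|left; apply exp_pos].
rewrite Rminus_0_r.
specialize (HMb c ltac:(lra)). specialize (Hw c ltac:(lra)). specialize (Hg c ltac:(lra)).
rewrite !Rmult_assoc. apply Rmult_le_compat_l; [left; apply exp_pos|].
rewrite <- !Rmult_assoc.
replace (M * exp (C * L) * L * e * Rabs (v 0)) with ((e * (Rabs (v 0) * exp (C * L))) * M * L) by ring.
apply Rmult_le_compat_r; [lra|].
apply Rmult_le_compat; auto using Rabs_pos.
eapply Rle_trans; [exact Hw|]. apply Rmult_le_compat_l; auto.
eapply Rle_trans; [exact Hg|]. apply Rmult_le_compat_l; [apply Rabs_pos|].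
destruct (Req_dec C 0) as [->|HC0]; [rewrite !Rmult_0_l; lra|].
left. apply exp_increasing. apply Rmult_lt_compat_l; lra.
Qed.

(** The intervals with centre u n and radius 2 K / 2^n are nested, and the supremum of their left
    ends lies in all of them. The explicit rate makes pointwise use yield uniform convergence. *)
Lemma geometric_cauchy (u : nat -> R) K :
  (forall n, Rabs (u (S n) - u n) <= K * (/ 2) ^ n) ->
  exists l, forall n, Rabs (l - u n) <= 2 * K * (/ 2) ^ n.
Proof.
intros H.
assert (Hp : forall n, 0 < (/ 2) ^ n) by (intros; apply pow_lt; lra).
set (lo := fun n => u n - 2 * K * (/ 2) ^ n). set (hi := fun n => u n + 2 * K * (/ 2) ^ n).
assert (HK : 0 <= K).
{ specialize (H O). simpl in H. pose proof (Rabs_pos (u 1%nat - u 0%nat)). lra. }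
assert (Hs : forall n, lo n <= lo (S n) /\ hi (S n) <= hi n).
{ intros n. unfold lo, hi. specialize (H n). apply Rabs_le_between in H.
  simpl. split; lra. }
assert (Hlo : forall n k, lo n <= lo (n + k)%nat).
{ intros n k. induction k as [|k IH]; [rewrite Nat.add_0_r; lra|].
  rewrite Nat.add_succ_r. pose proof (Hs (n + k)%nat). lra. }
assert (Hhi : forall n k, hi (n + k)%nat <= hi n).
{ intros n k. induction k as [|k IH]; [rewrite Nat.add_0_r; lra|].
  rewrite Nat.add_succ_r. pose proof (Hs (n + k)%nat). lra. }
assert (Hlh : forall n, lo n <= hi n).
{ intros n. unfold lo, hi. specialize (Hp n). nra. }
assert (Hnm : forall n m, lo n <= hi m).
{ intros n m. eapply Rle_trans; [apply (Hlo n m)|]. eapply Rle_trans; [apply Hlh|].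
  rewrite Nat.add_comm. apply Hhi. }
destruct (completeness (fun x => exists n, x = lo n)) as [l [H1 H2]].
{ exists (hi 0%nat). intros x [n ->]. apply Hnm. }
{ exists (lo 0%nat). now exists 0%nat. }
exists l. intros n. apply Rabs_le_between.
assert (lo n <= l) by (apply H1; now exists n).
assert (l <= hi n) by (apply H2; intros x [m ->]; apply Hnm).
unfold lo, hi in *. lra.
Qed.

(** * Truncation, and Picard iteration for globally Lipschitz fields *)

Definition clamp (a b x : R) : R := Rmax a (Rmin b x).

Lemma clamp_bounds a b x : a <= b -> a <= clamp a b x <= b.
Proof.
intros H. unfold clamp. split; [apply Rmax_l|]. apply Rmax_lub; [exact H|apply Rmin_l].
Qed.

Lemma clamp_id a b x : a <= x <= b -> clamp a b x = x.
Proof. intros H. unfold clamp. rewrite Rmin_right, Rmax_right; lra. Qed.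

Lemma clamp_lipschitz a b x y : Rabs (clamp a b x - clamp a b y) <= Rabs (x - y).
Proof.
unfold clamp, Rmax, Rmin.
repeat destruct Rle_dec; unfold Rabs; repeat destruct Rcase_abs; lra.
Qed.

Lemma clamp_continuous a b x : continuous (clamp a b) x.
Proof.
apply filterlim_locally. intros e. exists e. intros y Hy.
change (Rabs (clamp a b y - clamp a b x) < e). change (Rabs (y - x) < e) in Hy.
eapply Rle_lt_trans; [apply clamp_lipschitz|exact Hy].
Qed.

Section Picard.
Context (F : R -> R -> R) (C L v0 : R) (HL : 0 < L) (HC : 0 < C)
  (Flip : forall t v v', Rabs (F t v - F t v') <= C * Rabs (v - v'))
  (Fcont : forall q, (forall t, continuous q t) -> forall t, continuous (fun t => F t (q t)) t).

(** Clamping the time keeps each iterate continuous on the whole line and constant outside [0, L],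
    which avoids one-sided continuity at the ends. *)
Definition picard_step (q : R -> R) (t : R) : R :=
  v0 + RInt (fun x => F x (q x)) 0 (clamp 0 L t).

Fixpoint picard_iter (n : nat) : R -> R :=
  match n with O => fun _ => v0 | S n => picard_step (picard_iter n) end.

Lemma ex_RInt_F (q : R -> R) a b :
  (forall t, continuous q t) -> ex_RInt (fun x => F x (q x)) a b.
Proof.
intros Hq. apply (@ex_RInt_continuous R_CompleteNormedModule). intros; now apply Fcont.
Qed.

Lemma is_derive_RInt_F (q : R -> R) s : (forall t, continuous q t) ->
  is_derive (fun s => v0 + RInt (fun x => F x (q x)) 0 s) s (F s (q s)).
Proof.
intros Hq. replace (F s (q s)) with (0 + F s (q s)) by ring.
apply @is_derive_plus; [apply @is_derive_const|].
apply (is_derive_RInt (fun x => F x (q x)) _ 0 s); [|now apply Fcont].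
apply filter_forall. intros x. now apply (@RInt_correct R_CompleteNormedModule), ex_RInt_F.
Qed.

Lemma picard_step_continuous q : (forall t, continuous q t) -> forall t, continuous (picard_step q) t.
Proof.
intros Hq t. unfold picard_step.
apply (continuous_comp (clamp 0 L) (fun s => v0 + RInt (fun x => F x (q x)) 0 s)).
- apply clamp_continuous.
- apply (@ex_derive_continuous R_AbsRing R_NormedModule). eexists. now apply is_derive_RInt_F.
Qed.

Lemma picard_iter_continuous n t : continuous (picard_iter n) t.
Proof.
revert t. induction n as [|n IH]; intros t; simpl.
- apply continuous_const.
- now apply picard_step_continuous.
Qed.

(* In the norm weighted by [exp (- 2 C t)] the Picard operator halves distances. *)
Lemma picard_step_contraction q q' D : 0 <= D ->
  (forall t, continuous q t) -> (forall t, continuous q' t) ->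
  (forall t, 0 <= t <= L -> Rabs (q t - q' t) <= D * exp (2 * C * t)) ->
  forall t, Rabs (picard_step q t - picard_step q' t) <= D / 2 * exp (2 * C * clamp 0 L t).
Proof.
intros HD Hq Hq' Hb t. unfold picard_step.
destruct (clamp_bounds 0 L t) as [Ht0 HtL]; [lra|]. set (s := clamp 0 L t) in *.
replace (_ - _) with (RInt (fun x => F x (q x)) 0 s - RInt (fun x => F x (q' x)) 0 s) by ring.
assert (I1 := ex_RInt_F q 0 s Hq). assert (I2 := ex_RInt_F q' 0 s Hq').
apply Rle_trans with (D / 2 * exp (2 * C * s) - D / 2 * exp (2 * C * 0)).
2:{ pose proof (exp_pos (2 * C * 0)). nra. }
apply (norm_RInt_le (V := R_NormedModule) (fun x => F x (q x) - F x (q' x))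
   (fun x => C * (D * exp (2 * C * x))) 0 s); auto.
- intros x Hx. change norm with Rabs. eapply Rle_trans; [apply Flip|].
  apply Rmult_le_compat_l; [lra|]. apply Hb; lra.
- apply (is_RInt_minus (V := R_NormedModule)); now apply (@RInt_correct R_CompleteNormedModule).
- apply (is_RInt_derive (V := R_CompleteNormedModule) (fun x => D / 2 * exp (2 * C * x))).
  + intros x _. auto_derive; auto. field.
  + intros x _. apply (@ex_derive_continuous R_AbsRing R_NormedModule). auto_derive. auto.
Qed.

Lemma picard : exists v : R -> R, v 0 = v0 /\ forall s, 0 <= s <= L -> is_derive v s (F s (v s)).
Proof.
destruct (continuous_bounded (fun t => picard_step (picard_iter 0) t - v0) 0 L) as (D & HD & HDb); [lra| |].
{ intros t. apply (continuous_minus (V := R_NormedModule) (picard_iter 1) (fun _ => v0)).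
  - apply picard_iter_continuous.
  - apply continuous_const. }
assert (Hexp : forall t, 0 <= t <= L -> 1 <= exp (2 * C * t) <= exp (2 * C * L)).
{ intros t Ht. split.
  - destruct (Req_dec t 0) as [->|Hn]; [rewrite Rmult_0_r, exp_0; lra|].
    rewrite <- exp_0 at 1. left. apply exp_increasing. nra.
  - destruct (Req_dec t L) as [->|Hn]; [lra|]. left. apply exp_increasing. nra. }
assert (Hp : forall n, 0 < (/ 2) ^ n) by (intros; apply pow_lt; lra).
assert (Hit : forall n t, 0 <= t <= L ->
  Rabs (picard_iter (S n) t - picard_iter n t) <= D * (/ 2) ^ n * exp (2 * C * t)).
{ induction n as [|n IH]; intros t Ht.
  - simpl (_ ^ 0). rewrite Rmult_1_r. specialize (HDb t Ht). simpl in *.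
    specialize (Hexp t Ht). nra.
  - change (picard_iter (S (S n))) with (picard_step (picard_iter (S n))).
    change (picard_iter (S n) t) with (picard_step (picard_iter n) t).
    eapply Rle_trans; [apply (picard_step_contraction _ _ (D * (/ 2) ^ n))|].
    + specialize (Hp n). nra.
    + apply picard_iter_continuous.
    + apply picard_iter_continuous.
    + exact IH.
    + rewrite clamp_id by exact Ht. right. simpl. field. }
set (K := D * exp (2 * C * L)).
assert (HK : 0 < K) by (apply Rmult_lt_0_compat; [auto|apply exp_pos]).
assert (Hlim : forall t, exists l, 0 <= t <= L -> forall n, Rabs (l - picard_iter n t) <= 2 * K * (/ 2) ^ n).
{ intros t. destruct (classic (0 <= t <= L)) as [Ht|Ht]; [|exists 0; contradiction].
  destruct (geometric_cauchy (fun n => picard_iter n t) K) as [l Hl]; [|now exists l].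
  intros n. eapply Rle_trans; [now apply Hit|]. unfold K.
  replace (D * exp (2 * C * L) * (/ 2) ^ n) with (D * (/ 2) ^ n * exp (2 * C * L)) by ring.
  apply Rmult_le_compat_l; [|now apply Hexp]. specialize (Hp n). nra. }
set (q0 := fun t => proj1_sig (constructive_indefinite_description _ (Hlim t))).
assert (Hq0 : forall t n, 0 <= t <= L -> Rabs (q0 t - picard_iter n t) <= 2 * K * (/ 2) ^ n).
{ intros t n Ht. unfold q0. destruct constructive_indefinite_description as [l Hl]. now apply Hl. }
(* Extended by constants, the limit is continuous everywhere, being a uniform limit of the clamped
   iterates. *)
set (q := fun t => q0 (clamp 0 L t)).
assert (Hqn : forall t n, Rabs (q t - picard_iter n (clamp 0 L t)) <= 2 * K * (/ 2) ^ n).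
{ intros t n. apply Hq0. apply clamp_bounds; lra. }
assert (Hsmall : forall e, 0 < e -> exists n, 2 * K * (/ 2) ^ n < e).
{ intros e He. destruct (pow_lt_1_zero (/ 2)) with (y := e / (2 * K)) as [n Hn].
  - rewrite Rabs_pos_eq; lra.
  - apply Rdiv_lt_0_compat; lra.
  - exists n. specialize (Hn n (le_n n)). rewrite Rabs_pos_eq in Hn by (left; auto).
    apply Rlt_le_trans with (2 * K * (e / (2 * K))).
    + apply Rmult_lt_compat_l; lra.
    + right. field. lra. }
assert (Hqc : forall t, continuous q t).
{ intros t. apply filterlim_locally. intros e.
  destruct (Hsmall (e / 3)) as [n Hn]; [pose proof (cond_pos e); lra|].
  assert (Cn : continuous (fun t => picard_iter n (clamp 0 L t)) t).
  { apply (continuous_comp (clamp 0 L) (picard_iter n)); [apply clamp_continuous|apply picard_iter_continuous]. }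
  assert (He3 : 0 < e / 3) by (pose proof (cond_pos e); lra).
  generalize (proj1 (filterlim_locally _ _) Cn (mkposreal _ He3)).
  apply filter_imp. intros y Hy.
  change (Rabs (picard_iter n (clamp 0 L y) - picard_iter n (clamp 0 L t)) < e / 3) in Hy.
  change (Rabs (q y - q t) < e).
  pose proof (Hqn y n) as B1. pose proof (Hqn t n) as B2. rewrite Rabs_minus_sym in B2.
  replace (q y - q t) with ((q y - picard_iter n (clamp 0 L y))
    + (picard_iter n (clamp 0 L y) - picard_iter n (clamp 0 L t)) + (picard_iter n (clamp 0 L t) - q t)) by ring.
  eapply Rle_lt_trans; [apply Rabs_triang|].
  apply Rle_lt_trans with (2 * K * (/ 2) ^ n + e / 3 + 2 * K * (/ 2) ^ n); [|lra].
  apply Rplus_le_compat; [|exact B2].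
  eapply Rle_trans; [apply Rabs_triang|]. lra. }
(* The solution is this integral rather than [q]: they agree on [0, L], but the integral has
   two-sided derivatives at 0 and L as well. *)
set (v := fun s => v0 + RInt (fun x => F x (q x)) 0 s).
assert (Hvq : forall s, 0 <= s <= L -> v s = q s).
{ intros s Hs. apply cond_eq. intros e He.
  set (E := exp (2 * C * L)). assert (HE : 0 < E) by apply exp_pos.
  destruct (Hsmall (e / (E + 1))) as [n Hn]; [apply Rdiv_lt_0_compat; lra|].
  assert (Hps : v s = picard_step q s) by (unfold picard_step; now rewrite clamp_id).
  assert (B1 : Rabs (picard_step q s - picard_step (picard_iter n) s) <= 2 * K * (/ 2) ^ n / 2 * E).
  { eapply Rle_trans; [apply (picard_step_contraction q (picard_iter n) (2 * K * (/ 2) ^ n))|].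
    - specialize (Hp n). nra.
    - exact Hqc.
    - apply picard_iter_continuous.
    - intros t Ht. pose proof (Hqn t n) as B. rewrite clamp_id in B by exact Ht.
      specialize (Hexp t Ht). specialize (Hp n).
      assert (0 < 2 * K * (/ 2) ^ n) by nra. nra.
    - rewrite clamp_id by exact Hs. specialize (Hexp s Hs). specialize (Hp n).
      apply Rmult_le_compat_l; [nra|]. unfold E; lra. }
  pose proof (Hqn s (S n)) as B2. rewrite clamp_id in B2 by exact Hs. rewrite Rabs_minus_sym in B2.
  change (picard_iter (S n) s) with (picard_step (picard_iter n) s) in B2.
  rewrite Hps.
  replace (picard_step q s - q s) with ((picard_step q s - picard_step (picard_iter n) s)
     + (picard_step (picard_iter n) s - q s)) by ring.
  eapply Rle_lt_trans; [apply Rabs_triang|].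
  simpl (_ ^ S n) in B2.
  apply Rle_lt_trans with (2 * K * (/ 2) ^ n * (E + 1)).
  - assert (0 < 2 * K * (/ 2) ^ n) by (specialize (Hp n); nra). nra.
  - apply Rlt_le_trans with (e / (E + 1) * (E + 1)).
    + apply Rmult_lt_compat_r; lra.
    + right. field. lra. }
exists v. split.
- unfold v. rewrite (@RInt_point R_CompleteNormedModule). unfold zero; simpl. ring.
- intros s Hs. rewrite (Hvq s Hs). now apply is_derive_RInt_F.
Qed.

End Picard.

(** * The Poincare map near a trivial solution *)

(** The strict estimates at s0 and at s are applied to one and the same short increment from (s, 0)
    to (s, v); dividing by v compares om s with om s0. *)
Lemma strict_diff_partial_continuous W (al om : R -> R) :
  (forall s, strict_diff W s 0 (al s) (om s)) -> forall s, continuous om s.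
Proof.
intros HW s0. apply filterlim_locally. intros e.
assert (He : 0 < e / 3) by (pose proof (cond_pos e); lra).
destruct (HW s0 _ He) as [d H]. exists d. intros s Hs.
change (Rabs (s - s0) < d) in Hs. change (Rabs (om s - om s0) < e).
destruct (HW s _ He) as [d' H'].
set (v := Rmin d d' / 2).
assert (Hm : 0 < Rmin d d') by (apply Rmin_pos; apply cond_pos).
pose proof (Rmin_l d d') as M1; pose proof (Rmin_r d d') as M2.
assert (Hv : 0 < v) by (unfold v; lra).
assert (Hv1 : Rabs (v - 0) < d) by (rewrite Rminus_0_r, Rabs_pos_eq; unfold v; lra).
assert (Hv2 : Rabs (v - 0) < d') by (rewrite Rminus_0_r, Rabs_pos_eq; unfold v; lra).
assert (H0 : Rabs (0 - 0) < d) by (rewrite Rminus_0_r, Rabs_R0; apply cond_pos).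
assert (H0' : Rabs (0 - 0) < d') by (rewrite Rminus_0_r, Rabs_R0; apply cond_pos).
assert (H1 : Rabs (s - s) < d') by (rewrite Rminus_diag, Rabs_R0; apply cond_pos).
specialize (H s v s 0 Hs Hv1 Hs H0). specialize (H' s v s 0 H1 Hv2 H1 H0').
rewrite Rminus_diag, Rabs_R0, Rminus_0_r, Rmult_0_r, !Rplus_0_l, (Rabs_pos_eq v) in H, H' by lra.
assert (Hd : Rabs ((om s - om s0) * v) <= 2 * (e / 3) * v).
{ replace ((om s - om s0) * v) with ((W s v - W s 0 - om s0 * v) - (W s v - W s 0 - om s * v)) by ring.
  eapply Rle_trans; [apply Rabs_triang|]. rewrite Rabs_Ropp. lra. }
rewrite Rabs_mult, (Rabs_pos_eq v) in Hd by lra.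
apply Rmult_le_reg_r in Hd; auto. pose proof (cond_pos e); lra.
Qed.

Section PoincareMap.
Context (W : R -> R -> R) (om : R -> R) (Dir : R -> R -> R -> Prop) (L eps : R)
  (HL : 0 < L) (Heps : 0 < eps)
  (W0 : forall s, W s 0 = 0)
  (HW : forall s, strict_diff W s 0 0 (om s))
  (HDir : forall s, locally_2d (fun s v => forall d, Dir s v d <-> d = W s v) s 0).

Let line (v : R -> R) := forall s, 0 <= s <= L ->
  Rabs (v s) < eps /\ ex_derive v s /\ Dir s (v s) (Derive v s).
Let is_poincare (P : R -> R) :=
  locally 0 (fun v0 => exists v, line v /\ v 0 = v0 /\ P v0 = v L).

Let om_continuous s : continuous om s := strict_diff_partial_continuous W _ om HW s.

(** Near (s0, 0) strict differentiability with error 1 gives the Lipschitz constant |om s0| + 1 in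
    v, at most M + 1 on the segment; compactness makes the radius common. *)
Lemma slope_uniform : exists (d : posreal) C, 0 < C /\ forall s, 0 <= s <= L ->
  (forall v e, Rabs v < d -> (Dir s v e <-> e = W s v)) /\
  (forall v, Rabs v < d -> continuity_2d_pt W s v) /\
  (forall v v', Rabs v < d -> Rabs v' < d -> Rabs (W s v - W s v') <= C * Rabs (v - v')).
Proof.
destruct (continuous_bounded om 0 L) as (M & HM & HMb); [lra|exact om_continuous|].
destruct (segment_uniform (fun s d =>
  (forall v e, Rabs v < d -> (Dir s v e <-> e = W s v)) /\
  (forall v, Rabs v < d -> continuity_2d_pt W s v) /\
  (forall v v', Rabs v < d -> Rabs v' < d -> Rabs (W s v - W s v') <= (M + 1) * Rabs (v - v'))) 0 L)
  as [d Hd].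
- intros s d d' Hdd (A1 & A2 & A3). split; [|split]; intros.
  + apply A1; lra.
  + apply A2; lra.
  + apply A3; lra.
- intros s0 Hs0. destruct (HDir s0) as [d1 H1].
  destruct (strict_diff_continuity _ _ _ _ _ (HW s0)) as [d2 H2].
  destruct (HW s0 1 Rlt_0_1) as [d3 H3].
  assert (Hp : 0 < Rmin d1 (Rmin d2 d3)) by (repeat apply Rmin_pos; apply cond_pos).
  exists (mkposreal _ Hp); cbn. intros s Hs.
  pose proof (Rmin_l d1 (Rmin d2 d3)); pose proof (Rmin_r d1 (Rmin d2 d3));
  pose proof (Rmin_l d2 d3); pose proof (Rmin_r d2 d3).
  split; [|split].
  + intros v e Hv. apply H1; [lra|]. rewrite Rminus_0_r; lra.
  + intros v Hv. apply H2; [lra|]. rewrite Rminus_0_r; lra.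
  + intros v v' Hv Hv'. specialize (H3 s v s v').
    rewrite !Rminus_0_r in H3. specialize (H3 ltac:(lra) ltac:(lra) ltac:(lra) ltac:(lra)).
    rewrite Rminus_diag, Rabs_R0, Rmult_0_r, !Rplus_0_l in H3.
    replace (W s v - W s v') with ((W s v - W s v' - om s0 * (v - v')) + om s0 * (v - v')) by ring.
    eapply Rle_trans; [apply Rabs_triang|]. rewrite Rabs_mult.
    specialize (HMb s0 Hs0). pose proof (Rabs_pos (v - v')). nra.
- exists d, (M + 1). split; [lra|exact Hd].
Qed.

(** Half of [e] pays for the strict estimate at a nearby centre s0, half for |om s - om s0|; both
    hold for all s close to s0, so compactness applies. *)
Lemma slope_linearization e : 0 < e -> exists d : posreal, forall s, 0 <= s <= L ->
  forall v, Rabs v < d -> Rabs (W s v - om s * v) <= e * Rabs v.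
Proof.
intros He.
apply (segment_uniform (fun s d => forall v, Rabs v < d -> Rabs (W s v - om s * v) <= e * Rabs v)).
- intros s d d' Hd H v Hv. apply H. lra.
- intros s0 _. assert (He2 : 0 < e / 2) by lra.
  destruct (HW s0 _ He2) as [d1 H1].
  destruct (proj1 (filterlim_locally _ _) (om_continuous s0) (mkposreal _ He2)) as [d2 H2].
  exists (mkposreal _ (Rmin_stable_in_posreal d1 d2)); cbn. intros s Hs v Hv.
  pose proof (Rmin_l d1 d2); pose proof (Rmin_r d1 d2).
  assert (H2s : Rabs (om s - om s0) < e / 2).
  { apply (H2 s). change (Rabs (s - s0) < d2). lra. }
  specialize (H1 s v s 0). rewrite W0, !Rminus_0_r, Rminus_diag, Rabs_R0 in H1.
  pose proof (cond_pos d1).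
  specialize (H1 ltac:(lra) ltac:(lra) ltac:(lra) ltac:(lra)).
  rewrite Rmult_0_l, !Rplus_0_l in H1.
  replace (W s v - om s * v) with ((W s v - om s0 * v) - (om s - om s0) * v) by ring.
  eapply Rle_trans; [apply Rabs_triang|]. rewrite Rabs_Ropp, Rabs_mult.
  pose proof (Rabs_pos v). nra.
Qed.

(** Truncating v to [- d1, d1] and s to [0, L] makes the field globally Lipschitz. A solution with
    |v0| exp (C L) < d1 stays in the range where the truncation is the identity, so it solves the
    original equation. *)
Lemma poincare_map_exists : exists P, is_poincare P.
Proof.
destruct slope_uniform as (d & C & HC & HU).
(* Halving puts the closed interval [- d1, d1] inside the open conditions |v| < d and |v| < eps. *)
set (d1 := Rmin d eps / 2).
assert (Hm : 0 < Rmin d eps) by (apply Rmin_pos; [apply cond_pos|auto]).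
assert (Hd1 : 0 < d1) by (unfold d1; lra).
assert (Hd1d : d1 < d) by (pose proof (Rmin_l d eps); unfold d1; lra).
assert (Hd1e : d1 < eps) by (pose proof (Rmin_r d eps); unfold d1; lra).
set (F := fun t v => W (clamp 0 L t) (clamp (- d1) d1 v)).
assert (Hcl : forall v, Rabs (clamp (- d1) d1 v) < d).
{ intros v. destruct (clamp_bounds (- d1) d1 v); [lra|]. apply Rabs_def1; lra. }
assert (Hct : forall t, 0 <= clamp 0 L t <= L) by (intros; apply clamp_bounds; lra).
assert (Flip : forall t v v', Rabs (F t v - F t v') <= C * Rabs (v - v')).
{ intros t v v'. destruct (HU (clamp 0 L t) (Hct t)) as (_ & _ & HLip).
  eapply Rle_trans; [apply HLip; apply Hcl|].
  apply Rmult_le_compat_l; [lra|apply clamp_lipschitz]. }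
assert (Fcont : forall q, (forall t, continuous q t) -> forall t, continuous (fun t => F t (q t)) t).
{ intros q Hq t. destruct (HU (clamp 0 L t) (Hct t)) as (_ & HCo & _).
  apply (continuous_comp_2 (clamp 0 L) (fun t => clamp (- d1) d1 (q t)) W).
  - apply clamp_continuous.
  - apply (continuous_comp q (clamp (- d1) d1)); [apply Hq|apply clamp_continuous].
  - apply continuity_2d_pt_filterlim, HCo, Hcl. }
assert (HL0 : Rabs 0 < d) by (rewrite Rabs_R0; apply cond_pos).
(* The smallness condition sits inside the existential so that a value can be chosen for every v0;
   for large v0 it carries no information. *)
assert (Hex : forall v0, exists y, Rabs v0 * exp (C * L) < d1 ->
   exists v, line v /\ v 0 = v0 /\ y = v L).
{ intros v0. destruct (picard F C L v0 HL HC Flip Fcont) as (v & Hv0 & Hv).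
  exists (v L). intros Hsm. exists v. split; [|auto].
  assert (Hg : forall s, 0 <= s <= L -> Rabs (v s) < d1).
  { intros s Hs. eapply Rle_lt_trans.
    - apply (trapped_growth v (fun s => F s (v s)) C L d1); try lra; auto.
      + intros s' Hs' Hvs.
        replace (F s' (v s')) with (F s' (v s') - F s' 0).
        * rewrite <- (Rminus_0_r (v s')) at 2. apply Flip.
        * unfold F. rewrite (clamp_id (- d1) d1 0) by lra. rewrite W0. ring.
      + rewrite Hv0. exact Hsm.
    - rewrite Hv0. apply Rle_lt_trans with (2 := Hsm). apply Rmult_le_compat_l; [apply Rabs_pos|].
      destruct (Req_dec s L) as [->|Hn]; [lra|]. left. apply exp_increasing. nra. }
  intros s Hs. specialize (Hg s Hs). specialize (Hv s Hs).
  split; [lra|]. split; [eexists; exact Hv|].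
  destruct (HU s Hs) as (HD & _). apply HD; [lra|].
  rewrite (is_derive_unique _ _ _ Hv). unfold F.
  apply Rabs_def2 in Hg. rewrite !clamp_id; auto; lra. }
exists (fun v0 => proj1_sig (constructive_indefinite_description _ (Hex v0))).
pose proof (exp_pos (C * L)) as HE.
assert (Hp : 0 < d1 / exp (C * L)) by now apply Rdiv_lt_0_compat.
exists (mkposreal _ Hp). intros v0 Hv0.
change (Rabs (v0 - 0) < d1 / exp (C * L)) in Hv0. rewrite Rminus_0_r in Hv0.
destruct constructive_indefinite_description as [y Hy]; simpl. apply Hy.
apply Rmult_lt_reg_r with (/ exp (C * L)); [now apply Rinv_0_lt_compat|].
rewrite Rmult_assoc, Rinv_r, Rmult_1_r by lra. exact Hv0.
Qed.

(** A line starting at a small h is trapped where the slope is om v up to a relative error e / (2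
    K); [linearized_growth] then gives |P h - lam h| <= (e / 2) |h|. *)
Lemma poincare_map_is_derive P : is_poincare P -> is_derive P 0 (exp (RInt om 0 L)).
Proof.
intros [dP HP].
set (lam := exp (RInt om 0 L)).
destruct slope_uniform as (d & C & HC & HU).
pose proof (exp_pos (C * L)) as HE.
(* This covers any [line], not only those built by iteration: in the common neighbourhood [Dir]
   forces v' = W (s, v). *)
assert (Hline : forall v dl, line v -> 0 < dl <= d -> Rabs (v 0) * exp (C * L) < dl ->
  (forall s, 0 <= s <= L -> Rabs (v s) <= Rabs (v 0) * exp (C * s)) /\
  (forall s, 0 <= s <= L -> Rabs (v s) < dl) /\
  (forall s, 0 <= s <= L -> is_derive v s (W s (v s)))).
{ intros v dl Hv Hdl Hsm.
  assert (Hg : forall s, 0 <= s <= L -> Rabs (v s) <= Rabs (v 0) * exp (C * s)).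
  { apply (trapped_growth v (fun s => Derive v s) C L dl); try lra; auto.
    - intros s Hs. apply Derive_correct. now apply Hv.
    - intros s Hs Hvs. destruct (HU s Hs) as (HD & _ & HLip).
      destruct (Hv s Hs) as (_ & _ & HDv). apply HD in HDv; [|lra]. rewrite HDv.
      replace (W s (v s)) with (W s (v s) - W s 0) by (rewrite W0; ring).
      rewrite <- (Rminus_0_r (v s)) at 2. apply HLip; [lra|]. rewrite Rabs_R0. apply cond_pos. }
  assert (Hl : forall s, 0 <= s <= L -> Rabs (v s) < dl).
  { intros s Hs. eapply Rle_lt_trans; [now apply Hg|]. apply Rle_lt_trans with (2 := Hsm).
    apply Rmult_le_compat_l; [apply Rabs_pos|].
    destruct (Req_dec s L) as [->|Hn]; [lra|]. left. apply exp_increasing. nra. }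
  split; [exact Hg|]. split; [exact Hl|].
  intros s Hs. destruct (Hv s Hs) as (_ & Hex & HDv).
  destruct (HU s Hs) as (HD & _). apply HD in HDv; [|specialize (Hl s Hs); lra].
  rewrite <- HDv. now apply Derive_correct. }
destruct (linearized_growth om C L HL ltac:(lra) om_continuous) as (K & HK & Hlin).
(* The growth bound with v 0 = 0 forces the line to be the axis. *)
assert (HP0 : P 0 = 0).
{ destruct (HP 0) as (v & Hv & Hv0 & HPv).
  - change (Rabs (0 - 0) < dP). rewrite Rminus_0_r, Rabs_R0. apply cond_pos.
  - destruct (Hline v d Hv) as (Hg & _); [pose proof (cond_pos d); lra| |].
    + rewrite Hv0, Rabs_R0, Rmult_0_l. apply cond_pos.
    + specialize (Hg L ltac:(lra)). rewrite Hv0, Rabs_R0, Rmult_0_l in Hg.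
      rewrite HPv. apply Rabs_eq_0. pose proof (Rabs_pos (v L)). lra. }
apply is_derive_Reals. intros e He.
destruct (slope_linearization (e / (2 * K))) as [de Hde]; [apply Rdiv_lt_0_compat; lra|].
set (dl := Rmin d de).
assert (Hdl : 0 < dl) by (apply Rmin_pos; apply cond_pos).
assert (Hq : 0 < Rmin dP (dl / exp (C * L))).
{ apply Rmin_pos; [apply cond_pos|]. now apply Rdiv_lt_0_compat. }
exists (mkposreal _ Hq). intros h Hh0 Hh. simpl in Hh.
pose proof (Rmin_l dP (dl / exp (C * L))); pose proof (Rmin_r dP (dl / exp (C * L))).
pose proof (Rmin_l d de : dl <= d); pose proof (Rmin_r d de : dl <= de).
destruct (HP h) as (v & Hv & Hv0 & HPv).
{ change (Rabs (h - 0) < dP). rewrite Rminus_0_r. lra. }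
destruct (Hline v dl Hv) as (Hg & Hl & HD); [lra| |].
{ rewrite Hv0. apply Rmult_lt_reg_r with (/ exp (C * L)); [now apply Rinv_0_lt_compat|].
  rewrite Rmult_assoc, Rinv_r, Rmult_1_r by lra. fold (dl / exp (C * L)). lra. }
assert (Hb : Rabs (v L - v 0 * lam) <= K * (e / (2 * K)) * Rabs (v 0)).
{ apply (Hlin v (fun s => W s (v s))); auto.
  - left. apply Rdiv_lt_0_compat; lra.
  - intros s Hs. apply Hde; auto. specialize (Hl s Hs). lra. }
replace (K * (e / (2 * K))) with (e / 2) in Hb by (field; lra).
rewrite Rplus_0_l, HP0, Rminus_0_r, HPv. rewrite Hv0 in Hb.
assert (Hh1 : 0 < Rabs h) by now apply Rabs_pos_lt.
replace (v L / h - lam) with ((v L - h * lam) / h) by (field; auto).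
unfold Rdiv. rewrite Rabs_mult, Rabs_inv.
apply Rle_lt_trans with (e / 2 * Rabs h * / Rabs h).
- apply Rmult_le_compat_r; [left; now apply Rinv_0_lt_compat|exact Hb].
- rewrite Rmult_assoc, Rinv_r by lra. lra.
Qed.

End PoincareMap.

(** * Vector calculus and the slope of M-mean curvature lines *)

Lemma R3_ext (p q : R3) : x1 p = x1 q -> x2 p = x2 q -> x3 p = x3 q -> p = q.
Proof.
destruct p as [[a b] c]; destruct q as [[a' b'] c']; unfold x1, x2, x3; simpl.
now intros -> -> ->.
Qed.

Lemma dot_comm p q : dot p q = dot q p.
Proof. unfold dot. ring. Qed.

Lemma dot_scal3_l t p q : dot (scal3 t p) q = t * dot p q.
Proof. unfold dot, scal3, x1, x2, x3; simpl. ring. Qed.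

Lemma dot_scal3_r t p q : dot p (scal3 t q) = t * dot p q.
Proof. unfold dot, scal3, x1, x2, x3; simpl. ring. Qed.

Lemma dot_cross_l p q : dot (cross p q) p = 0.
Proof. unfold dot, cross, x1, x2, x3; simpl. ring. Qed.

Lemma dot_cross_r p q : dot (cross p q) q = 0.
Proof. unfold dot, cross, x1, x2, x3; simpl. ring. Qed.

Lemma dot_cross_cross p q : dot (cross p q) (cross p q) = dot p p * dot q q - dot p q ^ 2.
Proof. unfold dot, cross, x1, x2, x3; simpl. ring. Qed.

Lemma dot_nonneg p : 0 <= dot p p.
Proof. unfold dot. nra. Qed.

(* [dot a (cross n t) * dot b (cross n t)] is the Gram determinant of [(a, n, t)] and [(b, n, t)]. *)
Lemma dot_orthonormal n t a b : dot n n = 1 -> dot t t = 1 -> dot n t = 0 ->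
  dot a b = dot a t * dot b t + dot a (cross n t) * dot b (cross n t) + dot a n * dot b n.
Proof.
intros Hn Ht Hnt.
assert (G : dot a (cross n t) * dot b (cross n t) =
  dot a b * (dot n n * dot t t - dot n t ^ 2)
  - dot a n * (dot b n * dot t t - dot n t * dot b t)
  + dot a t * (dot b n * dot n t - dot n n * dot b t)).
{ unfold dot, cross, x1, x2, x3; simpl. ring. }
rewrite G, Hn, Ht, Hnt. ring.
Qed.

(** * Strict derivatives of vector fields and of the unit normal *)

Definition strict_diff3 (Y : R -> R -> R3) (x y : R) (A B : R3) : Prop :=
  strict_diff (fun u v => x1 (Y u v)) x y (x1 A) (x1 B) /\
  strict_diff (fun u v => x2 (Y u v)) x y (x2 A) (x2 B) /\
  strict_diff (fun u v => x3 (Y u v)) x y (x3 A) (x3 B).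

Lemma strict_diff_eq f x y a b a' b' :
  strict_diff f x y a b -> a = a' -> b = b' -> strict_diff f x y a' b'.
Proof. now intros H <- <-. Qed.

Lemma strict_diff_dot Y Z x y A B A' B' :
  strict_diff3 Y x y A B -> strict_diff3 Z x y A' B' ->
  strict_diff (fun u v => dot (Y u v) (Z u v)) x y
    (dot A (Z x y) + dot (Y x y) A') (dot B (Z x y) + dot (Y x y) B').
Proof.
intros (Y1 & Y2 & Y3) (Z1 & Z2 & Z3).
eapply strict_diff_eq.
- unfold dot. apply strict_diff_plus; [apply strict_diff_plus|]; apply strict_diff_mult; eassumption.
- unfold dot. ring.
- unfold dot. ring.
Qed.

Lemma strict_diff3_scal f Y x y a b A B :
  strict_diff f x y a b -> strict_diff3 Y x y A B ->
  strict_diff3 (fun u v => scal3 (f u v) (Y u v)) x y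
    (add3 (scal3 a (Y x y)) (scal3 (f x y) A)) (add3 (scal3 b (Y x y)) (scal3 (f x y) B)).
Proof.
intros Hf (Y1 & Y2 & Y3).
split; [|split]; (eapply strict_diff_eq; [apply strict_diff_mult; eassumption| |];
  unfold scal3, add3, x1, x2, x3; simpl; ring).
Qed.

Lemma strict_diff3_cross Y Z x y A B A' B' :
  strict_diff3 Y x y A B -> strict_diff3 Z x y A' B' ->
  strict_diff3 (fun u v => cross (Y u v) (Z u v)) x y
    (add3 (cross A (Z x y)) (cross (Y x y) A')) (add3 (cross B (Z x y)) (cross (Y x y) B')).
Proof.
intros (Y1 & Y2 & Y3) (Z1 & Z2 & Z3).
split; [|split];
(eapply strict_diff_eq; [apply strict_diff_minus; apply strict_diff_mult; eassumption| |];
  unfold cross, add3, x1, x2, x3; simpl; ring).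
Qed.

Lemma ex_diff3_n_strict_diff3 n Y x y : locally_2d (ex_diff3_n Y (S n)) x y ->
  strict_diff3 Y x y (d_u Y x y) (d_v Y x y).
Proof.
intros H.
split; [|split]; apply (ex_diff_n_strict_diff n);
revert H; apply locally_2d_impl, locally_2d_forall; intros u v (H1 & H2 & H3); assumption.
Qed.

Lemma ex_diff3_n_d_u n Y x y : locally_2d (ex_diff3_n Y (S n)) x y ->
  locally_2d (ex_diff3_n (d_u Y) n) x y.
Proof.
apply locally_2d_impl, locally_2d_forall. intros u v (H1 & H2 & H3).
split; [|split]; [apply H1|apply H2|apply H3].
Qed.

Lemma ex_diff3_n_d_v n Y x y : locally_2d (ex_diff3_n Y (S n)) x y ->
  locally_2d (ex_diff3_n (d_v Y) n) x y.
Proof.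
apply locally_2d_impl, locally_2d_forall. intros u v (H1 & H2 & H3).
split; [|split]; [apply H1|apply H2|apply H3].
Qed.

Lemma ex_diff3_n_Schwarz Y x y : locally_2d (ex_diff3_n Y 2) x y ->
  d_u (d_v Y) x y = d_v (d_u Y) x y.
Proof.
intros H.
apply R3_ext.
- apply (ex_diff_n_Schwarz (fun u v => x1 (Y u v))).
  revert H; apply locally_2d_impl, locally_2d_forall; intros u v (H1 & H2 & H3); assumption.
- apply (ex_diff_n_Schwarz (fun u v => x2 (Y u v))).
  revert H; apply locally_2d_impl, locally_2d_forall; intros u v (H1 & H2 & H3); assumption.
- apply (ex_diff_n_Schwarz (fun u v => x3 (Y u v))).
  revert H; apply locally_2d_impl, locally_2d_forall; intros u v (H1 & H2 & H3); assumption.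
Qed.

Lemma qa_cross X u v :
  qa X u v = dot (cross (d_u X u v) (d_v X u v)) (cross (d_u X u v) (d_v X u v)).
Proof. unfold qa, ffE, ffF, ffG. now rewrite dot_cross_cross. Qed.

Lemma unit_normal_unit X u v : 0 < qa X u v -> dot (unit_normal X u v) (unit_normal X u v) = 1.
Proof.
intros H. unfold unit_normal, norm3. rewrite <- qa_cross, dot_scal3_l, dot_scal3_r, <- qa_cross.
pose proof (sqrt_lt_R0 _ H). rewrite <- (sqrt_sqrt (qa X u v)) at 3 by lra. field. lra.
Qed.

Lemma unit_normal_d_u X u v : dot (unit_normal X u v) (d_u X u v) = 0.
Proof. unfold unit_normal. rewrite dot_scal3_l, dot_cross_l. ring. Qed.

Lemma unit_normal_d_v X u v : dot (unit_normal X u v) (d_v X u v) = 0.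
Proof. unfold unit_normal. rewrite dot_scal3_l, dot_cross_r. ring. Qed.

Definition strict_differentiable (f : R -> R -> R) (x y : R) : Prop :=
  exists a b, strict_diff f x y a b.

Lemma strict_differentiable_continuity f x y : strict_differentiable f x y -> continuity_2d_pt f x y.
Proof. intros (a & b & H). exact (strict_diff_continuity_pt _ _ _ _ _ H). Qed.

Lemma strict_differentiable_const c x y : strict_differentiable (fun _ _ => c) x y.
Proof. exists 0, 0. apply strict_diff_const. Qed.

Lemma strict_differentiable_plus f g x y : strict_differentiable f x y -> strict_differentiable g x y ->
  strict_differentiable (fun u v => f u v + g u v) x y.
Proof. intros (a & b & Hf) (a' & b' & Hg). do 2 eexists. eapply strict_diff_plus; eassumption. Qed.

Lemma strict_differentiable_minus f g x y : strict_differentiable f x y -> strict_differentiable g x y ->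
  strict_differentiable (fun u v => f u v - g u v) x y.
Proof. intros (a & b & Hf) (a' & b' & Hg). do 2 eexists. eapply strict_diff_minus; eassumption. Qed.

Lemma strict_differentiable_mult f g x y : strict_differentiable f x y -> strict_differentiable g x y ->
  strict_differentiable (fun u v => f u v * g u v) x y.
Proof. intros (a & b & Hf) (a' & b' & Hg). do 2 eexists. eapply strict_diff_mult; eassumption. Qed.

Lemma strict_differentiable_pow2 f x y : strict_differentiable f x y ->
  strict_differentiable (fun u v => f u v ^ 2) x y.
Proof.
intros H. destruct (strict_differentiable_mult _ _ _ _ H H) as (a & b & H'). exists a, b.
apply strict_diff_ext_loc with (2 := H'). apply locally_2d_forall; intros; ring.
Qed.

Lemma strict_differentiable_div f g x y : g x y <> 0 -> strict_differentiable f x y -> strict_differentiable g x y ->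
  strict_differentiable (fun u v => f u v / g u v) x y.
Proof. intros Hn (a & b & Hf) (a' & b' & Hg). do 2 eexists. eapply strict_diff_div; eassumption. Qed.

Lemma strict_differentiable_sqrt f x y : 0 < f x y -> strict_differentiable f x y ->
  strict_differentiable (fun u v => sqrt (f u v)) x y.
Proof. intros Hn (a & b & Hf). do 2 eexists. eapply strict_diff_sqrt; eassumption. Qed.

Lemma strict_differentiable_dot Y Z x y A B A' B' : strict_diff3 Y x y A B -> strict_diff3 Z x y A' B' ->
  strict_differentiable (fun u v => dot (Y u v) (Z u v)) x y.
Proof. intros HY HZ. do 2 eexists. eapply strict_diff_dot; eassumption. Qed.

Lemma unit_normal_strict_diff3 X x y : locally_2d (ex_diff3_n X 2) x y -> 0 < qa X x y ->
  exists Nu Nv, strict_diff3 (unit_normal X) x y Nu Nv.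
Proof.
intros H Hq.
pose proof (strict_diff3_cross _ _ _ _ _ _ _ _
  (ex_diff3_n_strict_diff3 0 _ _ _ (ex_diff3_n_d_u _ _ _ _ H))
  (ex_diff3_n_strict_diff3 0 _ _ _ (ex_diff3_n_d_v _ _ _ _ H))) as Hc.
pose proof (strict_diff_dot _ _ _ _ _ _ _ _ Hc Hc) as Hd.
assert (Hq' : 0 < dot (cross (d_u X x y) (d_v X x y)) (cross (d_u X x y) (d_v X x y)))
  by now rewrite <- qa_cross.
assert (Hn : sqrt (dot (cross (d_u X x y) (d_v X x y)) (cross (d_u X x y) (d_v X x y))) <> 0)
  by (apply Rgt_not_eq, sqrt_lt_R0, Hq').
do 2 eexists.
exact (strict_diff3_scal _ _ _ _ _ _ _ _
  (strict_diff_inv _ _ _ _ _ Hn (strict_diff_sqrt _ _ _ _ _ Hq' Hd)) Hc).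
Qed.

(** * Curvatures without square roots, and the slope equation *)

Lemma mean_curv_eq X u v : mean_curv X u v = qb X u v / (2 * qa X u v).
Proof. unfold mean_curv, k1, k2, Rdiv. lra. Qed.

Definition curvature_disc (X : R -> R -> R3) (u v : R) : R := qb X u v ^ 2 - 4 * qa X u v * qc X u v.

(** The product of the two roots squares the radical away and leaves a rational expression in the
    coefficients of the forms. The sign of the discriminant matters because [sqrt] is 0 on negative
    numbers. *)
Lemma gauss_curv_eq X u v : qa X u v <> 0 -> 0 <= curvature_disc X u v ->
  gauss_curv X u v = qc X u v / qa X u v.
Proof.
intros Hq HD. unfold gauss_curv, k1, k2. fold (curvature_disc X u v).
replace ((qb X u v - sqrt (curvature_disc X u v)) / (2 * qa X u v) * ((qb X u v + sqrt (curvature_disc X u v)) / (2 * qa X u v)))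
  with ((qb X u v ^ 2 - sqrt (curvature_disc X u v) * sqrt (curvature_disc X u v)) / (4 * qa X u v ^ 2)) by (field; auto).
rewrite sqrt_sqrt by exact HD. unfold curvature_disc. field; auto.
Qed.

Lemma mean_gauss_disc X u v : qa X u v <> 0 -> 0 <= curvature_disc X u v ->
  mean_curv X u v ^ 2 - gauss_curv X u v = curvature_disc X u v / (2 * qa X u v) ^ 2.
Proof.
intros Hq HD. rewrite mean_curv_eq, gauss_curv_eq by auto. unfold curvature_disc. field; auto.
Qed.

(** The square of the geodesic torsion, (M - k1) (k2 - M), rewritten through the mean and Gauss
    curvatures, whose regularity is established without [k1] and [k2]. *)
Definition torsion_square (m : R -> R -> R) (X : R -> R -> R3) (u v : R) : R :=
  2 * mean_curv X u v * Mcurv m X u v - Mcurv m X u v ^ 2 - gauss_curv X u v.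

Lemma torsion_square_eq m X u v :
  (Mcurv m X u v - k1 X u v) * (k2 X u v - Mcurv m X u v) = torsion_square m X u v.
Proof. unfold torsion_square, mean_curv, gauss_curv. field. Qed.

Lemma foliation_sign_square fol : foliation_sign fol ^ 2 = 1.
Proof. destruct fol; simpl; ring. Qed.

Lemma tau_g_eq m X fol u v :
  tau_g m X fol u v = foliation_sign fol * sqrt (torsion_square m X u v).
Proof. unfold tau_g. now rewrite torsion_square_eq. Qed.

(** A positive product allows k1 < M < k2 or k2 < M < k1; the sign of [qa] gives k1 <= k2 and
    excludes the latter. *)
Lemma between_principal m X u v : 0 < qa X u v -> 0 < torsion_square m X u v ->
  k1 X u v < Mcurv m X u v < k2 X u v.
Proof.
intros Hq Ht. rewrite <- torsion_square_eq in Ht.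
assert (k1 X u v <= k2 X u v).
{ unfold k1, k2, Rdiv. apply Rmult_le_compat_r.
  - left. apply Rinv_0_lt_compat. lra.
  - pose proof (sqrt_pos (qb X u v ^ 2 - 4 * qa X u v * qc X u v)). lra. }
nra.
Qed.

(* Solving [II (T, .) = M I (T, .) + tau I (N /\ T, .)] for the slope of [T]. *)
Definition line_slope (m : R -> R -> R) (X : R -> R -> R3) (fol : foliation) (u v : R) : R :=
  (Mcurv m X u v * ffE X u v - sfe X u v) /
  (sff X u v - Mcurv m X u v * ffF X u v + tau_g m X fol u v * sqrt (qa X u v)).

(** With T = (1, d), the vector equation tested on (1, 0) is linear in d and its solution is the
    quotient. Tested on (0, 1) it then follows, because the hypothesis on tau^2 w^2 says that it
    equals - det (II - M I). *)
Lemma slope_algebra E F G e f g M tau w d :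
  0 < w -> w ^ 2 = E * G - F ^ 2 -> 0 < E ->
  tau ^ 2 * w ^ 2 = M * (e * G - 2 * f * F + g * E) - M ^ 2 * (E * G - F ^ 2) - (e * g - f ^ 2) ->
  f - M * F + tau * w <> 0 ->
  ((e * 1 * 1 + f * (1 * d + d * 1) + g * d * d) / (E * 1 * 1 + F * (1 * d + d * 1) + G * d * d) = M /\
   (e * 1 * (- (F * 1 + G * d) / w) + f * (1 * ((E * 1 + F * d) / w) + d * (- (F * 1 + G * d) / w))
     + g * d * ((E * 1 + F * d) / w)) / (E * 1 * 1 + F * (1 * d + d * 1) + G * d * d) = tau)
  <-> d = (M * E - e) / (f - M * F + tau * w).
Proof.
intros Hw Hw2 HE Ht Hn.
set (I := E * 1 * 1 + F * (1 * d + d * 1) + G * d * d).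
assert (HI : 0 < I).
{ assert (E * I = (E + F * d) ^ 2 + w ^ 2 * d ^ 2) by (rewrite Hw2; unfold I; ring).
  destruct (Req_dec d 0) as [->|Hd].
  - unfold I. lra.
  - assert (0 < w ^ 2 * d ^ 2) by (apply Rmult_lt_0_compat; apply pow2_gt_0; lra).
    pose proof (pow2_ge_0 (E + F * d)). nra. }
set (II := e * 1 * 1 + f * (1 * d + d * 1) + g * d * d).
set (IJ := e * 1 * (- (F * 1 + G * d) / w) + f * (1 * ((E * 1 + F * d) / w) + d * (- (F * 1 + G * d) / w))
     + g * d * ((E * 1 + F * d) / w)).
(* The vector (1, 0) multiplied by I (T, T) is (E + F d) T - d w (N /\ T); [Key] is II (T, .)
   evaluated on it. *)
assert (Key : (e + f * d) * I = (E + F * d) * II - d * w * IJ).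
{ unfold IJ, II, I. field. lra. }
assert (HII : II / I = M <-> II = M * I).
{ split; intros H.
  - rewrite <- H. field. lra.
  - rewrite H. field. lra. }
assert (HIJ : IJ / I = tau <-> IJ = tau * I).
{ split; intros H.
  - rewrite <- H. field. lra.
  - rewrite H. field. lra. }
rewrite HII, HIJ. split.
- intros [H1 H2]. rewrite H1, H2 in Key.
  assert (Ha : e + f * d = M * (E + F * d) - d * w * tau).
  { apply Rmult_eq_reg_r with I; [|lra]. rewrite Key. ring. }
  apply Rmult_eq_reg_r with (f - M * F + tau * w); auto.
  unfold Rdiv. rewrite Rmult_assoc, Rinv_l by auto. lra.
- intros Hd.
  assert (Ha : d * (f - M * F + tau * w) = M * E - e).
  { rewrite Hd. field. auto. }
  (* Multiplied by the nonzero denominator, the second component becomes the determinant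
     identity. *)
  assert (Hb : d * (g - M * G) = - (f - M * F - tau * w)).
  { apply Rmult_eq_reg_r with (f - M * F + tau * w); auto.
    replace (d * (g - M * G) * (f - M * F + tau * w)) with ((g - M * G) * (M * E - e)) by (rewrite <- Ha; ring).
    transitivity (- ((f - M * F) ^ 2 - tau ^ 2 * w ^ 2)); [|ring].
    rewrite Ht. ring. }
  assert (Ha' : e + f * d = M * (E + F * d) - d * w * tau) by lra.
  assert (Hb' : f + g * d = M * (F + G * d) + w * tau) by lra.
  split.
  + unfold II, I. transitivity ((e + f * d) + d * (f + g * d)); [ring|].
    rewrite Ha', Hb'. ring.
  + unfold IJ, I. transitivity ((- (F + G * d) * (e + f * d) + (E + F * d) * (f + g * d)) / w); [field; lra|].
    rewrite Ha', Hb'. field. lra.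
Qed.

Lemma mean_curvature_direction_slope m X fol u v d :
  0 < qa X u v -> 0 <= curvature_disc X u v -> 0 < gauss_curv X u v -> 0 < torsion_square m X u v ->
  sff X u v - Mcurv m X u v * ffF X u v + tau_g m X fol u v * sqrt (qa X u v) <> 0 ->
  mean_curvature_direction m X fol u v 1 d <-> d = line_slope m X fol u v.
Proof.
intros Hq HD HK Ht Hn.
pose proof (slope_algebra (ffE X u v) (ffF X u v) (ffG X u v) (sfe X u v) (sff X u v) (sfg X u v)
  (Mcurv m X u v) (tau_g m X fol u v) (sqrt (qa X u v)) d) as HA.
unfold line_slope. rewrite <- HA; auto.
- unfold mean_curvature_direction, normal_curvature, geodesic_torsion, Defs.form1, Defs.form2.
  fold (qa X u v). split; [tauto|]. intros H.
  split; [exact HK|]. split; [now apply between_principal|]. split; [|exact H].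
  intros E; injection E; intros; lra.
- now apply sqrt_lt_R0.
- rewrite <- Rsqr_pow2, Rsqr_sqrt; [reflexivity|lra].
- destruct (dot_nonneg (d_u X u v)) as [HE|HE]; [exact HE|].
  unfold qa, ffE in Hq. rewrite <- HE in Hq. pose proof (pow2_ge_0 (ffF X u v)). lra.
- rewrite tau_g_eq, Rpow_mult_distr, foliation_sign_square.
  rewrite <- (Rsqr_pow2 (sqrt (torsion_square m X u v))), <- (Rsqr_pow2 (sqrt (qa X u v))), !Rsqr_sqrt by lra.
  unfold torsion_square. rewrite mean_curv_eq, gauss_curv_eq by (auto; lra).
  change (ffE X u v * ffG X u v - ffF X u v ^ 2) with (qa X u v).
  change (sfe X u v * sfg X u v - sff X u v ^ 2) with (qc X u v).
  change (sfe X u v * ffG X u v - 2 * sff X u v * ffF X u v + sfg X u v * ffE X u v) with (qb X u v).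
  field. lra.
Qed.

(** * Regularity near a point of an M-mean curvature line *)

(** With the default values of division and [sqrt], a degenerate first form would give k1 = k2 = 0,
    against positive Gauss curvature, and a nonpositive discriminant would give k1 = k2, against k1
    < M < k2. *)
Lemma mean_curvature_direction_regular m X fol u v du dv :
  mean_curvature_direction m X fol u v du dv ->
  0 < qa X u v /\ 0 < curvature_disc X u v /\ 0 < gauss_curv X u v /\ 0 < torsion_square m X u v.
Proof.
intros (HK & Hk & _).
assert (Hq : 0 < qa X u v).
{ assert (H : 0 <= qa X u v) by (rewrite qa_cross; apply dot_nonneg).
  destruct H as [H|H]; [exact H|].
  assert (Hz : / (2 * qa X u v) = 0) by (rewrite <- H, Rmult_0_r; exact Rinv_0).
  unfold gauss_curv, k1, k2, Rdiv in HK. rewrite Hz, !Rmult_0_r in HK. lra. }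
assert (HD : 0 < curvature_disc X u v).
{ apply Rnot_le_lt. intros HD.
  assert (E : k1 X u v = k2 X u v).
  { unfold k1, k2. fold (curvature_disc X u v). rewrite (sqrt_neg_0 _ HD). f_equal. ring. }
  lra. }
split; [exact Hq|]. split; [exact HD|]. split; [exact HK|].
rewrite <- torsion_square_eq. apply Rmult_lt_0_compat; lra.
Qed.

Section RegularPoint.
Context (m : R -> R -> R) (X : R -> R -> R3) (fol : foliation) (x y : R)
  (hm : mean_curvature_function m)
  (HX : locally_2d (ex_diff3_n X 3) x y)
  (Hqa : 0 < qa X x y) (Hdisc : 0 < curvature_disc X x y) (HK : 0 < gauss_curv X x y)
  (Htau : 0 < torsion_square m X x y).

Let Xu := ex_diff3_n_d_u _ _ _ _ HX.
Let Xv := ex_diff3_n_d_v _ _ _ _ HX.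
Let SXu := ex_diff3_n_strict_diff3 _ _ _ _ Xu.
Let SXv := ex_diff3_n_strict_diff3 _ _ _ _ Xv.

Lemma strict_differentiable_ffE : strict_differentiable (ffE X) x y.
Proof. exact (strict_differentiable_dot _ _ _ _ _ _ _ _ SXu SXu). Qed.

Lemma strict_differentiable_ffF : strict_differentiable (ffF X) x y.
Proof. exact (strict_differentiable_dot _ _ _ _ _ _ _ _ SXu SXv). Qed.

Lemma strict_differentiable_ffG : strict_differentiable (ffG X) x y.
Proof. exact (strict_differentiable_dot _ _ _ _ _ _ _ _ SXv SXv). Qed.

Lemma ex_diff3_n_3_2 : locally_2d (ex_diff3_n X 2) x y.
Proof.
generalize HX. apply locally_2d_impl, locally_2d_forall. intros u v (H1 & H2 & H3).
split; [|split]; (eapply ex_diff_n_m; [|eassumption]; lia).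
Qed.

(** [Y] stands for a second derivative of [X], which is C^1 since [X] has three derivatives. *)
Lemma strict_differentiable_second_form (Y : R -> R -> R3) : locally_2d (ex_diff3_n Y 1) x y ->
  strict_differentiable (fun u v => dot (Y u v) (unit_normal X u v)) x y.
Proof.
intros HY. destruct (unit_normal_strict_diff3 X x y ex_diff3_n_3_2 Hqa) as (Nu & Nv & HN).
exact (strict_differentiable_dot _ _ _ _ _ _ _ _ (ex_diff3_n_strict_diff3 _ _ _ _ HY) HN).
Qed.

Lemma strict_differentiable_sfe : strict_differentiable (sfe X) x y.
Proof. exact (strict_differentiable_second_form _ (ex_diff3_n_d_u _ _ _ _ Xu)). Qed.

Lemma strict_differentiable_sff : strict_differentiable (sff X) x y.
Proof. exact (strict_differentiable_second_form _ (ex_diff3_n_d_v _ _ _ _ Xu)). Qed.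

Lemma strict_differentiable_sfg : strict_differentiable (sfg X) x y.
Proof. exact (strict_differentiable_second_form _ (ex_diff3_n_d_v _ _ _ _ Xv)). Qed.

Lemma strict_differentiable_qa : strict_differentiable (qa X) x y.
Proof. exact (strict_differentiable_minus _ _ _ _ (strict_differentiable_mult _ _ _ _ strict_differentiable_ffE strict_differentiable_ffG) (strict_differentiable_pow2 _ _ _ strict_differentiable_ffF)). Qed.

Lemma strict_differentiable_qb : strict_differentiable (qb X) x y.
Proof.
exact (strict_differentiable_plus _ _ _ _ (strict_differentiable_minus _ _ _ _ (strict_differentiable_mult _ _ _ _ strict_differentiable_sfe strict_differentiable_ffG)
  (strict_differentiable_mult _ _ _ _ (strict_differentiable_mult _ _ _ _ (strict_differentiable_const 2 x y) strict_differentiable_sff) strict_differentiable_ffF))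
  (strict_differentiable_mult _ _ _ _ strict_differentiable_sfg strict_differentiable_ffE)).
Qed.

Lemma strict_differentiable_qc : strict_differentiable (qc X) x y.
Proof. exact (strict_differentiable_minus _ _ _ _ (strict_differentiable_mult _ _ _ _ strict_differentiable_sfe strict_differentiable_sfg) (strict_differentiable_pow2 _ _ _ strict_differentiable_sff)). Qed.

Lemma strict_differentiable_disc : strict_differentiable (curvature_disc X) x y.
Proof.
exact (strict_differentiable_minus _ _ _ _ (strict_differentiable_pow2 _ _ _ strict_differentiable_qb)
  (strict_differentiable_mult _ _ _ _ (strict_differentiable_mult _ _ _ _ (strict_differentiable_const 4 x y) strict_differentiable_qa) strict_differentiable_qc)).
Qed.

Lemma locally_qa_disc : locally_2d (fun u v => 0 < qa X u v /\ 0 < curvature_disc X u v) x y.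
Proof.
apply locally_2d_and; apply locally_2d_pos; auto; apply strict_differentiable_continuity;
  [exact strict_differentiable_qa|exact strict_differentiable_disc].
Qed.

Lemma strict_differentiable_ext_loc f g : locally_2d (fun u v => f u v = g u v) x y ->
  strict_differentiable f x y -> strict_differentiable g x y.
Proof. intros H (a & b & Hf). exists a, b. now apply strict_diff_ext_loc with f. Qed.

Lemma strict_differentiable_mean_curv : strict_differentiable (mean_curv X) x y.
Proof.
apply strict_differentiable_ext_loc with (fun u v => qb X u v / (2 * qa X u v)).
- apply locally_2d_forall. intros. symmetry. apply mean_curv_eq.
- apply strict_differentiable_div; [lra|exact strict_differentiable_qb|]. exact (strict_differentiable_mult _ _ _ _ (strict_differentiable_const 2 x y) strict_differentiable_qa).
Qed.

Lemma strict_differentiable_gauss_curv : strict_differentiable (gauss_curv X) x y.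
Proof.
apply strict_differentiable_ext_loc with (fun u v => qc X u v / qa X u v).
- generalize locally_qa_disc. apply locally_2d_impl, locally_2d_forall. intros u v [].
  symmetry. apply gauss_curv_eq; lra.
- apply strict_differentiable_div; [lra|exact strict_differentiable_qc|exact strict_differentiable_qa].
Qed.

(** H^2 - K is a positive multiple of the discriminant, so the pair of curvatures lies where [m] is
    strictly differentiable. *)
Lemma strict_differentiable_Mcurv : strict_differentiable (Mcurv m X) x y.
Proof.
destruct (mean_curvature_function_strict_diff m (mean_curv X x y) (gauss_curv X x y) hm) as (a & b & Hm).
{ split; [exact HK|].
  assert (H : 0 < mean_curv X x y ^ 2 - gauss_curv X x y); [|lra].
  rewrite mean_gauss_disc by lra. apply Rdiv_lt_0_compat; [exact Hdisc|]. apply pow2_gt_0. lra. }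
destruct strict_differentiable_mean_curv as (a1 & b1 & H1). destruct strict_differentiable_gauss_curv as (a2 & b2 & H2).
do 2 eexists. exact (strict_diff_comp m _ _ x y _ _ _ _ _ _ Hm H1 H2).
Qed.

Lemma strict_differentiable_torsion_square : strict_differentiable (torsion_square m X) x y.
Proof.
exact (strict_differentiable_minus _ _ _ _ (strict_differentiable_minus _ _ _ _
  (strict_differentiable_mult _ _ _ _ (strict_differentiable_mult _ _ _ _ (strict_differentiable_const 2 x y) strict_differentiable_mean_curv) strict_differentiable_Mcurv)
  (strict_differentiable_pow2 _ _ _ strict_differentiable_Mcurv)) strict_differentiable_gauss_curv).
Qed.

Lemma strict_differentiable_tau_g : strict_differentiable (tau_g m X fol) x y.
Proof.
apply strict_differentiable_ext_loc with (fun u v => foliation_sign fol * sqrt (torsion_square m X u v)).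
- apply locally_2d_forall. intros. symmetry. apply tau_g_eq.
- exact (strict_differentiable_mult _ _ _ _ (strict_differentiable_const _ x y) (strict_differentiable_sqrt _ _ _ Htau strict_differentiable_torsion_square)).
Qed.

Definition slope_denominator (u v : R) : R :=
  sff X u v - Mcurv m X u v * ffF X u v + tau_g m X fol u v * sqrt (qa X u v).

Lemma strict_differentiable_slope_denominator : strict_differentiable slope_denominator x y.
Proof.
exact (strict_differentiable_plus _ _ _ _ (strict_differentiable_minus _ _ _ _ strict_differentiable_sff (strict_differentiable_mult _ _ _ _ strict_differentiable_Mcurv strict_differentiable_ffF))
  (strict_differentiable_mult _ _ _ _ strict_differentiable_tau_g (strict_differentiable_sqrt _ _ _ Hqa strict_differentiable_qa))).
Qed.

(** The conditions under which the slope equation can be solved are open conditions on continuous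
    functions, so they persist near the point. *)
Lemma locally_direction_slope : slope_denominator x y <> 0 ->
  locally_2d (fun u v => forall d,
    mean_curvature_direction m X fol u v 1 d <-> d = line_slope m X fol u v) x y.
Proof.
intros Hn.
assert (L1 := continuity_2d_pt_neq_0 _ _ _ (strict_differentiable_continuity _ _ _ strict_differentiable_slope_denominator) Hn).
assert (L2 := locally_2d_pos _ _ _ (strict_differentiable_continuity _ _ _ strict_differentiable_gauss_curv) HK).
assert (L3 := locally_2d_pos _ _ _ (strict_differentiable_continuity _ _ _ strict_differentiable_torsion_square) Htau).
generalize (locally_2d_and _ _ _ _ locally_qa_disc
  (locally_2d_and _ _ _ _ L1 (locally_2d_and _ _ _ _ L2 L3))).
apply locally_2d_impl, locally_2d_forall. intros u v ((H1 & H2) & H3 & H4 & H5) d.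
apply mean_curvature_direction_slope; auto. lra.
Qed.

End RegularPoint.

(** The expansion cannot be differentiated term by term, [b] being merely continuous at 0. Instead
    its quadratic part is compared with the Taylor estimate that differentiability of phi' at 0
    provides; the two quadratic coefficients must agree. *)
Lemma expansion_derivatives (phi b : R -> R) p q k A n eps : 0 < eps ->
  continuous b 0 -> b 0 = 0 ->
  (forall v, Rabs v < eps -> phi v = p + v * q + (k * (v ^ 2 / 2) + A / 6 * v ^ 3 + v ^ 3 * b v) * n) ->
  locally 0 (fun v => ex_derive phi v) -> ex_derive (Derive phi) 0 ->
  Derive phi 0 = q /\ Derive (Derive phi) 0 = k * n.
Proof.
intros Heps Cb Hb0 Hphi Hex Hex2.
assert (HB : exists (d : posreal) B, 0 < B /\ d <= eps /\ forall v, Rabs v < d ->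
  Rabs (phi v - (p + v * q + k * n * v ^ 2 / 2)) <= B * Rabs v ^ 3).
{ destruct (proj1 (filterlim_locally _ _) Cb (mkposreal 1 Rlt_0_1)) as [d Hd].
  assert (Hp : 0 < Rmin d eps) by (apply Rmin_pos; auto; apply cond_pos).
  (* Since [b] vanishes at 0, |b| < 1 nearby, which bounds the cubic terms; the last 1 makes the
     constant positive even if n = 0. *)
  exists (mkposreal _ Hp), ((Rabs (A / 6) + 1) * Rabs n + 1). cbn [pos].
  pose proof (Rmin_l d eps); pose proof (Rmin_r d eps).
  pose proof (Rabs_pos (A / 6)); pose proof (Rabs_pos n).
  split; [nra|]. split; [lra|]. intros v Hv.
  assert (Hbv : Rabs (b v) < 1).
  { specialize (Hd v). rewrite Hb0 in Hd. rewrite <- (Rminus_0_r (b v)). apply Hd.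
    change (Rabs (v - 0) < d). rewrite Rminus_0_r. lra. }
  rewrite Hphi by lra.
  replace (_ - _) with (v ^ 3 * ((A / 6 + b v) * n)) by field.
  rewrite !Rabs_mult, RPow_abs, (Rmult_comm (Rabs (v ^ 3))).
  apply Rmult_le_compat_r; [apply Rabs_pos|].
  apply Rle_trans with ((Rabs (A / 6) + 1) * Rabs n); [|lra].
  apply Rmult_le_compat_r; [lra|]. eapply Rle_trans; [apply Rabs_triang|]. lra. }
destruct HB as (d0 & B & HBp & Hd0 & HB).
assert (Hphi0 : phi 0 = p).
{ specialize (Hphi 0). rewrite Rabs_R0 in Hphi. rewrite (Hphi Heps). field. }
set (kn := k * n) in *.
assert (D1 : is_derive phi 0 q).
{ apply is_derive_Reals. intros e He.
  set (C := Rabs kn + B + 1).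
  assert (HC : 0 < C) by (unfold C; pose proof (Rabs_pos kn); lra).
  assert (Hp : 0 < Rmin d0 (Rmin 1 (e / C))).
  { repeat apply Rmin_pos; try lra; [apply cond_pos|now apply Rdiv_lt_0_compat]. }
  exists (mkposreal _ Hp). intros h Hh0 Hh. simpl in Hh.
  pose proof (Rmin_l d0 (Rmin 1 (e / C))); pose proof (Rmin_r d0 (Rmin 1 (e / C))).
  pose proof (Rmin_l 1 (e / C)); pose proof (Rmin_r 1 (e / C)).
  assert (Hha : 0 < Rabs h) by now apply Rabs_pos_lt.
  specialize (HB h ltac:(lra)). rewrite Rplus_0_l, Hphi0.
  replace ((phi h - p) / h - q) with
    (((phi h - (p + h * q + kn * h ^ 2 / 2)) + kn / 2 * h ^ 2) / h) by (field; auto).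
  unfold Rdiv at 1. rewrite Rabs_mult, Rabs_inv.
  apply Rmult_lt_reg_r with (Rabs h); auto. rewrite Rmult_assoc, Rinv_l, Rmult_1_r by lra.
  apply Rle_lt_trans with (C * Rabs h * Rabs h).
  - eapply Rle_trans; [apply Rabs_triang|]. rewrite Rabs_mult, <- RPow_abs.
    assert (Hk2 : Rabs (kn / 2) <= Rabs kn).
    { unfold Rdiv. rewrite Rabs_mult, (Rabs_pos_eq (/ 2)) by lra. pose proof (Rabs_pos kn). lra. }
    assert (B * Rabs h ^ 3 <= B * Rabs h * Rabs h).
    { simpl. rewrite Rmult_1_r, Rmult_assoc. apply Rmult_le_compat_l; [lra|]. nra. }
    assert (0 < Rabs h * Rabs h) by now apply Rmult_lt_0_compat.
    apply Rle_trans with (B * Rabs h ^ 3 + Rabs kn * Rabs h ^ 2).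
    { apply Rplus_le_compat; [exact HB|]. apply Rmult_le_compat_r; [apply pow2_ge_0|exact Hk2]. }
    replace (C * Rabs h * Rabs h) with (B * Rabs h * Rabs h + Rabs kn * Rabs h ^ 2 + Rabs h * Rabs h)
      by (unfold C; ring).
    lra.
  - apply Rmult_lt_compat_r; auto. apply Rlt_le_trans with (C * (e / C)).
    + apply Rmult_lt_compat_l; lra.
    + right; field; lra. }
assert (E1 : Derive phi 0 = q) by (now apply is_derive_unique).
split; [exact E1|].
set (c := Derive (Derive phi) 0).
destruct Hex as [d1 Hex].
apply cond_eq. intros e He.
assert (He4 : 0 < e / 4) by lra.
destruct (proj1 (is_derive_Reals _ _ _) (Derive_correct _ _ Hex2) _ He4) as [d2 Hd2].
fold c in Hd2.
(* A single small v suffices: v < d2 makes the difference quotient of phi' accurate to e / 4, and v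
   < e / (8 B) makes the cubic error 2 B v less than e / 4. *)
set (v := Rmin (Rmin d0 d1) (Rmin d2 (e / (8 * B))) / 2).
assert (Hv : 0 < v).
{ apply Rmult_lt_0_compat; [|lra]. repeat apply Rmin_pos; try apply cond_pos. apply Rdiv_lt_0_compat; lra. }
pose proof (Rmin_l (Rmin d0 d1) (Rmin d2 (e / (8 * B)))); pose proof (Rmin_r (Rmin d0 d1) (Rmin d2 (e / (8 * B)))).
pose proof (Rmin_l d0 d1); pose proof (Rmin_r d0 d1).
pose proof (Rmin_l d2 (e / (8 * B))); pose proof (Rmin_r d2 (e / (8 * B))).
assert (V0 : v < d0) by (unfold v in *; lra). assert (V1 : v < d1) by (unfold v in *; lra).
assert (V2 : v < d2) by (unfold v in *; lra). assert (V3 : v < e / (8 * B)) by (unfold v in *; lra).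
(* Subtracting c t^2 / 2 leaves a derivative equal to q up to o(t), so the mean value theorem yields
   the Taylor estimate. *)
destruct (MVT_cor2 (fun t => phi t - c * t ^ 2 / 2) (fun t => Derive phi t - c * t) 0 v Hv) as (t & Ht & Htv).
{ intros t Ht. apply is_derive_Reals.
  assert (Dt : is_derive phi t (Derive phi t)).
  { apply Derive_correct, Hex. change (Rabs (t - 0) < d1). rewrite Rminus_0_r, Rabs_pos_eq; lra. }
  apply (is_derive_minus phi (fun t => c * t ^ 2 / 2)); [exact Dt|].
  auto_derive; auto. field. }
specialize (Hd2 t ltac:(lra) ltac:(rewrite Rabs_pos_eq; lra)).
rewrite Rplus_0_l, E1 in Hd2.
assert (Hlin : Rabs (Derive phi t - q - c * t) <= e / 4 * v).
{ replace (Derive phi t - q - c * t) with (((Derive phi t - q) / t - c) * t) by (field; lra).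
  rewrite Rabs_mult, (Rabs_pos_eq t) by lra. apply Rmult_le_compat; try lra. apply Rabs_pos. }
specialize (HB v ltac:(rewrite Rabs_pos_eq; lra)). rewrite (Rabs_pos_eq v) in HB by lra.
assert (Q : (kn - c) * v ^ 2 / 2 =
   (Derive phi t - q - c * t) * v - (phi v - (p + v * q + kn * v ^ 2 / 2))).
{ rewrite Hphi0 in Ht. simpl in Ht. nra. }
assert (Qb : Rabs ((kn - c) * v ^ 2 / 2) <= e / 4 * v * v + B * v ^ 3).
{ rewrite Q. eapply Rle_trans; [apply Rabs_triang|]. rewrite Rabs_Ropp, Rabs_mult, (Rabs_pos_eq v) by lra.
  apply Rplus_le_compat; auto. apply Rmult_le_compat_r; lra. }
assert (Hv2 : 0 < v ^ 2) by now apply pow_lt.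
assert (Qc : Rabs (c - kn) * (v ^ 2 / 2) <= (e / 2 + 2 * (B * v)) * (v ^ 2 / 2)).
{ rewrite Rabs_minus_sym, <- (Rabs_pos_eq (v ^ 2 / 2)) at 1 by lra. rewrite <- Rabs_mult.
  replace ((kn - c) * (v ^ 2 / 2)) with ((kn - c) * v ^ 2 / 2) by field.
  eapply Rle_trans; [exact Qb|]. right. field. }
apply Rmult_le_reg_r in Qc; [|lra].
assert (B * v < e / 8).
{ apply Rlt_le_trans with (B * (e / (8 * B))); [apply Rmult_lt_compat_l; lra|]. right; field; lra. }
lra.
Qed.

(** * Linearization along the axis of an adapted chart *)

Lemma strict_diff_const_1 f x y a b c :
  strict_diff f x y a b -> (forall t, f t y = c) -> a = 0.
Proof.
intros H Hc. pose proof (strict_diff_is_derive_1 _ _ _ _ _ H) as D.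
rewrite <- (is_derive_unique _ _ _ D), (Derive_ext _ (fun _ => c)) by exact Hc.
apply Derive_const.
Qed.

Lemma strict_diff_const_loc f x y a b c :
  strict_diff f x y a b -> locally_2d (fun u v => f u v = c) x y -> a = 0 /\ b = 0.
Proof.
intros H Hc. apply (strict_diff_unique (fun _ _ => c) x y); [|apply strict_diff_const].
exact (strict_diff_ext_loc _ _ _ _ _ _ Hc H).
Qed.

Section AdaptedStrip.
Context (m : R -> R -> R) (X : R -> R -> R3) (fol : foliation)
  (hm : mean_curvature_function m)
  (HX : forall s, locally_2d (ex_diff3_n X 3) s 0)
  (Hdir : forall s, mean_curvature_direction m X fol s 0 1 0)
  (HE : forall s, ffE X s 0 = 1)
  (HQ : forall s, d_v X s 0 = cross (unit_normal X s 0) (d_u X s 0))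
  (Hvv : forall s, d_v (d_v X) s 0 =
     scal3 (2 * mean_curv X s 0 - Mcurv m X s 0) (unit_normal X s 0)).

Let regular s := mean_curvature_direction_regular _ _ _ _ _ _ _ (Hdir s).

Let NN s : dot (unit_normal X s 0) (unit_normal X s 0) = 1.
Proof. apply unit_normal_unit, regular. Qed.

Lemma axis_ffF s : ffF X s 0 = 0.
Proof. unfold ffF. rewrite HQ, dot_comm. apply dot_cross_r. Qed.

Lemma axis_ffG s : ffG X s 0 = 1.
Proof.
unfold ffG. rewrite HQ, dot_cross_cross, NN, unit_normal_d_u.
change (dot (d_u X s 0) (d_u X s 0)) with (ffE X s 0). rewrite HE. ring.
Qed.

Lemma axis_qa s : qa X s 0 = 1.
Proof. unfold qa. rewrite HE, axis_ffF, axis_ffG. ring. Qed.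

Lemma axis_sfe s : sfe X s 0 = Mcurv m X s 0.
Proof.
destruct (Hdir s) as (_ & _ & _ & Hn & _). rewrite <- Hn.
unfold normal_curvature, Defs.form1, Defs.form2. rewrite HE. field.
Qed.

Lemma axis_sff s : sff X s 0 = tau_g m X fol s 0.
Proof.
destruct (Hdir s) as (_ & _ & _ & _ & Ht). rewrite <- Ht.
unfold geodesic_torsion. change (ffE X s 0 * ffG X s 0 - ffF X s 0 ^ 2) with (qa X s 0).
unfold Defs.form1, Defs.form2. rewrite axis_qa, sqrt_1, HE, axis_ffF. field.
Qed.

Lemma axis_tau_g_neq0 s : tau_g m X fol s 0 <> 0.
Proof.
rewrite tau_g_eq. apply Rmult_integral_contrapositive_currified.
- destruct fol; simpl; lra.
- apply Rgt_not_eq, sqrt_lt_R0, regular.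
Qed.

Lemma axis_slope_denominator s : slope_denominator m X fol s 0 = 2 * tau_g m X fol s 0.
Proof. unfold slope_denominator. rewrite axis_sff, axis_ffF, axis_qa, sqrt_1. ring. Qed.

Lemma axis_line_slope s : line_slope m X fol s 0 = 0.
Proof. unfold line_slope. rewrite axis_sfe, HE. unfold Rdiv. ring. Qed.

Lemma axis_direction_slope s : locally_2d (fun u v => forall d,
    mean_curvature_direction m X fol u v 1 d <-> d = line_slope m X fol u v) s 0.
Proof.
destruct (regular s) as (H1 & H2 & H3 & H4).
apply locally_direction_slope; auto.
rewrite axis_slope_denominator. pose proof (axis_tau_g_neq0 s). lra.
Qed.

(* The Darboux frame [(T, N /\ T, N)] is orthonormal along the axis; the first-order identities
   come from differentiating its Gram matrix, which gives [E_v = - 2 k_g] and, with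
   [X_uuv . N = tau' - k_g M], also [e_v = tau' - 2 H k_g]. *)
Lemma axis_linearization s : exists om tp tq,
  strict_diff (line_slope m X fol) s 0 0 om /\
  strict_diff (sff X) s 0 tp tq /\
  om + tp / (2 * tau_g m X fol s 0) =
    Derive (fun v => Mcurv m X s v) 0 / (2 * tau_g m X fol s 0)
    + dot (d_u (d_u X) s 0) (cross (unit_normal X s 0) (d_u X s 0)) / tau_g m X fol s 0
      * (mean_curv X s 0 - Mcurv m X s 0).
Proof.
destruct (regular s) as (Hqa & Hdisc & HK & Htau).
pose proof (axis_tau_g_neq0 s) as Hn.
assert (H2 := ex_diff3_n_3_2 _ _ _ (HX s)).
assert (Xu := ex_diff3_n_d_u _ _ _ _ (HX s)). assert (Xv := ex_diff3_n_d_v _ _ _ _ (HX s)).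
assert (Xuu := ex_diff3_n_d_u _ _ _ _ Xu). assert (Xuv := ex_diff3_n_d_v _ _ _ _ Xu).
assert (SXu := ex_diff3_n_strict_diff3 _ _ _ _ Xu). assert (SXv := ex_diff3_n_strict_diff3 _ _ _ _ Xv).
assert (SXuu := ex_diff3_n_strict_diff3 _ _ _ _ Xuu). assert (SXuv := ex_diff3_n_strict_diff3 _ _ _ _ Xuv).
destruct (unit_normal_strict_diff3 X s 0 H2 Hqa) as (Nu & Nv & SN).
assert (Sch := ex_diff3_n_Schwarz _ _ _ H2).
assert (Sch3 := ex_diff3_n_Schwarz _ _ _ Xu).
rewrite Sch in SXv. rewrite Sch3 in SXuv.
set (T := d_u X s 0) in *. set (Q := d_v X s 0) in *. set (N := unit_normal X s 0) in *.
set (A := d_u (d_u X) s 0) in *. set (B := d_v (d_u X) s 0) in *.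
set (A' := d_v (d_u (d_u X)) s 0) in *. set (B' := d_v (d_v (d_u X)) s 0) in *.
set (M := Mcurv m X s 0) in *. set (H := mean_curv X s 0) in *.
set (tau := tau_g m X fol s 0) in *.
assert (eQ : Q = cross N T) by apply HQ.
assert (NT : dot N T = 0) by apply unit_normal_d_u.
assert (NQ : dot N Q = 0) by apply unit_normal_d_v.
assert (eN : dot N N = 1) by apply NN.
assert (eT : dot T T = 1) by apply HE.
assert (AN : dot A N = M) by apply axis_sfe.
assert (BN : dot B N = tau) by apply axis_sff.
(* The coefficient 2 H - M agrees with the trace relation e + g = 2 H of the orthonormal frame,
   where e = M. *)
assert (GN : dot (d_v (d_v X) s 0) N = 2 * H - M).
{ rewrite Hvv, dot_scal3_l. fold N M H. rewrite eN. ring. }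
assert (IE := strict_diff_dot _ _ _ _ _ _ _ _ SXu SXu). fold T in IE.
assert (IF := strict_diff_dot _ _ _ _ _ _ _ _ SXu SXv). fold T Q in IF.
assert (IG := strict_diff_dot _ _ _ _ _ _ _ _ SXv SXv). fold Q in IG.
(* E = 1, G = 1 and F = 0 hold along the axis only, so just their s-derivatives vanish; the one from
   F determines E_v = 2 B . T as - 2 A . Q, where A . Q is k_g. *)
assert (AT : dot A T = 0).
{ pose proof (strict_diff_const_1 _ _ _ _ _ _ IE HE) as E. rewrite (dot_comm T A) in E. lra. }
assert (BQ : dot B Q = 0).
{ pose proof (strict_diff_const_1 _ _ _ _ _ _ IG axis_ffG) as E. rewrite (dot_comm Q B) in E. lra. }
assert (BT : dot B T = - dot A Q).
{ pose proof (strict_diff_const_1 _ _ _ _ _ _ IF axis_ffF) as E. rewrite (dot_comm T B) in E. lra. }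
assert (INN := strict_diff_dot _ _ _ _ _ _ _ _ SN SN). fold N in INN.
assert (INT := strict_diff_dot _ _ _ _ _ _ _ _ SN SXu). fold N T in INT.
assert (INQ := strict_diff_dot _ _ _ _ _ _ _ _ SN SXv). fold N Q in INQ.
(* Unlike the relations above, those involving N hold on a neighbourhood, so both partials
   vanish. *)
destruct (strict_diff_const_loc _ _ _ _ _ 1 INN) as [NuN NvN].
{ generalize (locally_qa_disc X s 0 (HX s) Hqa Hdisc). apply locally_2d_impl, locally_2d_forall.
  intros u v []. now apply unit_normal_unit. }
destruct (strict_diff_const_loc _ _ _ _ _ 0 INT) as [NuT NvT].
{ apply locally_2d_forall. intros. apply unit_normal_d_u. }
destruct (strict_diff_const_loc _ _ _ _ _ 0 INQ) as [NuQ NvQ].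
{ apply locally_2d_forall. intros. apply unit_normal_d_v. }
rewrite (dot_comm N A), AN in NuT. rewrite (dot_comm N B), BN in NvT, NuQ.
rewrite (dot_comm N (d_v _ _ _)), GN in NvQ.
assert (BNu : dot B Nu = dot A Q * M).
{ rewrite (dot_orthonormal N T B Nu eN eT NT), <- eQ, BQ, BT. rewrite (dot_comm N Nu) in NuN.
  replace (dot Nu T) with (- M) by lra. replace (dot Nu N) with 0 by lra. ring. }
assert (ANv : dot A Nv = - dot A Q * (2 * H - M)).
{ rewrite (dot_orthonormal N T A Nv eN eT NT), <- eQ, AT. rewrite (dot_comm N Nv) in NvN.
  replace (dot Nv Q) with (- (2 * H - M)) by lra. replace (dot Nv N) with 0 by lra. ring. }
(* By Schwarz [A'] is both the v-derivative of X_uu and the s-derivative of X_uv; A' . N enters e_v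
   and the s-derivative of [sff] alike, and cancels in their difference. *)
assert (If := strict_diff_dot _ _ _ _ _ _ _ _ SXuv SN). fold N B in If. rewrite BNu in If.
assert (Ie := strict_diff_dot _ _ _ _ _ _ _ _ SXuu SN). fold N A in Ie. rewrite ANv in Ie.
destruct (strict_differentiable_Mcurv m X s 0 hm (HX s) Hqa Hdisc HK) as (Ms & Mv & IM).
destruct (strict_differentiable_slope_denominator m X fol s 0 hm (HX s) Hqa Hdisc HK Htau) as (d1 & d2 & Iden).
assert (eM : Derive (fun v => Mcurv m X s v) 0 = Mv).
{ apply is_derive_unique. exact (strict_diff_is_derive_2 _ _ _ _ _ IM). }
rewrite eM.
assert (Hden : slope_denominator m X fol s 0 <> 0).
{ rewrite axis_slope_denominator. fold tau. lra. }
(* In the quotient rule the derivatives of the denominator are multiplied by the numerator, which is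
   0 on the axis. *)
assert (Islope := strict_diff_div _ _ _ _ _ _ _ _ Hden
  (strict_diff_minus _ _ _ _ _ _ _ _ (strict_diff_mult _ _ _ _ _ _ _ _ IM IE) Ie) Iden).
cbv beta in Islope. fold T A N M in Islope. rewrite AN, eT, axis_slope_denominator in Islope. fold tau in Islope.
assert (Ha := strict_diff_const_1 _ _ _ _ _ _ Islope axis_line_slope).
rewrite Ha in Islope.
do 3 eexists. split; [exact Islope|]. split; [exact If|].
rewrite <- eQ, (dot_comm T B), BT. field. exact Hn.
Qed.

(** With [Derive] as witness the coefficients found at each s become functions of s, as integration
    requires. *)
Lemma axis_linearization_functions : exists om tp : R -> R,
  (forall s, strict_diff (line_slope m X fol) s 0 0 (om s)) /\
  (forall s, is_derive (fun t => sff X t 0) s (tp s)) /\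
  (forall s, continuous tp s) /\
  (forall s, om s + tp s / (2 * tau_g m X fol s 0) =
    Derive (fun v => Mcurv m X s v) 0 / (2 * tau_g m X fol s 0)
    + dot (d_u (d_u X) s 0) (cross (unit_normal X s 0) (d_u X s 0)) / tau_g m X fol s 0
      * (mean_curv X s 0 - Mcurv m X s 0)).
Proof.
exists (fun s => Derive (fun v => line_slope m X fol s v) 0), (fun s => Derive (fun t => sff X t 0) s).
assert (K : forall s, exists tq,
  strict_diff (line_slope m X fol) s 0 0 (Derive (fun v => line_slope m X fol s v) 0) /\
  strict_diff (sff X) s 0 (Derive (fun t => sff X t 0) s) tq /\
  Derive (fun v => line_slope m X fol s v) 0 + Derive (fun t => sff X t 0) s / (2 * tau_g m X fol s 0) =
    Derive (fun v => Mcurv m X s v) 0 / (2 * tau_g m X fol s 0)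
    + dot (d_u (d_u X) s 0) (cross (unit_normal X s 0) (d_u X s 0)) / tau_g m X fol s 0
      * (mean_curv X s 0 - Mcurv m X s 0)).
{ intros s. destruct (axis_linearization s) as (om & tp & tq & H1 & H2 & H3).
  exists tq.
  assert (E1 : Derive (fun v => line_slope m X fol s v) 0 = om)
    by exact (is_derive_unique _ _ _ (strict_diff_is_derive_2 _ _ _ _ _ H1)).
  assert (E2 : Derive (fun t => sff X t 0) s = tp)
    by exact (is_derive_unique _ _ _ (strict_diff_is_derive_1 _ _ _ _ _ H2)).
  rewrite E1, E2. auto. }
split; [intros s; now destruct (K s) as (? & ? & _)|].
split.
{ intros s. destruct (K s) as (? & _ & H & _). exact (strict_diff_is_derive_1 _ _ _ _ _ H). }
split.
- (* the [s]-partial of [sff] is the [v]-partial of [(s, v) |-> sff (s + v) 0] *)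
  apply (strict_diff_partial_continuous (fun u v => sff X (u + v) 0) (fun s => Derive (fun t => sff X t 0) s)).
  intros s. destruct (K s) as (tq & _ & H & _).
  eapply strict_diff_eq.
  + apply (strict_diff_comp (sff X) (fun u v => u + v) (fun _ _ => 0) s 0
      (Derive (fun t => sff X t 0) s) tq 1 1 0 0).
    * now rewrite Rplus_0_r.
    * apply (strict_diff_C1 Rplus (fun _ _ => 1) (fun _ _ => 1)).
      -- apply locally_2d_forall; intros; split; auto_derive; auto; ring.
      -- apply continuity_2d_pt_const.
      -- apply continuity_2d_pt_const.
    * apply strict_diff_const.
  + ring.
  + ring.
- intros s. now destruct (K s) as (? & _ & _ & ?).
Qed.

(* [tau_g] being periodic, [tau_g' / (2 tau_g) = (ln |tau_g| / 2)'] integrates to zero. *)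
Lemma axis_integral (om tp : R -> R) L :
  (forall s, is_derive (fun t => sff X t 0) s (tp s)) -> (forall s, continuous tp s) ->
  (forall s, continuous om s) -> sff X L 0 = sff X 0 0 ->
  is_RInt (fun s => om s + tp s / (2 * tau_g m X fol s 0)) 0 L (RInt om 0 L).
Proof.
intros Htp Ctp Com Hper.
replace (RInt om 0 L) with (plus (RInt om 0 L) 0) by apply Rplus_0_r.
apply (is_RInt_plus (V := R_NormedModule) om (fun s => tp s / (2 * tau_g m X fol s 0))).
- apply (@RInt_correct R_CompleteNormedModule), ex_RInt_continuous. intros; apply Com.
(* On the axis [sff] equals [tau_g] and has the sign of the foliation; the factor [sg] makes the
   argument of [ln] positive for both foliations. *)
- set (sg := foliation_sign fol).
  assert (Hsg : sg ^ 2 = 1) by apply foliation_sign_square.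
  assert (Hpos : forall s, 0 < sg * sff X s 0).
  { intros s. rewrite axis_sff, tau_g_eq. fold sg.
    rewrite <- Rmult_assoc. replace (sg * sg) with 1 by (rewrite <- Hsg; ring).
    rewrite Rmult_1_l. apply sqrt_lt_R0, regular. }
  assert (Hnz : forall s, sff X s 0 <> 0).
  { intros s E. specialize (Hpos s). rewrite E, Rmult_0_r in Hpos. lra. }
  apply is_RInt_ext with (fun s => tp s / (2 * sff X s 0)).
  { intros s _. now rewrite axis_sff. }
  replace 0 with (minus (ln (sg * sff X L 0) / 2) (ln (sg * sff X 0 0) / 2)) at 2
    by (rewrite Hper; apply Rminus_diag).
  apply (is_RInt_derive (V := R_CompleteNormedModule) (fun s => ln (sg * sff X s 0) / 2)).
  + intros s _. pose proof (Htp s) as D. pose proof (Hpos s). pose proof (Hnz s).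
    assert (D' : is_derive (fun t => sg * sff X t 0) s (sg * tp s)) by now apply is_derive_scal.
    assert (Dl : is_derive ln (sg * sff X s 0) (/ (sg * sff X s 0))).
    { apply is_derive_Reals, derivable_pt_lim_ln. assumption. }
    pose proof (is_derive_scal _ _ (/ 2) _ (is_derive_comp _ _ _ _ _ Dl D')) as D2.
    assert (sg <> 0) by (intros E; rewrite E in Hsg; lra).
    evar_last.
    * apply is_derive_ext with (2 := D2). intros t. simpl. field.
    * unfold scal; simpl; unfold mult; simpl. field. auto.
  + intros s _. unfold Rdiv.
    apply (continuous_mult (K := R_AbsRing) tp (fun s => / (2 * sff X s 0))); [apply Ctp|].
    apply (@ex_derive_continuous R_AbsRing R_NormedModule).
    apply ex_derive_inv.
    * apply ex_derive_scal. eexists; apply Htp.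
    * specialize (Hnz s). lra.
Qed.

End AdaptedStrip.

(** * Periodicity of the derivatives and of the second fundamental form *)

Lemma Derive_shift (f g : R -> R) x h : (forall t, f (t + h) = g t) -> Derive f (x + h) = Derive g x.
Proof.
intros H. unfold Derive. f_equal. apply Lim_ext. intros t.
rewrite <- (H x), <- (H (x + t)). now replace (x + t + h) with (x + h + t) by ring.
Qed.

Section Periodic.
Context (L eps : R).

Let periodic (Y : R -> R -> R3) := forall s v, Rabs v < eps -> Y (s + L) v = Y s v.

Lemma periodic_d_u Y : periodic Y -> periodic (d_u Y).
Proof.
intros H s v Hv. unfold d_u, Derive3.
f_equal; [f_equal|]; apply Derive_shift; intros t; now rewrite H.
Qed.

Lemma periodic_d_v Y : periodic Y -> periodic (d_v Y).
Proof.
intros H s v Hv. unfold d_v, Derive3.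
assert (Hl : locally v (fun t => Y (s + L) t = Y s t)).
{ assert (He : 0 < eps - Rabs v) by lra. exists (mkposreal _ He). intros t Ht.
  change (Rabs (t - v) < eps - Rabs v) in Ht. apply H.
  replace t with ((t - v) + v) by ring. eapply Rle_lt_trans; [apply Rabs_triang|]. lra. }
f_equal; [f_equal|]; apply Derive_ext_loc; revert Hl; apply filter_imp; intros t Ht; now rewrite Ht.
Qed.

Lemma periodic_sff X s v : periodic X -> Rabs v < eps -> sff X (s + L) v = sff X s v.
Proof.
intros H Hv. unfold sff, unit_normal.
now rewrite (periodic_d_v _ (periodic_d_u _ H)), (periodic_d_u _ H), (periodic_d_v _ H).
Qed.

End Periodic.

(** * The chart adapted to a closed M-mean curvature line *)

Lemma local_chart_le {V : Type} (S : oriented_surface V) k k' D phi :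
  (k <= k')%nat -> local_chart S k' D phi -> local_chart S k D phi.
Proof.
intros Hk (H1 & H2 & H3). split; [exact H1|]. split; [exact H2|].
intros i x y HD x' y' Hd Hp. destruct (H3 i x y HD x' y' Hd Hp) as (a & b & Ea & Eb & Hloc).
exists a, b. split; [exact Ea|]. split; [exact Eb|].
revert Hloc. apply locally_2d_impl, locally_2d_forall. intros u v (P1 & P2 & P3 & P4 & P5).
split; [exact P1|]. split; [exact P2|]. split; [exact (ex_diff_n_m _ _ Hk _ _ _ P3)|].
split; [exact (ex_diff_n_m _ _ Hk _ _ _ P4)|exact P5].
Qed.

Lemma immersion_local_chart {V : Type} (S : oriented_surface V) (alpha : V -> R3) r k D phi x y :
  immersion S r alpha -> (k <= r)%nat -> local_chart S k D phi -> D x y ->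
  locally_2d (ex_diff3_n (in_chart alpha phi) k) x y.
Proof.
intros Ha Hk Hc HD.
assert (L : forall pr : R3 -> R, (forall i x y, dom S i x y ->
     ex_diff_n (fun u v => pr (in_chart alpha (par S i) u v)) r x y) ->
  locally_2d (ex_diff_n (fun u v => pr (in_chart alpha phi u v)) k) x y).
{ intros pr Hpr. now apply (local_chart_ex_diff_n S alpha pr r k D). }
apply locally_2d_and; [|apply locally_2d_and]; apply L; intros i u v Hd; apply (Ha i u v Hd).
Qed.

Section AdaptedChart.
Context (m : R -> R -> R) (V : Type) (S : oriented_surface V)
    (r : nat) (alpha : V -> R3) (fol : foliation) (c : R -> V) (L eps : R)
    (Phi : R -> R -> V)
    (hr : (6 <= r)%nat)
    (halpha : immersion S r alpha)
    (hc : closed_mean_curvature_line S alpha m fol c L)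
    (hPhi : adapted_chart S alpha m c L eps Phi).

Let X := in_chart alpha Phi.

Let strip_center s : Rabs (s - s) < L / 2 /\ Rabs 0 < eps.
Proof.
rewrite Rminus_diag, Rabs_R0. pose proof (cl_length_pos _ _ _ _ _ _ hc).
pose proof (ac_width _ _ _ _ _ _ _ hPhi). lra.
Qed.

Lemma adapted_chart_regularity s : locally_2d (ex_diff3_n X 3) s 0.
Proof.
apply (immersion_local_chart S alpha r 3 _ Phi s 0 halpha ltac:(lia) (ac_chart _ _ _ _ _ _ _ hPhi s)).
apply strip_center.
Qed.

(** [Phi] is a local chart only on strips of width L; in the strip centred at s the curve reads t
    |-> (t, 0), with velocity (1, 0). *)
Lemma adapted_chart_direction s : mean_curvature_direction m X fol s 0 1 0.
Proof.
destruct (cl_line _ _ _ _ _ _ hc) as [_ Hl].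
specialize (Hl _ Phi (local_chart_le S 2 3 _ _ (Nat.le_succ_diag_r 2) (ac_chart _ _ _ _ _ _ _ hPhi s))
  s (fun t => t) (fun _ => 0)).
rewrite Derive_id, Derive_const in Hl. apply Hl.
assert (HL : 0 < L / 2) by (pose proof (cl_length_pos _ _ _ _ _ _ hc); lra).
exists (mkposreal _ HL). intros t Ht. change (Rabs (t - s) < L / 2) in Ht.
split; [split; [exact Ht|apply (strip_center s)]|].
split; [apply (ac_curve _ _ _ _ _ _ _ hPhi)|].
split; [apply ex_derive_id|]. split; [apply ex_derive_const|].
split.
- apply continuous_ext with (fun _ => 1); [intros; symmetry; apply Derive_id|apply continuous_const].
- apply continuous_ext with (fun _ => 0); [intros; symmetry; apply Derive_const|apply continuous_const].
Qed.

Lemma adapted_chart_tangent s : d_u X s 0 = tangent alpha c s.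
Proof.
unfold d_u, tangent, Derive3, X, in_chart.
f_equal; [f_equal|]; apply Derive_ext; intros t; now rewrite (ac_curve _ _ _ _ _ _ _ hPhi).
Qed.

Lemma adapted_chart_unit_speed s : ffE X s 0 = 1.
Proof.
unfold ffE. rewrite adapted_chart_tangent.
pose proof (cl_arc_length _ _ _ _ _ _ hc s) as H. unfold norm3 in H.
rewrite <- (sqrt_sqrt (dot _ _)) by apply dot_nonneg. rewrite H. ring.
Qed.

(** Each coordinate of X (s, .) is an instance of [expansion_derivatives], because coordinate
    functions are linear. *)
Lemma adapted_chart_d_v s :
  d_v X s 0 = cross (unit_normal X s 0) (d_u X s 0) /\
  d_v (d_v X) s 0 = scal3 (2 * mean_curv X s 0 - Mcurv m X s 0) (unit_normal X s 0).
Proof.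
destruct (ac_expansion _ _ _ _ _ _ _ hPhi) as (A & B & HB0 & HBc & Hexp).
pose proof (ac_width _ _ _ _ _ _ _ hPhi) as Heps.
rewrite adapted_chart_tangent.
assert (K : forall pr : R3 -> R,
  (forall p q v w n, pr (add3 (add3 p (scal3 v q)) (scal3 w n)) = pr p + v * pr q + w * pr n) ->
  locally_2d (ex_diff_n (fun u v => pr (X u v)) 3) s 0 ->
  Derive (fun v => pr (X s v)) 0 = pr (cross (unit_normal X s 0) (tangent alpha c s)) /\
  Derive (Derive (fun v => pr (X s v))) 0 =
    (2 * mean_curv X s 0 - Mcurv m X s 0) * pr (unit_normal X s 0)).
{ intros pr Hpr HX.
  apply (expansion_derivatives (fun v => pr (X s v)) (fun v => B s v) (pr (alpha (c s))) _ _ (A s) _ eps Heps).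
  - specialize (HBc s 0 ltac:(apply (strip_center s))).
    apply filterlim_locally. intros e. exact (locally_2d_1d_const_x _ _ _ (HBc e)).
  - apply HB0.
  - intros v Hv. unfold X. rewrite (Hexp s v Hv). apply Hpr.
  - apply locally_2d_1d_const_x in HX. revert HX. apply filter_imp. intros v Hv; apply Hv.
  - destruct (locally_2d_singleton _ _ _ HX) as (_ & _ & _ & _ & Hd). apply Hd. }
pose proof (adapted_chart_regularity s) as HX.
destruct (K x1) as [K1 K1']; [reflexivity|revert HX; apply locally_2d_impl, locally_2d_forall; intros u v Hd; apply Hd|].
destruct (K x2) as [K2 K2']; [reflexivity|revert HX; apply locally_2d_impl, locally_2d_forall; intros u v Hd; apply Hd|].
destruct (K x3) as [K3 K3']; [reflexivity|revert HX; apply locally_2d_impl, locally_2d_forall; intros u v Hd; apply Hd|].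
split; apply R3_ext; assumption.
Qed.

Lemma adapted_chart_geodesic_curvature s :
  geodesic_curvature alpha c Phi s =
  dot (d_u (d_u X) s 0) (cross (unit_normal X s 0) (d_u X s 0)).
Proof.
unfold geodesic_curvature. rewrite adapted_chart_tangent. f_equal.
change (d_u (d_u X) s 0) with (Derive3 (fun t => d_u X t 0) s). unfold Derive3.
f_equal; [f_equal|]; apply Derive_ext; intros t; now rewrite adapted_chart_tangent.
Qed.

End AdaptedChart.

(** The existence clause keeps the second clause from being vacuous; [is_RInt] includes
    integrability; positivity of the derivative gives the total function [ln] its usual meaning. *)
Theorem proposition2 (m : R -> R -> R) (V : Type) (S : oriented_surface V)
    (r : nat) (alpha : V -> R3) (fol : foliation) (c : R -> V) (L eps : R)
    (Phi : R -> R -> V)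
    (hm : mean_curvature_function m)
    (hS : compact_surface S)
    (hr : (6 <= r)%nat)
    (halpha : immersion S r alpha)
    (hc : closed_mean_curvature_line S alpha m fol c L)
    (hPhi : adapted_chart S alpha m c L eps Phi) :
  (exists P, poincare_map alpha m fol L eps Phi P) /\
  forall P, poincare_map alpha m fol L eps Phi P ->
    ex_derive P 0 /\ 0 < Derive P 0 /\
    is_RInt (fun s =>
      let X := in_chart alpha Phi in
      Mcurv_v alpha m Phi s / (2 * tau_g m X fol s 0)
      + geodesic_curvature alpha c Phi s / tau_g m X fol s 0
        * (mean_curv X s 0 - Mcurv m X s 0))
      0 L (ln (Derive P 0)).
Proof.
pose (X := in_chart alpha Phi).
pose proof (cl_length_pos _ _ _ _ _ _ hc) as HL.
pose proof (ac_width _ _ _ _ _ _ _ hPhi) as Heps.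
assert (HX : forall s, locally_2d (ex_diff3_n X 3) s 0)
  by exact (adapted_chart_regularity m V S r alpha fol c L eps Phi hr halpha hc hPhi).
assert (Hdir : forall s, mean_curvature_direction m X fol s 0 1 0)
  by exact (adapted_chart_direction m V S alpha fol c L eps Phi hc hPhi).
assert (HE : forall s, ffE X s 0 = 1)
  by exact (adapted_chart_unit_speed m V S alpha fol c L eps Phi hc hPhi).
assert (Hv := adapted_chart_d_v m V S r alpha fol c L eps Phi hr halpha hc hPhi). fold X in Hv.
assert (HQ := fun s => proj1 (Hv s)). assert (Hvv := fun s => proj2 (Hv s)). cbv beta in HQ, Hvv.
destruct (axis_linearization_functions m X fol hm HX Hdir HE HQ Hvv) as (om & tp & Hom & Htp & Ctp & Heq).
assert (Hslope0 := axis_line_slope m X fol Hdir HE).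
assert (Hslope := axis_direction_slope m X fol hm HX Hdir HE HQ).
split.
- exact (poincare_map_exists (line_slope m X fol) om
    (fun s v d => mean_curvature_direction m X fol s v 1 d) L eps HL Heps Hslope0 Hom Hslope).
- intros P HP.
  assert (D : is_derive P 0 (exp (RInt om 0 L)))
    by exact (poincare_map_is_derive (line_slope m X fol) om
      (fun s v d => mean_curvature_direction m X fol s v 1 d) L eps HL Hslope0 Hom Hslope P HP).
  rewrite (is_derive_unique _ _ _ D), ln_exp.
  split; [eexists; exact D|]. split; [apply exp_pos|].
  apply is_RInt_ext with (fun s => om s + tp s / (2 * tau_g m X fol s 0)).
  + intros s _. rewrite Heq.
    rewrite (adapted_chart_geodesic_curvature m V S alpha c L eps Phi hPhi).
    reflexivity.
  + apply (axis_integral m X fol Hdir HE HQ); auto.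
    * exact (strict_diff_partial_continuous _ _ _ Hom).
    * rewrite <- (Rplus_0_l L). apply (periodic_sff L eps).
      -- intros s v Hsv. unfold X, in_chart. now rewrite (ac_periodic _ _ _ _ _ _ _ hPhi).
      -- now rewrite Rabs_R0.
Qed.
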